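(* Let $V$ be a shift invariant subspace of $L^2(\mathbb{R})^n$ and let $\Phi\subset V$ be an NTF generator for $V$. Then for every positive (or trace-class) operator $R$ on $\ell^2(\mathbb{Z})^n$ and every $f\in\ell^2(\mathbb{Z})^n$, $$\tau_{V,R}(\xi)=\sum_{\varphi\in\Phi}\langle R\,\mathcal{T}_{per}\varphi(\xi)\,|\,\mathcal{T}_{per}\varphi(\xi)\rangle\quad\text{for a.e. }\xi\in\mathbb{R},$$ $$\tau_{V,f}(\xi)=\sum_{\varphi\in\Phi}|\langle f\,|\,\mathcal{T}_{per}\varphi(\xi)\rangle|^2\quad\text{for a.e. }\xi\in\mathbb{R}.$$
   Context: Setting: fix integers $N\ge 2$, $n\ge 1$, a permutation $\sigma$ of $\{1,\dots,n\}$ and points $z_k=e^{-i\theta_k}$ with $\theta_k\in[-\pi,\pi)$ and $z_k^N=z_{\sigma(k)}$ for all $k\in\{1,\dots,n\}$. On $L^2(\mathbb{R})$ let $T_0f(x)=f(x-1)$. On $L^2(\mathbb{R})^n=L^2(\mathbb{R})\oplus\dots\oplus L^2(\mathbb{R})$ let the translation be $T(f_1,\dots,f_n)=(z_1T_0f_1,\dots,z_nT_0f_n)$. Fourier transform: $\hat f(\xi)=\int_{\mathbb{R}}f(x)e^{-i\xi x}\,dx$ (extended to $L^2(\mathbb{R})$ by density); it is taken componentwise on $L^2(\mathbb{R})^n$. Inner products are linear in the first variable. Fibers: for $\varphi=(\varphi_1,\dots,\varphi_n)\in L^2(\mathbb{R})^n$, $\mathcal{T}_{per}\varphi(\xi)\in\ell^2(\mathbb{Z})^n$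 is given by $\mathcal{T}_{per}\varphi(\xi)(k,i)=\hat\varphi_i(\xi-\theta_i+2k\pi)$, $k\in\mathbb{Z}$, $i\in\{1,\dots,n\}$ (defined for a.e. $\xi\in\mathbb{R}$). A closed subspace $V$ of $L^2(\mathbb{R})^n$ is shift invariant if $T^kV\subset V$ for all $k\in\mathbb{Z}$. Its range function $J_{per}$ is the (a.e. unique) weakly measurable map from $\mathbb{R}$ to closed subspaces of $\ell^2(\mathbb{Z})^n$ with $J_{per}(\xi+2k\pi)=\lambda(k)^*(J_{per}(\xi))$, where $(\lambda(s)\alpha)(k,i)=\alpha(k-s,i)$, such that $V=\{f\in L^2(\mathbb{R})^n: \mathcal{T}_{per}f(\xi)\in J_{per}(\xi)\text{ for a.e. }\xi\}$. The same symbol $J_{per}(\xi)$ denotes the orthogonal projection onto that subspace. A family $(e_i)_{i\in I}$ in a Hilbert space $H$ is a normalized tight frame (NTF) for $H$ if $\sum_i|\langle f\,|\,e_i\rangle|^2=\|f\|^2$ for all $f\in H$. A set $\Phi\subset V$ is an NTF generator for $V$ if the family $\{T^k\varphi: k\in\mathbb{Z},\varphi\in\Phi\}$ (indexed by $(k,\varphi)$) is an NTF for $V$. Local trace function: for a bounded positive (or trace-class) operator $R$ on $\ell^2(\mathbb{Z})^n$, $\tau_{V,R}(\xi)=\operatorname{Trace}(R\,J_{per}(\xi))$, with values in $[0,\infty]$ (resp. $\mathbb{C}$); for positive $R$ this is understood as $\operatorname{Trace}(J_{per}(\xi)RJ_{per}(\xi))$. For $f\in\ell^2(\mathbb{Z})^n$,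 $\tau_{V,f}(\xi)=\tau_{V,P_f}(\xi)$, where $P_f(v)=\langle v\,|\,f\rangle f$. *)

(* Defs.v *)
From HB Require Import structures.
From mathcomp Require Import all_boot all_order all_algebra perm.
From mathcomp Require Import all_classical all_reals all_analysis.
From mathcomp Require Import complex.

Set Implicit Arguments.
Unset Strict Implicit.
Unset Printing Implicit Defensive.
Import Order.TTheory GRing.Theory Num.Theory.
Import numFieldNormedType.Exports.

Local Open Scope classical_set_scope.
Local Open Scope ring_scope.
Local Open Scope complex_scope.

(* The regular module [R[i]^o], so that functions into it are canonically
   modules over [R[i]]. *)
Notation Cplx R := (R[i]^o) (only parsing).

Definition sqnorm {R : realType} (z : R[i]) : R := complex.Re z ^+ 2 + complex.Im z ^+ 2.

Definition expi {R : realType} (t : R) : R[i] := cos t +i* sin t.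

(* Unconditional sum of a complex family over a set of indices; meaningful only
   for absolutely summable families, hence the relation [has_csum]. *)
Definition rsum {R : realType} {I : choiceType} (D : set I) (a : I -> R) : R :=
  fine (\esum_(i in D) (EFin \o a)^\+ i)%E -
  fine (\esum_(i in D) (EFin \o a)^\- i)%E.

Definition csum {R : realType} {I : choiceType} (D : set I) (a : I -> R[i])
    : R[i] :=
  rsum D (fun i => complex.Re (a i)) +i* rsum D (fun i => complex.Im (a i)).

Definition has_csum {R : realType} {I : choiceType} (D : set I)
    (a : I -> R[i]) (s : R[i]) : Prop :=
  [/\ summable D (fun i => (complex.Re (a i))%:E),
      summable D (fun i => (complex.Im (a i))%:E) & csum D a = s].

(* [H] is the ambient space, a subset of [E], and [nsq] its squared norm.  The
   elements of L^2 being represented by functions, closedness also gives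
   saturation of [V] under almost everywhere equality. *)
Definition closed_subspace {R : realType} {E : lmodType R[i]}
    (H : set E) (nsq : E -> \bar R) (V : set E) : Prop :=
  [/\ V `<=` H, V 0,
      (forall (c : R[i]) u v, V u -> V v -> V (c *: u + v)) &
      (forall (u : nat -> E) v, (forall m, V (u m)) -> H v ->
        (nsq (u m - v) @[m --> \oo] --> 0%E) -> V v)].

Section L2.
Context {R : realType}.
Local Notation C := (Cplx R).
Local Notation mu := (@lebesgue_measure R).
Implicit Types f g F : R -> C.

Definition CLfun (p : \bar R) f : Prop :=
  (fun x => complex.Re (f x)) \in Lfun mu p /\ (fun x => complex.Im (f x)) \in Lfun mu p.

Definition cint f : R[i] :=
  Rintegral mu setT (fun x => complex.Re (f x)) +i*
  Rintegral mu setT (fun x => complex.Im (f x)).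

Definition L2nsq f : \bar R := (\int[mu]_x (sqnorm (f x))%:E)%E.

Definition fourier1 f : R -> C := fun xi => cint (fun x => f x * expi (- (xi * x))).

(* [F] is a version of the Fourier transform of [f] in L^2, by density of
   L^1 `&` L^2. *)
Definition is_fourier f F : Prop :=
  CLfun 2%:E F /\
  exists u : nat -> R -> C,
    [/\ (forall m, CLfun 1%:E (u m) /\ CLfun 2%:E (u m)),
        (L2nsq (u m - f) @[m --> \oo] --> 0%E) &
        (L2nsq (fourier1 (u m) - F) @[m --> \oo] --> 0%E)].

(* A fixed version of the Fourier transform, by choice; it depends only on the
   almost everywhere class of [f]. *)
Definition fourier f : R -> C := xget 0 [set F | is_fourier f F].

End L2.

Section L2n.
Context {R : realType} {n : nat}.
Local Notation C := (Cplx R).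
Local Notation mu := (@lebesgue_measure R).
Implicit Types f g : 'I_n -> R -> C.

Definition L2n : set ('I_n -> R -> C) := [set f | forall i, CLfun 2%:E (f i)].

Definition L2n_nsq f : \bar R := (\sum_(i < n) L2nsq (f i))%E.

Definition L2n_inner f g : R[i] :=
  \sum_(i < n) cint (fun x => f i x * (g i x)^*).

Definition NTF {I : choiceType} (D : set I) (e : I -> 'I_n -> R -> C)
    (V : set ('I_n -> R -> C)) : Prop :=
  forall f, V f ->
    (\esum_(i in D) (sqnorm (L2n_inner f (e i)))%:E)%E = L2n_nsq f.

Variable theta : 'I_n -> R.

Definition zpt (i : 'I_n) : R[i] := expi (- theta i).

Definition transl f : 'I_n -> R -> C := fun i x => zpt i * f i (x - 1).

Definition transl_inv f : 'I_n -> R -> C := fun i x => (zpt i)^-1 * f i (x + 1).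

Definition translz (k : int) : ('I_n -> R -> C) -> 'I_n -> R -> C :=
  match k with
  | Posz m => iter m transl
  | Negz m => iter m.+1 transl_inv
  end.

Definition shift_invariant (V : set ('I_n -> R -> C)) : Prop :=
  closed_subspace L2n L2n_nsq V /\
  forall (k : int) f, V f -> V (translz k f).

(* [Phi] is a set of functions: distinct functions that agree almost everywhere
   count separately in the family. *)
Definition NTF_generator (V Phi : set ('I_n -> R -> C)) : Prop :=
  Phi `<=` V /\
  NTF [set p : int * ('I_n -> R -> C) | Phi p.2]
      (fun p => translz p.1 p.2) V.

End L2n.

Section l2.
Context {R : realType} {n : nat}.
Local Notation C := (Cplx R).
Local Notation E := (int * 'I_n -> C).
Implicit Types (a b : E) (W : set E) (A B : E -> E).

Definition l2_nsq a : \bar R := (\esum_(p in [set: int * 'I_n]) (sqnorm (a p))%:E)%E.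

Definition l2 : set E := [set a | (l2_nsq a < +oo)%E].

Definition l2_inner a b : R[i] := csum [set: int * 'I_n] (fun p => a p * (b p)^*).

Definition delta (p : int * 'I_n) : E := fun q => (q == p)%:R.

Definition lambda (s : int) a : E := fun p => a (p.1 - s, p.2).

Definition proj W a : E :=
  xget 0 [set b | W b /\ forall w, W w -> l2_inner (a - b) w = 0].

(* Operators on l^2(Z)^n are functions on [E] of which only the values on [l2]
   matter. *)
Definition bounded_op A : Prop :=
  [/\ (forall a, l2 a -> l2 (A a)),
      (forall (c : R[i]) a b, l2 a -> l2 b -> A (c *: a + b) = c *: A a + A b) &
      exists M : R, forall a, l2 a -> (l2_nsq (A a) <= M%:E * l2_nsq a)%E].

Definition positive_op A : Prop :=
  bounded_op A /\ forall a, l2 a -> 0 <= l2_inner (A a) a.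

Definition is_adjoint A B : Prop :=
  forall a b, l2 a -> l2 b -> l2_inner (A a) b = l2_inner a (B b).

(* [B] is the absolute value of [A], the positive square root of [A^* A]. *)
Definition is_abs_op A B : Prop :=
  positive_op B /\
  exists Astar, [/\ bounded_op Astar, is_adjoint A Astar &
    forall a, l2 a -> B (B a) = Astar (A a)].

Definition trace_pos A : \bar R :=
  (\esum_(p in [set: int * 'I_n]) (complex.Re (l2_inner (A (delta p)) (delta p)))%:E)%E.

Definition trace A : R[i] :=
  csum [set: int * 'I_n] (fun p => l2_inner (A (delta p)) (delta p)).

Definition trace_class A : Prop :=
  bounded_op A /\ exists2 B, is_abs_op A B & (trace_pos B < +oo)%E.

Lemma rsum_lambda (s : int) (h : int * 'I_n -> R) :
  rsum [set: int * 'I_n] (fun p : int * 'I_n => h (p.1 - s, p.2)) = rsum [set: int * 'I_n] h.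
Proof.
have bij : set_bij setT setT (fun p : int * 'I_n => (p.1 - s : int, p.2)).
  split=> [//|[k i] [l j] _ _ [/addIr -> ->] //|[k i] _].
  by exists (k + s, i) => //=; rewrite addrK.
rewrite /rsum (reindex_esum _ _ _ (EFin \o h)^\+%E bij).
rewrite (reindex_esum _ _ _ (EFin \o h)^\-%E bij).
by congr (fine _ - fine _); apply: eq_esum => p _; rewrite ?funeposE ?funenegE.
Qed.

Lemma lambda_adjoint (s : int) : is_adjoint (lambda s) (lambda (- s)).
Proof.
move=> a b _ _; rewrite /l2_inner /csum.
rewrite -(rsum_lambda s (fun p => complex.Re (a p * (lambda (- s) b p)^*))).
rewrite -(rsum_lambda s (fun p => complex.Im (a p * (lambda (- s) b p)^*))).
by congr Complex; congr rsum; apply/funext => -[k i] /=;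
  rewrite /lambda /= opprK subrK.
Qed.

Definition rank1 (f v : E) : E := l2_inner v f *: f.

End l2.

Section range.
Context {R : realType} {n : nat}.
Local Notation C := (Cplx R).
Local Notation E := (int * 'I_n -> C).
Local Notation mu := (@lebesgue_measure R).

Definition lebesgue_measurable_fun (g : R -> R) : Prop :=
  @measurable_fun _ _
    (caratheodory_type ((wlength (@idfun R))^*)%mu)
    (measurableTypeR R) setT g.

Definition weakly_measurable (J : R -> set E) : Prop :=
  forall a b, l2 a -> l2 b ->
    lebesgue_measurable_fun (fun xi => complex.Re (l2_inner (proj (J xi) a) b)) /\
    lebesgue_measurable_fun (fun xi => complex.Im (l2_inner (proj (J xi) a) b)).

Variable theta : 'I_n -> R.

Definition Tper (phi : 'I_n -> R -> C) (xi : R) : E :=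
  fun p => fourier (phi p.2) (xi - theta p.2 + 2 * p.1%:~R * pi).

(* The adjoint of [lambda k] is [lambda (- k)], see [lambda_adjoint]. *)
Definition range_function (V : set ('I_n -> R -> C)) (J : R -> set E) : Prop :=
  [/\ (forall xi, closed_subspace l2 l2_nsq (J xi)),
      weakly_measurable J,
      (forall xi (k : int), J (xi + 2 * k%:~R * pi) = lambda (- k) @` J xi) &
      V = [set f | L2n f /\ {ae mu, forall xi, J xi (Tper f xi)}]].

End range.

Section local_trace.
Context {R : realType} {n : nat}.
Local Notation C := (Cplx R).
Local Notation E := (int * 'I_n -> C).
Implicit Types (J : R -> set E) (A : E -> E).

Definition tau_pos J A (xi : R) : \bar R :=
  trace_pos (fun a => proj (J xi) (A (proj (J xi) a))).

Definition tau J A (xi : R) : R[i] := trace (fun a => A (proj (J xi) a)).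

Definition tau_vec J (f : E) (xi : R) : \bar R := tau_pos J (rank1 f) xi.

End local_trace.

(* Main.v *)
(* Fix f in l^2(Z)^n, a measurable subset E of a period and a real s.  The
   function with fiber 1_E(xi) e^{-i s xi} J_per(xi) f lies in V, and 2 pi times
   its inner product with T^k phi is the Fourier transform of 1_E h_phi at s - k,
   where h_phi(xi) = <f | T_per phi(xi)>.  By the NTF property the sum over k and
   phi of |(1_E h_phi)^(s - k)|^2 is 2 pi int_E |J_per f|^2; averaging over s and
   Plancherel give sum_phi int_E |h_phi|^2 = int_E |J_per f|^2 for every E, so
   that |J_per(xi) f|^2 = sum_phi |<f | T_per phi(xi)>|^2 for a.e. xi.

   Gram-Schmidt for the form <A a | b> of a positive operator A gives
   <A a | a> = sum_j |<a | y_j>|^2, and summing the identity over f = y_j is the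
   trace formula.  For A trace class, applied to |A| it gives
   <A a | c> = sum_j <a | g_j> <h_j | c> with sum |g_j|^2 and sum |h_j|^2 finite,
   and polarization reduces to sums of nonnegative terms. *)
Require Import Defs.
From HB Require Import structures.
From mathcomp Require Import all_boot all_order all_algebra perm.
From mathcomp Require Import all_classical all_reals all_analysis.
From mathcomp Require Import complex.
From mathcomp Require Import measurable_realfun ring lra.

Set Implicit Arguments.
Unset Strict Implicit.
Unset Printing Implicit Defensive.
Import Order.TTheory GRing.Theory Num.Theory.
Import numFieldNormedType.Exports.

Local Open Scope classical_set_scope.
Local Open Scope ring_scope.
Local Open Scope complex_scope.

(** * Plancherel theorem on the real line *)

Section affine_change.
Context {R : realType}.
Local Notation mu := (@lebesgue_measure R).
Local Notation TR := (measurableTypeR R).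

(** The identity for a vector f holds off a null set that depends on f. An operator must therefore
    be reduced to countably many vectors chosen independently of xi; Gram-Schmidt on the coordinate
    basis supplies them without a square root or an eigenbasis of the operator. For a single s the
    NTF property only yields samples of a Fourier transform at the points s - k. Integrating s over
    a period unfolds the sum over k into an integral over the line, so that Plancherel on the line
    takes the place of Fourier series. A function of V with a prescribed fiber exists because the
    Fourier transform is onto. The fiber must be Borel measurable, whereas weak measurability of the
    range function refers to the completed sigma-algebra; hence the passage to Borel versions.
    Plancherel itself rests on the weight e^{-eps |xi|}: its transform is the rational function 2
    eps / (eps^2 + t^2), whose mass, computed by the arctangent, is the constant 2 pi of the
    theorem. *)

Lemma measurable_affine (a b : R) :
  measurable_fun setT (fun x : TR => a * x + b : TR).
Proof. by apply: measurable_funD => //; exact: mulrl_measurable. Qed.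

Local Notation pushforward_measure :=
  measure_function_pushforward__canonical__measure_function_Measure.

(** The pushforward scaled by a gives every half-open interval its length, and Lebesgue measure is
    the only measure that does. *)
Lemma pushforward_affine (a b : R) (A : set R) : 0 < a -> measurable A ->
  pushforward mu (fun x : TR => a * x + b : TR) A = (a^-1%:E * mu A)%E.
Proof.
move=> a0 mA.
pose nu := mscale (NngNum (ltW a0)) (pushforward_measure mu (measurable_affine a b)).
suff H : mu A = nu A.
  rewrite H /nu /mscale /= muleA -EFinM mulVf ?mul1e// gt_eqF//.
apply: lebesgue_measure_unique => // X [[x y] /= _ <-].
rewrite /nu /mscale /= /pushforward.
have -> : (fun x : R => a * x + b) @^-1` `]x, y] = `](x - b) / a, (y - b) / a]%classic.
  apply/seteqP; split => z /=; rewrite !in_itv/= ltr_pdivrMr// ler_pdivlMr//.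
    by rewrite ltrBlDr lerBrDr (mulrC z).
  by rewrite ltrBlDr lerBrDr (mulrC z).
rewrite !lebesgue_measure_itv/= !lte_fin.
rewrite ltr_pM2r ?invr_gt0// ltrD2r; case: ifPn => // xy.
  by rewrite -!EFinB -EFinM; congr EFin; field; rewrite gt_eqF.
by rewrite mule0.
Qed.

Lemma ge0_integral_affine (a b : R) (f : R -> \bar R) : 0 < a ->
  measurable_fun setT f -> (forall x, 0 <= f x)%E ->
  (\int[mu]_x f (a * x + b)%R = a^-1%:E * \int[mu]_x f x)%E.
Proof.
move=> a0 mf f0.
have := @ge0_integral_pushforward _ _ TR TR R (fun x : TR => a * x + b : TR)
  (measurable_affine a b) mu setT f measurableT mf (fun y _ => f0 y).
rewrite preimage_setT /= => <-.
have a0' : 0 <= a^-1 by rewrite invr_ge0 ltW.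
rewrite -(ge0_integral_mscale mu measurableT (NngNum a0') mf (fun x _ => f0 x)).
apply: eq_measure_integral => [|mphi A mA _]; first exact: measurable_affine.
exact: pushforward_affine.
Qed.

Lemma ge0_integral_reflect (f : R -> \bar R) :
  measurable_fun setT f -> (forall x, 0 <= f x)%E ->
  (\int[mu]_x f (- x)%R = \int[mu]_x f x)%E.
Proof.
move=> mf f0.
have := @ge0_integral_pushforward _ _ TR TR R (-%R : _ -> TR)
  (@oppr_measurable R setT) mu setT f measurableT mf (fun y _ => f0 y).
rewrite preimage_setT /= => <-.
by apply: eq_measure_integral => //= A mA _; exact: lebesgue_measureN.
Qed.

Lemma ge0_integral_translate (b : R) (f : R -> \bar R) :
  measurable_fun setT f -> (forall x, 0 <= f x)%E ->
  (\int[mu]_x f (x + b)%R = \int[mu]_x f x)%E.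
Proof.
move=> mf f0; rewrite -[RHS]mul1e -[X in _ = (X%:E * _)%E]invr1.
rewrite -(@ge0_integral_affine 1 b)//.
by under [in RHS]eq_integral do rewrite mul1r.
Qed.

Lemma Rintegral_affine (a b : R) (f : R -> R) : 0 < a ->
  mu.-integrable setT (EFin \o f) ->
  \int[mu]_x f (a * x + b) = a^-1 * \int[mu]_x f x.
Proof.
move=> a0 intf; rewrite /Rintegral -[a^-1 in RHS]/(fine a^-1%:E) -fineM//;
  last exact: integrable_fin_num.
have mf := measurable_int _ intf.
rewrite integralE [X in _ = fine (_ * X)%E]integralE.
rewrite muleBr//; last first.
  apply: fin_num_adde_defl; rewrite fin_numN ge0_fin_numE.
    exact: (integral_funeneg_lt_pinfty measurableT intf).
  by apply: integral_ge0 => x _; exact: funeneg_ge0.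
congr fine; congr (_ - _)%E.
  rewrite -(@ge0_integral_affine a b)//; last exact: measurable_funepos.
  by apply: eq_integral => x _; rewrite !funeposE.
rewrite -(@ge0_integral_affine a b)//; last exact: measurable_funeneg.
by apply: eq_integral => x _; rewrite !funenegE.
Qed.

Lemma Rintegral_translate (b : R) (f : R -> R) :
  measurable_fun setT f -> \int[mu]_x f (x + b) = \int[mu]_x f x.
Proof.
move=> mf; have mf' : measurable_fun setT (EFin \o f) by exact/measurable_EFinP.
rewrite /Rintegral integralE [in RHS]integralE; congr (fine (_ - _)%E).
  transitivity (\int[mu]_x (EFin \o f)^\+ (x + b)%R)%E.
    by apply: eq_integral => x _; rewrite !funeposE.
  by rewrite (ge0_integral_translate b (f := (EFin \o f)^\+%E))//; exact: measurable_funepos.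
transitivity (\int[mu]_x (EFin \o f)^\- (x + b)%R)%E.
  by apply: eq_integral => x _; rewrite !funenegE.
by rewrite (ge0_integral_translate b (f := (EFin \o f)^\-%E))//; exact: measurable_funeneg.
Qed.

Lemma Rintegral_reflect (f : R -> R) :
  measurable_fun setT f -> \int[mu]_x f (- x) = \int[mu]_x f x.
Proof.
move=> mf; have mf' : measurable_fun setT (EFin \o f) by exact/measurable_EFinP.
rewrite /Rintegral integralE [in RHS]integralE; congr (fine (_ - _)%E).
  transitivity (\int[mu]_x (EFin \o f)^\+ (- x)%R)%E.
    by apply: eq_integral => x _; rewrite !funeposE.
  by rewrite (ge0_integral_reflect (f := (EFin \o f)^\+%E))//; exact: measurable_funepos.
transitivity (\int[mu]_x (EFin \o f)^\- (- x)%R)%E.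
  by apply: eq_integral => x _; rewrite !funenegE.
by rewrite (ge0_integral_reflect (f := (EFin \o f)^\-%E))//; exact: measurable_funeneg.
Qed.

Lemma integrable_translate (b : R) (f : R -> R) :
  mu.-integrable setT (EFin \o f) -> mu.-integrable setT (EFin \o (fun x => f (x + b))).
Proof.
move=> /integrableP[/measurable_EFinP mf foo]; apply/integrableP; split.
  apply/measurable_EFinP; apply: (measurableT_comp mf).
  by apply: measurable_funD.
rewrite [ltLHS](_ : _ = \int[mu]_x `|(EFin \o f) x|)%E// -(@ge0_integral_translate b)//.
by apply: measurableT_comp => //; exact/measurable_EFinP.
Qed.

Lemma integrable_reflect (f : R -> R) :
  mu.-integrable setT (EFin \o f) -> mu.-integrable setT (EFin \o (fun x => f (- x))).
Proof.
move=> /integrableP[/measurable_EFinP mf foo]; apply/integrableP; split.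
  apply/measurable_EFinP; apply: (measurableT_comp mf).
  exact: oppr_measurable.
rewrite [ltLHS](_ : _ = \int[mu]_x `|(EFin \o f) x|)%E// -ge0_integral_reflect//.
by apply: measurableT_comp => //; exact/measurable_EFinP.
Qed.

End affine_change.

(** * The Poisson kernel as the transform of an exponential weight *)

Section poisson.
Context {R : realType}.
Local Notation mu := (@lebesgue_measure R).

Lemma is_derive_pair (F : R -> R) (x d : R) :
  is_derive x (1 : R) F d -> derivable F x 1 /\ 'D_1 F x = d.
Proof. by case. Qed.

(** The integrands below may contain [|x|], which is not differentiable at 0: g is the smooth
    expression that agrees with f on the half-line, and F is an antiderivative of g on the whole
    line. Evenness doubles the half-line integral. *)
Lemma integral_even_FTC (f g F : R -> R) (l : R) :
  (forall x, 0 <= f x) -> continuous f -> f =1 f \o -%R ->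
  (forall x, 0 <= x -> f x = g x) ->
  (forall x : R, derivable F x 1 /\ 'D_1 F x = g x) -> F x @[x --> +oo] --> l ->
  (\int[mu]_x (f x)%:E = (2 * (l - F 0))%:E)%E.
Proof.
move=> f0 cf fe fg dF Fl; rewrite ge0_symfun_integralT// EFinM; congr (_ * _)%E.
rewrite -set_itvcy (@ge0_continuous_FTC2y _ f F 0 l)//.
- exact: continuous_subspaceT.
- by move=> x _; case: (dF x).
- apply: cvg_at_right_filter; apply: differentiable_continuous.
  by apply/derivable1_diffP; case: (dF 0).
- move=> x; rewrite in_itv/= andbT => x0.
  by rewrite derive1E (dF x).2 fg// ltW.
Qed.

Lemma measurable_cos : measurable_fun setT (@cos R).
Proof. by apply: continuous_measurable_fun; exact: continuous_cos. Qed.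

Lemma measurable_sin : measurable_fun setT (@sin R).
Proof. by apply: continuous_measurable_fun; exact: continuous_sin. Qed.

Lemma cos_abs_le1 (x : R) : `|cos x| <= 1.
Proof. by rewrite ler_norml cos_geN1 cos_le1. Qed.

Lemma sin_abs_le1 (x : R) : `|sin x| <= 1.
Proof. by rewrite ler_norml sin_geN1 sin_le1. Qed.

Lemma continuous_expRNabs (eps : R) : continuous (fun x : R => expR (- (eps * `|x|))).
Proof.
move=> x; apply: continuous_comp; last exact: continuous_expR.
apply: cvgN; apply: cvgMl_tmp; exact: norm_continuous.
Qed.

Lemma cvg_expRN_bounded (eps C : R) (h : R -> R) : 0 < eps -> (forall x, `|h x| <= C) ->
  expR (- (eps * x)) * h x @[x --> +oo] --> (0 : R).
Proof.
move=> e0 hC.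
have E0 : expR (- (eps * x)) @[x --> +oo] --> (0 : R).
  apply: (cvg_comp (fun x => eps * x) (fun y => expR (- y))) (@cvgr_expR R).
  by apply: gt0_cvgMry => //; exact: cvg_id.
apply/norm_cvg0P; apply: (@squeeze_cvgr _ _ _ _ (cst 0) (fun x => C * expR (- (eps * x)))).
- near=> x; rewrite normr_ge0/= normrM (ger0_norm (expR_ge0 _)) mulrC.
  by rewrite ler_wpM2r// expR_ge0.
- exact: cvg_cst.
- by rewrite -(mulr0 C); apply: cvgMl_tmp.
Unshelve. all: by end_near. Qed.

Lemma integral_expRNabs (eps : R) : 0 < eps ->
  (\int[mu]_x (expR (- (eps * `|x|)))%:E = (2 / eps)%:E)%E.
Proof.
move=> e0; rewrite (@integral_even_FTC _ (fun x => expR (- (eps * x)))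
  (fun x => expR (- (eps * x)) * (- eps^-1)) 0).
- by rewrite mulr0 oppr0 expR0 mul1r opprK add0r.
- by move=> x; exact: expR_ge0.
- exact: continuous_expRNabs.
- by move=> x /=; rewrite normrN.
- by move=> x x0; rewrite ger0_norm.
- move=> x; apply/is_derive_pair; apply: is_derive_eq; rewrite /GRing.scale/=; field.
  by rewrite gt_eqF.
- apply: (@cvg_expRN_bounded eps (eps^-1) (fun=> - eps^-1)) => // _.
  by rewrite normrN ger0_norm// invr_ge0 ltW.
Qed.

(** The Poisson kernel of the half-plane at height eps, multiplied by 2 pi. *)
Definition poisson (eps t : R) := 2 * eps / (eps ^+ 2 + t ^+ 2).

(** The summand 1 makes the integrand nonnegative, as the fundamental theorem on a half-line
    requires; it is subtracted again in [Rintegral_expRNabs_cos]. *)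
Lemma integral_expRNabs_cos1 (eps t : R) : 0 < eps ->
  (\int[mu]_x (expR (- (eps * `|x|)) * (1 + cos (t * x)))%:E = (2 / eps + poisson eps t)%:E)%E.
Proof.
move=> e0.
have d0 : 0 < eps ^+ 2 + t ^+ 2 by rewrite ltr_pwDl ?exprn_gt0// sqr_ge0.
(* The second term of the antiderivative is the real part of e^{(-eps + i t) x} / (-eps + i t). *)
rewrite (@integral_even_FTC _ (fun x => expR (- (eps * x)) * (1 + cos (t * x)))
  (fun x => expR (- (eps * x)) * (- eps^-1 + (t * sin (t * x) - eps * cos (t * x)) / (eps ^+ 2 + t
    ^+ 2))) 0).
- rewrite !mulr0 oppr0 expR0 sin0 cos0 mulr0 mulr1 mul1r sub0r /poisson; congr EFin.
  by field; rewrite !gt_eqF.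
- by move=> x; rewrite mulr_ge0 ?expR_ge0// -lerBlDl sub0r cos_geN1.
- move=> x; apply: cvgM; first exact: continuous_expRNabs.
  apply: cvgD; first exact: cvg_cst.
  apply: (@continuous_comp _ _ _ (fun x => t * x) cos); last exact: continuous_cos.
  by apply: cvgMl_tmp; exact: cvg_id.
- by move=> x /=; rewrite normrN mulrN cosN.
- by move=> x x0; rewrite ger0_norm.
- move=> x; apply/is_derive_pair; apply: is_derive_eq; rewrite /GRing.scale/=; field.
  by rewrite !gt_eqF.
- apply: (@cvg_expRN_bounded eps (eps^-1 + (`|t| + `|eps|) / (eps ^+ 2 + t ^+ 2))) => // x.
  rewrite (le_trans (ler_normD _ _))// lerD//.
    by rewrite normrN ger0_norm// invr_ge0 ltW.
  rewrite normrM normfV (ger0_norm (ltW d0)) ler_pM2r ?invr_gt0//.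
  rewrite (le_trans (ler_normB _ _))// lerD// normrM ler_piMr// ?cos_abs_le1 ?sin_abs_le1//.
Qed.

Lemma integrable_expRNabs (eps : R) : 0 < eps ->
  mu.-integrable setT (EFin \o (fun x => expR (- (eps * `|x|)))).
Proof.
move=> e0; apply/integrableP; split.
  apply/measurable_EFinP; apply: continuous_measurable_fun; exact: continuous_expRNabs.
under eq_integral do rewrite gee0_abs ?lee_fin ?expR_ge0//.
by rewrite integral_expRNabs// ltry.
Qed.

Lemma Rintegral_expRNabs_cos (eps t : R) : 0 < eps ->
  \int[mu]_x (expR (- (eps * `|x|)) * cos (t * x)) = poisson eps t.
Proof.
move=> e0; have i1 := integrable_expRNabs e0.
have i2 : mu.-integrable setT (EFin \o (fun x => expR (- (eps * `|x|)) * (1 + cos (t * x)))).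
  apply/integrableP; split.
    apply/measurable_EFinP; apply: measurable_funM.
      by apply: continuous_measurable_fun; exact: continuous_expRNabs.
    apply: measurable_funD => //; apply: (measurableT_comp measurable_cos).
    exact: mulrl_measurable.
  under eq_integral do rewrite gee0_abs ?lee_fin ?mulr_ge0 ?expR_ge0// -?lerBlDl ?sub0r ?cos_geN1//.
  by rewrite integral_expRNabs_cos1// ltry.
transitivity (\int[mu]_x (expR (- (eps * `|x|)) * (1 + cos (t * x)) - expR (- (eps * `|x|)))).
  by apply: eq_Rintegral => x _; ring.
rewrite RintegralB// /Rintegral integral_expRNabs_cos1// integral_expRNabs//=; ring.
Qed.

Lemma integral_poisson1 : (\int[mu]_x (poisson 1 x)%:E = (2 * pi)%:E)%E.
Proof.
rewrite (@integral_even_FTC _ (poisson 1) (fun x => 2 * atan x) pi).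
- by rewrite atan0 mulr0 subr0.
- by move=> x; rewrite /poisson divr_ge0// addr_ge0 ?sqr_ge0.
- move=> x; rewrite /poisson; apply: cvgMl_tmp; apply: cvgV.
    by rewrite gt_eqF// ltr_pwDl ?exprn_gt0// sqr_ge0.
  apply: cvgD; [exact: cvg_cst|exact: exprn_continuous].
- by move=> x; rewrite /poisson/= sqrrN.
- by [].
- move=> x; apply/is_derive_pair; apply: is_derive_eq; rewrite /GRing.scale/= /poisson expr1n mulr1.
  by [].
- have -> : pi = 2 * (pi / 2) :> R by field.
  apply: cvgMl_tmp; exact: cvgy_atan.
Qed.

Lemma poisson_ge0 (eps t : R) : 0 < eps -> 0 <= poisson eps t.
Proof. by move=> e0; rewrite /poisson divr_ge0 ?mulr_ge0 ?addr_ge0 ?sqr_ge0// ltW. Qed.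

Lemma measurable_poisson (eps : R) : 0 < eps -> measurable_fun setT (poisson eps).
Proof.
move=> e0; apply: continuous_measurable_fun => x.
apply: cvgMl_tmp; apply: cvgV.
  by rewrite gt_eqF// ltr_pwDl ?exprn_gt0// sqr_ge0.
apply: cvgD; [exact: cvg_cst|exact: exprn_continuous].
Qed.

Lemma integrable_poisson1 : mu.-integrable setT (EFin \o poisson 1).
Proof.
apply/integrableP; split; first by apply/measurable_EFinP; exact: measurable_poisson.
under eq_integral do rewrite gee0_abs ?lee_fin ?poisson_ge0//.
by rewrite integral_poisson1 ltry.
Qed.

Lemma poisson_scale (eps u : R) : 0 < eps -> eps * poisson eps (eps * u) = poisson 1 u.
Proof.
move=> e0; rewrite /poisson expr1n; field.
by apply/andP; split; rewrite gt_eqF// ltr_pwDl ?sqr_ge0// exprn_gt0.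
Qed.

End poisson.

(** * Exchange of integrals against a bounded kernel *)

Section fubini_kernel.
Context {R : realType}.
Local Notation mu := (@lebesgue_measure R).
Local Notation TR := (measurableTypeR R).

Lemma measurable_Rintegral_param (h : R * R -> R) : measurable_fun [set: TR * TR] h ->
  measurable_fun setT (fun x : R => \int[mu]_y h (x, y)).
Proof.
move=> mh; rewrite /Rintegral.
have mh' : measurable_fun [set: TR * TR] (EFin \o h) by exact/measurable_EFinP.
apply: measurableT_comp => //.
have -> : (fun x : TR => \int[mu]_y (h (x, y))%:E)%E =
   ((fun x : TR => \int[mu]_y ((EFin \o h)^\+ (x, y))) \- (fun x : TR => \int[mu]_y ((EFin \o
     h)^\- (x, y))))%E.
  apply/funext => x /=; rewrite integralE; congr (_ - _)%E.
    by apply: eq_integral => y _; rewrite !funeposE.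
  by apply: eq_integral => y _; rewrite !funenegE.
apply: emeasurable_funB.
  by apply: (@measurable_fun_fubini_tonelli_F _ _ TR TR R mu) => //; exact: measurable_funepos.
by apply: (@measurable_fun_fubini_tonelli_F _ _ TR TR R mu) => //; exact: measurable_funeneg.
Qed.

Lemma integrableM_bounded (f k : R -> R) (M : R) :
  mu.-integrable setT (EFin \o f) -> measurable_fun setT k -> (forall x, `|k x| <= M) ->
  mu.-integrable setT (EFin \o (fun x => f x * k x)).
Proof.
move=> intf mk kM.
have iM : mu.-integrable setT (fun x => (M%:E * `|(EFin \o f) x|)%E).
  by apply: integrableZl => //; exact: integrable_abse.
have mf : measurable_fun setT f by case/integrableP : intf => /measurable_EFinP.
apply: (le_integrable _ _ _ iM) => //.
  by apply/measurable_EFinP; exact: measurable_funM.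
move=> x _ /=; rewrite lee_fin [X in _ <= X]ger0_norm;
  last by rewrite mulr_ge0// (le_trans _ (kM x)).
by rewrite normrM mulrC ler_wpM2r.
Qed.

Lemma Rintegral_bounded_le (f k : R -> R) (M : R) :
  mu.-integrable setT (EFin \o f) -> measurable_fun setT k -> (forall x, `|k x| <= M) ->
  `|\int[mu]_x (f x * k x)| <= M * \int[mu]_x `|f x|.
Proof.
move=> intf mk kM; have ifk := integrableM_bounded intf mk kM.
apply: (le_trans (le_normr_Rintegral measurableT ifk)).
rewrite -RintegralZl//; last exact: integrable_norm.
apply: le_Rintegral => //.
- exact: (integrable_norm ifk).
- exact: (integrableZl measurableT M (integrable_norm intf)).
- by move=> x _; rewrite normrM mulrC ler_wpM2r.
Qed.

Lemma fubini_kernel_integrable (f g : R -> R) (k : R * R -> R) (M : R) :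
  mu.-integrable setT (EFin \o f) -> mu.-integrable setT (EFin \o g) ->
  measurable_fun [set: TR * TR] k -> (forall z, `|k z| <= M) ->
  (mu \x mu)%E.-integrable [set: TR * TR] (fun z => (f z.1 * (g z.2 * k z))%:E).
Proof.
move=> intf intg mk kM.
have mf : measurable_fun setT f by case/integrableP : intf => /measurable_EFinP.
have mg : measurable_fun setT g by case/integrableP : intg => /measurable_EFinP.
apply/integrable12ltyP => /=.
  apply/measurable_EFinP; apply: measurable_funM.
    exact: (measurableT_comp mf).
  apply: measurable_funM => //; exact: (measurableT_comp mg).
have M0 : 0 <= M by exact: le_trans (kM (0, 0)).
apply: (@le_lt_trans _ _ (\int[mu]_x (M * fine (\int[mu]_y `|g y|%:E)%E * `|f x|)%:E)%E).
  apply: ge0_le_integral => //.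
  - by move=> x _; exact: integral_ge0.
  - apply: (@measurable_fun_fubini_tonelli_F _ _ TR TR R mu (fun z => `|(f z.1 * (g z.2 * k
    z))%:E|)%E) => //.
    apply: measurableT_comp => //; apply/measurable_EFinP; apply: measurable_funM.
      exact: (measurableT_comp mf).
    apply: measurable_funM => //; exact: (measurableT_comp mg).
  - by apply/measurable_EFinP/measurable_funM => //; exact: measurableT_comp.
  - move=> x _; rewrite [leRHS](_ : _ = \int[mu]_y (M * `|f x| * `|g y|)%:E)%E.
      apply: ge0_le_integral => //.
      + apply/measurable_EFinP; apply: measurableT_comp => //; apply: measurable_funM => //.
        apply: measurable_funM => //; apply: (measurableT_comp mk).
        exact: measurable_pair1.
      + by apply/measurable_EFinP/measurable_funM => //; exact: measurableT_comp.
      + move=> y _; rewrite lee_fin !normrM mulrA -mulrA mulrA mulrC -mulrA.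
        by rewrite ler_wpM2r// mulr_ge0.
    have gf : (\int[mu]_y `|g y|%:E)%E \is a fin_num.
      exact: (integrable_fin_num measurableT (integrable_norm intg)).
    under [RHS]eq_integral do rewrite EFinM.
    rewrite integralZl//; last exact: integrable_norm.
    by rewrite -[in RHS](fineK gf) -EFinM; congr EFin; ring.
have := integrableZl measurableT (M * fine (\int[mu]_y `|g y|%:E)%E) (integrable_norm intf).
by move=> /(integrable_lty measurableT).
Qed.

(** The product f(x) g(y) is integrable on the plane, and a bounded factor keeps it so. The
    exchanges of two integrals below are all of this form, the kernel being trigonometric or a
    translate of a bounded function. *)
Lemma fubini_kernel (f g : R -> R) (k : R * R -> R) (M : R) :
  mu.-integrable setT (EFin \o f) -> mu.-integrable setT (EFin \o g) ->
  measurable_fun [set: TR * TR] k -> (forall z, `|k z| <= M) ->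
  \int[mu]_x (f x * \int[mu]_y (g y * k (x, y))) =
  \int[mu]_y (g y * \int[mu]_x (f x * k (x, y))).
Proof.
move=> intf intg mk kM.
have mf : measurable_fun setT f by case/integrableP : intf => /measurable_EFinP.
have mg : measurable_fun setT g by case/integrableP : intg => /measurable_EFinP.
have H := Fubini (fubini_kernel_integrable intf intg mk kM); rewrite /= in H.
have mk1 x : measurable_fun setT (fun y : TR => k (x, y)).
  by apply: (measurableT_comp mk); exact: measurable_pair1.
have mk2 y : measurable_fun setT (fun x : TR => k (x, y)).
  by apply: (measurableT_comp mk); exact: measurable_pair2.
rewrite {1 3}/Rintegral; congr fine.
transitivity (\int[mu]_x \int[mu]_y (f x * (g y * k (x, y)))%:E)%E.
  apply: eq_integral => x _.
  have i1 := integrableM_bounded intg (mk1 x) (fun y => kM (x, y)).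
  rewrite /Rintegral EFinM fineK; last exact: (integrable_fin_num measurableT i1).
  by rewrite -integralZl//; apply: eq_integral => y _.
rewrite H; apply: eq_integral => y _.
have i1 := integrableM_bounded intf (mk2 y) (fun x => kM (x, y)).
rewrite /Rintegral EFinM fineK; last exact: (integrable_fin_num measurableT i1).
rewrite -integralZl//; apply: eq_integral => x _; rewrite -EFinM; congr EFin; ring.
Qed.

End fubini_kernel.

(** * Limit theorems and truncation of values *)

Section limits.
Context {R : realType}.
Local Notation mu := (@lebesgue_measure R).

Lemma ae_imply (P Q : R -> Prop) : (forall x, P x -> Q x) ->
  {ae mu, forall x, P x} -> {ae mu, forall x, Q x}.
Proof.
by move=> PQ; apply: filterS => //; exact: (ae_filter_ringOfSetsType mu).
Qed.

Lemma ae_imply2 (P Q S : R -> Prop) : (forall x, P x -> Q x -> S x) ->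
  {ae mu, forall x, P x} -> {ae mu, forall x, Q x} -> {ae mu, forall x, S x}.
Proof.
by move=> PQ; apply: filterS2 => //; exact: (ae_filter_ringOfSetsType mu).
Qed.

Lemma Rintegral_dct (D : set R) (f_ : nat -> R -> R) (f g : R -> R) : measurable D ->
  (forall n, measurable_fun D (f_ n)) -> measurable_fun D f ->
  (forall x, D x -> f_ ^~ x @ \oo --> f x) ->
  mu.-integrable D (EFin \o g) -> (forall n x, D x -> `|f_ n x| <= g x) ->
  \int[mu]_(x in D) f_ n x @[n --> \oo] --> \int[mu]_(x in D) f x.
Proof.
move=> mD mf_ mf cf ig le_fg.
have [] := @dominated_convergence _ _ R mu D mD (fun n x => (f_ n x)%:E)
    (EFin \o f) (EFin \o g).
- by move=> n; apply/measurable_EFinP; exact: mf_.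
- by apply/measurable_EFinP; exact: mf.
- by apply: aeW => x Dx; apply: cvg_EFin; [exact: nearW|exact: cf].
- by [].
- by apply: aeW => x n Dx; rewrite lee_fin; exact: le_fg.
move=> intf _ H; apply: fine_cvg; rewrite /Rintegral fineK//.
exact: integrable_fin_num.
Qed.

(** Fatou's lemma in the form used throughout: f is almost everywhere the limit inferior of the
    integrands, and the integrals are controlled by a convergent sequence of bounds. *)
Lemma ge0_integral_le_liminf (D : set R) (f_ : nat -> R -> R) (f : R -> R) (c : nat ->
  \bar R) (l : \bar R) :
  measurable D -> (forall n, measurable_fun D (f_ n)) -> (forall n x, D x -> 0 <= f_ n x) ->
  {ae mu, forall x, D x -> f_ ^~ x @ \oo --> f x} -> measurable_fun D f ->
  (forall n, (\int[mu]_(x in D) (f_ n x)%:E <= c n)%E) -> c @ \oo --> l ->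
  (\int[mu]_(x in D) (f x)%:E <= l)%E.
Proof.
move=> mD mf_ f0 cf mf fc cl.
have mef n : measurable_fun D (fun x => (f_ n x)%:E) by exact/measurable_EFinP.
have e1 : {ae mu, forall x, D x -> (f x)%:E = limn_einf (fun n => (f_ n x)%:E)}.
  apply: ae_imply cf => x cf Dx.
  have : (f_ n x)%:E @[n --> \oo] --> (f x)%:E by apply: cvg_EFin; [exact: nearW|exact: cf].
  by move=> /cvg_limn_einf_sup[].
have mlim : measurable_fun D (fun x => limn_einf (fun n => (f_ n x)%:E)).
  have -> : (fun x => limn_einf (fun n => (f_ n x)%:E)) = (fun x => - limn_esup (fun n => - (f_ n
    x)%:E))%E.
    apply/funext => x; rewrite -limn_einfN; congr limn_einf.
    by apply/funext => n /=; rewrite opprK.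
  by apply: measurableT_comp => //; apply: measurable_fun_limn_esup => n; exact: measurableT_comp.
rewrite (@ae_eq_integral _ _ _ mu D (fun x => limn_einf (fun n => (f_ n x)%:E)) (EFin \o f))//;
  last exact/measurable_EFinP.
apply: (le_trans (fatou mu mD mef (fun n x Dx => f0 n x Dx))).
rewrite -(cvg_limn_einf_sup cl).1.
rewrite !limn_einf_lim; apply: lee_lim; [exact: is_cvg_einfs|exact: is_cvg_einfs|].
apply: nearW => n; apply: le_ereal_inf_tmp => _ [m /= nm <-].
by apply: le_trans (fc m); apply: ereal_inf_lbound; exists m.
Qed.

(** For M >= 0 this is the nearest-point map onto [-M, M]; in this form its continuity and its
    Lipschitz constant come from those of the absolute value. *)
Definition clamp (M y : R) := (`|y + M| - `|y - M|) / 2.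

Lemma clamp_id (M y : R) : `|y| <= M -> clamp M y = y.
Proof.
rewrite /clamp ler_norml => /andP[y1 y2].
by rewrite ger0_norm -?lerBlDr ?sub0r// ler0_norm ?subr_le0//; field.
Qed.

Lemma clamp_le (M y : R) : 0 <= M -> `|clamp M y| <= M.
Proof.
move=> M0; rewrite /clamp normrM (ger0_norm (_ : 0 <= 2^-1)) ?invr_ge0// ler_pdivrMr//.
apply: (le_trans (ler_dist_dist _ _)); rewrite [X in `|X|](_ : _ = 2 * M); [rewrite ger0_norm;
  lra|ring].
Qed.

Lemma clamp_lip (M y z : R) : `|clamp M y - clamp M z| <= `|y - z|.
Proof.
have -> : clamp M y - clamp M z = ((`|y + M| - `|z + M|) - (`|y - M| - `|z - M|)) / 2.
  by rewrite /clamp; field.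
rewrite normrM (ger0_norm (_ : 0 <= 2^-1)) ?invr_ge0// ler_pdivrMr//.
rewrite (le_trans (ler_normB _ _))// mulr_natr mulr2n lerD//.
  by rewrite (le_trans (ler_dist_dist _ _))// opprD addrACA subrr addr0.
by rewrite (le_trans (ler_dist_dist _ _))// opprB addrA subrK.
Qed.

Lemma continuous_clamp (M : R) : continuous (clamp M).
Proof.
move=> y; apply: cvgMr_tmp; apply: cvgB.
  by apply: cvg_norm; apply: cvgD; [exact: cvg_id|exact: cvg_cst].
by apply: cvg_norm; apply: cvgB; [exact: cvg_id|exact: cvg_cst].
Qed.

End limits.

(** * The weighted energy of a transform as a Poisson integral *)

Section real_plancherel.
Context {R : realType}.
Local Notation mu := (@lebesgue_measure R).
Local Notation TR := (measurableTypeR R).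

(** For real u the Fourier transform is [cosT u] minus 'i times [sinT u]; working with both parts
    keeps all integrals real. *)
Definition cosT (u : R -> R) (xi : R) := \int[mu]_x (u x * cos (xi * x)).
Definition sinT (u : R -> R) (xi : R) := \int[mu]_x (u x * sin (xi * x)).

Lemma measurable_mulp : measurable_fun [set: TR * TR] (fun z : TR * TR => z.1 * z.2 : TR).
Proof. by apply: measurable_funM. Qed.

Lemma measurable_cosT (u : R -> R) : measurable_fun setT u -> measurable_fun setT (cosT u).
Proof.
move=> mu_; apply: (@measurable_Rintegral_param _ (fun z => u z.2 * cos (z.1 * z.2))).
apply: measurable_funM; first exact: (measurableT_comp mu_).
apply: (measurableT_comp measurable_cos); exact: measurable_mulp.
Qed.

Lemma measurable_sinT (u : R -> R) : measurable_fun setT u -> measurable_fun setT (sinT u).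
Proof.
move=> mu_; apply: (@measurable_Rintegral_param _ (fun z => u z.2 * sin (z.1 * z.2))).
apply: measurable_funM; first exact: (measurableT_comp mu_).
apply: (measurableT_comp measurable_sin); exact: measurable_mulp.
Qed.

Lemma measurable_cosM (xi : R) : measurable_fun setT (fun x : R => cos (xi * x)).
Proof. apply: (measurableT_comp measurable_cos); exact: mulrl_measurable. Qed.

Lemma measurable_sinM (xi : R) : measurable_fun setT (fun x : R => sin (xi * x)).
Proof. apply: (measurableT_comp measurable_sin); exact: mulrl_measurable. Qed.

Lemma integrableM_cos (u : R -> R) (xi : R) : mu.-integrable setT (EFin \o u) ->
  mu.-integrable setT (EFin \o (fun x => u x * cos (xi * x))).
Proof.
by move=> iu; apply: (integrableM_bounded iu (measurable_cosM xi)) => x; exact: cos_abs_le1.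
Qed.

Lemma integrableM_sin (u : R -> R) (xi : R) : mu.-integrable setT (EFin \o u) ->
  mu.-integrable setT (EFin \o (fun x => u x * sin (xi * x))).
Proof.
by move=> iu; apply: (integrableM_bounded iu (measurable_sinM xi)) => x; exact: sin_abs_le1.
Qed.

Lemma cosT_le (u : R -> R) (xi : R) : mu.-integrable setT (EFin \o u) ->
  `|cosT u xi| <= \int[mu]_x `|u x|.
Proof.
move=> iu; have := Rintegral_bounded_le iu (measurable_cosM xi) (fun x => cos_abs_le1 _).
by rewrite mul1r.
Qed.

Lemma sinT_le (u : R -> R) (xi : R) : mu.-integrable setT (EFin \o u) ->
  `|sinT u xi| <= \int[mu]_x `|u x|.
Proof.
move=> iu; have := Rintegral_bounded_le iu (measurable_sinM xi) (fun x => sin_abs_le1 _).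
by rewrite mul1r.
Qed.

(** Expanding the squares gives the double integral of f(x) f(y) cos(xi (x - y)). The weight makes
    the integral in xi absolutely convergent, so it can be carried out first, and it turns the
    cosine into a Poisson kernel. *)
Lemma energy_poisson (f : R -> R) (eps : R) : 0 < eps -> mu.-integrable setT (EFin \o f) ->
  \int[mu]_xi (expR (- (eps * `|xi|)) * (cosT f xi ^+ 2 + sinT f xi ^+ 2)) =
  \int[mu]_x (f x * \int[mu]_y (f y * poisson eps (x - y))).
Proof.
move=> e0 intf.
have mf : measurable_fun setT f by case/integrableP : intf => /measurable_EFinP.
have iE := integrable_expRNabs e0.
pose L := \int[mu]_x `|f x|.
(* At (x, xi) this is the integral of f(y) cos(xi (x - y)) in y; integrating it against f in x
   recovers the energy at xi. *)
pose k1 (z : R * R) := cos (z.2 * z.1) * cosT f z.2 + sin (z.2 * z.1) * sinT f z.2.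
have mk1 : measurable_fun [set: TR * TR] k1.
  have m21 : measurable_fun [set: TR * TR] (fun z : TR * TR => z.2 * z.1 : TR) by exact:
    measurable_funM.
  apply: measurable_funD; apply: measurable_funM.
  - exact: (measurableT_comp measurable_cos).
  - by apply: (measurableT_comp (measurable_cosT mf)).
  - exact: (measurableT_comp measurable_sin).
  - by apply: (measurableT_comp (measurable_sinT mf)).
have k1le z : `|k1 z| <= L + L.
  rewrite (le_trans (ler_normD _ _))// lerD// normrM -[leRHS]mul1r ler_pM//.
  - exact: cos_abs_le1.
  - exact: cosT_le.
  - exact: sin_abs_le1.
  - exact: sinT_le.
transitivity (\int[mu]_xi (expR (- (eps * `|xi|)) * \int[mu]_x (f x * k1 (x, xi)))).
  apply: eq_Rintegral => xi _; congr (_ * _).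
  transitivity (\int[mu]_x (cosT f xi * (f x * cos (xi * x)) + sinT f xi * (f x * sin (xi * x)))).
    rewrite RintegralD//; last 2 first.
      exact: (integrableZl measurableT _ (integrableM_cos xi intf)).
      exact: (integrableZl measurableT _ (integrableM_sin xi intf)).
    rewrite RintegralZl//; last exact: integrableM_cos.
    by rewrite RintegralZl//; last exact: integrableM_sin.
  by apply: eq_Rintegral => x _; rewrite /k1/=; ring.
rewrite -(fubini_kernel intf iE mk1 k1le).
apply: eq_Rintegral => x _; congr (_ * _).
pose k2 (z : R * R) := cos ((x - z.2) * z.1).
have mk2 : measurable_fun [set: TR * TR] k2.
  apply: (measurableT_comp measurable_cos); apply: measurable_funM => //.
  by apply: measurable_funB.
have mk2' y : measurable_fun setT (fun xi : TR => cos ((x - y) * xi)) by exact: measurable_cosM.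
transitivity (\int[mu]_xi (expR (- (eps * `|xi|)) * \int[mu]_y (f y * k2 (xi, y)))).
  apply: eq_Rintegral => xi _; congr (_ * _); rewrite /k1 /k2/=.
  transitivity (\int[mu]_y (cos (xi * x) * (f y * cos (xi * y)) + sin (xi * x) * (f y * sin (xi *
    y)))).
    rewrite RintegralD//; last 2 first.
      exact: (integrableZl measurableT _ (integrableM_cos xi intf)).
      exact: (integrableZl measurableT _ (integrableM_sin xi intf)).
    rewrite RintegralZl//; last exact: integrableM_cos.
    by rewrite RintegralZl//; last exact: integrableM_sin.
  by apply: eq_Rintegral => y _; rewrite mulrBl (mulrC x) (mulrC y) cosB; ring.
rewrite (fubini_kernel iE intf mk2 (fun z => cos_abs_le1 _)).
by apply: eq_Rintegral => y _; rewrite /k2/= Rintegral_expRNabs_cos.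
Qed.

Lemma poisson_le (eps t : R) : 0 < eps -> `|poisson eps t| <= 2 / eps.
Proof.
move=> e0; rewrite ger0_norm ?poisson_ge0// /poisson ler_pdivrMr; last first.
  by rewrite ltr_pwDl ?exprn_gt0// sqr_ge0.
rewrite -mulrA ler_pM2l// mulrDr expr2 mulKf ?gt_eqF// lerDl mulr_ge0 ?sqr_ge0//.
by rewrite invr_ge0 ltW.
Qed.

(** The substitution y = x - eps u moves eps from the kernel into a translation of f, so that the
    limit eps to 0 can be taken under the fixed weight [poisson 1]. *)
Lemma poisson_conv (f : R -> R) (eps x : R) : 0 < eps -> mu.-integrable setT (EFin \o f) ->
  \int[mu]_y (f y * poisson eps (x - y)) = \int[mu]_u (poisson 1 u * f (x - eps * u)).
Proof.
move=> e0 intf.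
have mf : measurable_fun setT f by case/integrableP : intf => /measurable_EFinP.
pose G y := f y * poisson eps (x - y).
have iG : mu.-integrable setT (EFin \o G).
  apply: (@integrableM_bounded _ f (fun y => poisson eps (x - y)) (2 / eps)) => //.
    apply: (measurableT_comp (measurable_poisson e0)); exact: measurable_funB.
  by move=> y; exact: poisson_le.
have iG' : mu.-integrable setT (EFin \o (fun t => G (x - t))).
  have := integrable_reflect (integrable_translate x iG).
  by apply: eq_integrable => // t _ /=; rewrite addrC.
transitivity (\int[mu]_t G (x - t)).
  have mG : measurable_fun setT G by case/integrableP : iG => /measurable_EFinP.
  rewrite -(Rintegral_translate x mG) -(Rintegral_reflect (f := fun t => G (t + x))).
    by apply: eq_Rintegral => t _; rewrite addrC.
  apply: (measurableT_comp mG); exact: measurable_funD.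
have := Rintegral_affine 0 e0 iG'.
move=> /(congr1 (fun z => eps * z)); rewrite mulrA mulfV ?gt_eqF// mul1r => <-.
rewrite -RintegralZl//.
  apply: eq_Rintegral => u _; rewrite addr0 /G subKr.
  by rewrite mulrCA poisson_scale// mulrC.
apply/integrableP; split.
  apply/measurable_EFinP; case/integrableP : iG' => /measurable_EFinP mG' _.
  exact: (measurableT_comp mG' (measurable_affine eps 0)).
have mG' := measurable_int _ iG'.
rewrite (@ge0_integral_affine _ eps 0 (fun t => `|(G (x - t))%:E|)%E)//; last first.
  exact: measurableT_comp.
by case/integrableP : iG' => _ iG'; rewrite lte_mul_pinfty// lee_fin invr_ge0 ltW.
Qed.

(** Continuity of translation in the mean. On a compact set f is close in L^1 to a continuous
    function; clamping its values to [-M, M] does not increase the distance to f and provides the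
    bound for dominated convergence. *)
Lemma autocorrelation_cvg (f : R -> R) (M A : R) (t : nat -> R) :
  measurable_fun setT f -> (forall x, `|f x| <= M) -> (forall x, A < `|x| -> f x = 0) ->
  t @ \oo --> (0 : R) ->
  \int[mu]_x (f x * f (x + t n)) @[n --> \oo] --> \int[mu]_x (f x ^+ 2).
Proof.
move=> mf fM fA t0.
have M0 : 0 <= M by exact: le_trans (fM 0).
(* The margin 1 keeps x + s in E whenever [|x| <= A] and [|s| <= 1]. *)
pose E := `[- A - 1, A + 1]%classic : set R.
have mE : measurable E by exact: measurable_itv.
have Efin : (mu E < +oo)%E.
  by rewrite /E lebesgue_measure_itv/= lte_fin; case: ifP => // _; rewrite -EFinB ltry.
have intf : mu.-integrable setT (EFin \o f).
  have fE : f = f \_ E.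
    apply/funext => x; rewrite patchE; case: ifPn => //; rewrite notin_setE => nE.
    apply: fA; rewrite ltNge; apply/negP => xA; apply: nE; rewrite /E /= in_itv/=.
    by move: xA; rewrite ler_norml => /andP[]; lra.
  rewrite fE -restrict_EFin; have Hk := (integrable_mkcond (mu := mu) (EFin \o f) mE).1; apply: Hk.
  apply: measurable_bounded_integrable => //; first exact: measurable_funTS.
  exists M; split; first exact: num_real.
  by move=> z Mz x _; apply: (le_trans (fM x)); exact: ltW.
have intfE : mu.-integrable E (EFin \o f) by exact: integrableS intf.
have [g_ [cg ig g0]] := approximation_continuous_integrable mE Efin intfE.
apply/cvgrPdist_le => /= e e0.
(* The factor f(x) multiplies the L^1 error by at most M; dividing by M + 1 also covers M = 0. *)
have d0 : 0 < e / 3 / (M + 1) by rewrite !divr_gt0// ltr_wpDl.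
have [n0 g0n] : exists n, (\int[mu]_(z in E) `|(f z - g_ n z)%:E| <= (e / 3 / (M + 1))%:E)%E.
  move: g0 => /fine_cvgP[[m1 _ gfin]] /cvgrPdist_le /(_ _ d0)[m2 _ gle].
  exists (maxn m1 m2).
  have /= := gle (maxn m1 m2) (leq_maxr _ _); rewrite sub0r normrN ger0_norm; last first.
    by apply: fine_ge0; exact: integral_ge0.
  by rewrite -lee_fin fineK//; apply: gfin; exact: leq_maxl.
pose g := clamp M \o g_ n0.
have cg' : continuous g by move=> x; apply: continuous_comp; [exact: cg|exact: continuous_clamp].
have mg : measurable_fun setT g by exact: continuous_measurable_fun.
have gM x : `|g x| <= M by exact: clamp_le.
have fg x : `|f x - g x| <= `|f x - g_ n0 x| by rewrite -{1}(clamp_id (fM x)); exact: clamp_lip.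
pose d := (fun x => `|f x - g x|) \_ E.
have mdE : measurable_fun E (fun x => `|f x - g x|).
  apply: measurable_funTS; apply: measurableT_comp => //; exact: measurable_funB.
have id_ : mu.-integrable setT (EFin \o d).
  rewrite /d -restrict_EFin; have Hk := (integrable_mkcond (mu := mu) (EFin \o (fun x => `|f x - g
    x|)) mE).1; apply: Hk.
  apply: measurable_bounded_integrable => //.
  exists (M + M); split; first exact: num_real.
  move=> z Mz x _ /=; rewrite normr_id (le_trans (ler_normB _ _))// ltW// (le_lt_trans _ Mz)//.
  exact: lerD.
have dle : \int[mu]_x d x <= e / 3 / (M + 1).
  rewrite -lee_fin /Rintegral fineK; last exact: integrable_fin_num.
  apply: le_trans g0n; rewrite [X in (X <= _)%E](_ : _ = \int[mu]_(x in E) `|(f x - g x)|%:E)%E.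
    apply: ge0_le_integral => //.
    - exact/measurable_EFinP.
    - apply: measurableT_comp => //; apply/measurable_EFinP; apply: measurable_funB.
        exact: measurable_funTS.
      by apply: measurable_funTS; exact: continuous_measurable_fun.
    - by move=> x _; rewrite lee_fin; exact: fg.
  by rewrite [RHS]integral_mkcond restrict_EFin.
have d_ge0 x : 0 <= d x by rewrite /d patchE; case: ifP.
have Hd s : `|s| <= 1 -> `|\int[mu]_x ((f (x + s) - g (x + s)) * f x)| <= e / 3.
  move=> s1.
  have mfs : measurable_fun setT (fun x : TR => f (x + s)).
    by apply: (measurableT_comp mf); exact: measurable_funD.
  have mgs : measurable_fun setT (fun x : TR => g (x + s)).
    by apply: (measurableT_comp mg); exact: measurable_funD.
  have ids : mu.-integrable setT (EFin \o (fun x => d (x + s))) by exact: integrable_translate.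
  have ptw x : `|(f (x + s) - g (x + s)) * f x| <= M * d (x + s).
    have [xA|xA] := leP `|x| A.
      rewrite normrM mulrC ler_pM//.
      rewrite /d patchE mem_set// /E /= in_itv/=.
      by move: xA s1; rewrite !ler_norml => /andP[? ?] /andP[? ?]; apply/andP; split; lra.
    by rewrite (fA _ xA) mulr0 normr0 mulr_ge0.
  have iM : mu.-integrable setT (EFin \o (fun x => M * d (x + s))).
    exact: (integrableZl measurableT M ids).
  have i1 : mu.-integrable setT (EFin \o (fun x => (f (x + s) - g (x + s)) * f x)).
    apply: (le_integrable measurableT _ _ iM) => //.
      by apply/measurable_EFinP/measurable_funM => //; exact: measurable_funB.
    move=> x _; rewrite lee_fin (le_trans (ptw x))// ler_norm//.
  apply: (le_trans (le_normr_Rintegral measurableT i1)).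
  apply: (@le_trans _ _ (\int[mu]_x (M * d (x + s)))).
    by apply: le_Rintegral => //; exact: (integrable_norm i1).
  rewrite RintegralZl// Rintegral_translate; last by case/integrableP : id_ => /measurable_EFinP.
  apply: (@le_trans _ _ ((M + 1) * (e / 3 / (M + 1)))).
    by rewrite ler_pM// ?lerDl// Rintegral_ge0.
  by rewrite mulrC divfK// gt_eqF// ltr_wpDl.
have ifg s : mu.-integrable setT (EFin \o (fun x => f x * f (x + s))).
  apply: (integrableM_bounded intf _ (fun x => fM (x + s))).
  by apply: (measurableT_comp mf); exact: measurable_funD.
have ifgg s : mu.-integrable setT (EFin \o (fun x => f x * g (x + s))).
  apply: (integrableM_bounded intf _ (fun x => gM (x + s))).
  by apply: (measurableT_comp mg); exact: measurable_funD.
have split_ s : \int[mu]_x (f x * f (x + s)) =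
    \int[mu]_x ((f (x + s) - g (x + s)) * f x) + \int[mu]_x (f x * g (x + s)).
  have -> : \int[mu]_x ((f (x + s) - g (x + s)) * f x) =
     \int[mu]_x (f x * f (x + s) - f x * g (x + s)) by apply: eq_Rintegral => x _; ring.
  by rewrite RintegralB// subrK.
have cvgg : \int[mu]_x (f x * g (x + t n)) @[n --> \oo] --> \int[mu]_x (f x * g (x + 0)).
  apply: (@Rintegral_dct _ setT (fun n x => f x * g (x + t n)) _ (fun x => M * `|f x|)) => //.
  - by move=> n; apply: measurable_funM => //; apply: (measurableT_comp mg); exact: measurable_funD.
  - by apply: measurable_funM => //; apply: (measurableT_comp mg); exact: measurable_funD.
  - move=> x _; apply: cvgMl_tmp; apply: (cvg_comp (fun n => x + t n) g); last exact: cg'.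
    by apply: cvgD => //; exact: cvg_cst.
  - exact: (integrableZl measurableT M (integrable_norm intf)).
  - by move=> n x _; rewrite normrM mulrC ler_wpM2r.
have -> : \int[mu]_x (f x ^+ 2) = \int[mu]_x (f x * f (x + 0)).
  by apply: eq_Rintegral => x _; rewrite addr0.
move/cvgrPdist_le : cvgg => /(_ (e / 3) _)[|n1 _ H1]; first by rewrite divr_gt0.
move/cvgrPdist_le : t0 => /(_ 1 ltr01)[n2 _ H2].
exists (maxn n1 n2) => // n /= nn.
rewrite !split_.
have := H1 n (leq_trans (leq_maxl _ _) nn); have := H2 n (leq_trans (leq_maxr _ _) nn) => /=.
rewrite sub0r normrN => tn1 H3.
have h0 := Hd 0; rewrite normr0 in h0; have {}h0 := h0 ler01.
have hn := Hd _ tn1.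
move: h0 hn H3; set a := \int[mu]_x (_ * _); set b := \int[mu]_x (_ * _);
  set c := \int[mu]_x (_ * _).
set a' := \int[mu]_x (_ * _).
rewrite !ler_norml => /andP[? ?] /andP[? ?] /andP[? ?]; apply/andP; split; lra.
Qed.

End real_plancherel.

(** * Plancherel for real functions in L^1 and L^2 *)

Section real_plancherel2.
Context {R : realType}.
Local Notation mu := (@lebesgue_measure R).
Local Notation TR := (measurableTypeR R).

Definition spec (f : R -> R) (xi : R) := cosT f xi ^+ 2 + sinT f xi ^+ 2.

Lemma spec_ge0 f xi : 0 <= spec f xi.
Proof. by rewrite addr_ge0// sqr_ge0. Qed.

Lemma measurable_spec f : measurable_fun setT f -> measurable_fun setT (spec f).
Proof.
move=> mf; apply: measurable_funD; apply: measurable_funX.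
  exact: measurable_cosT.
exact: measurable_sinT.
Qed.

Lemma bounded_support_integrable (f : R -> R) (M A : R) :
  measurable_fun setT f -> (forall x, `|f x| <= M) -> (forall x, A < `|x| -> f x = 0) ->
  mu.-integrable setT (EFin \o f).
Proof.
move=> mf fM fA; pose E := `[- A, A]%classic : set R.
have mE : measurable E by exact: measurable_itv.
have Efin : (mu E < +oo)%E.
  by rewrite /E lebesgue_measure_itv/= lte_fin; case: ifP => // _; rewrite -EFinB ltry.
have fE : f = f \_ E.
  apply/funext => x; rewrite patchE; case: ifPn => //; rewrite notin_setE => nE.
  apply: fA; rewrite ltNge; apply/negP => xA; apply: nE; rewrite /E /= in_itv/=.
  by rewrite -ler_norml.
rewrite fE -restrict_EFin; have Hk := (integrable_mkcond (mu := mu) (EFin \o f) mE).1; apply: Hk.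
apply: measurable_bounded_integrable => //; first exact: measurable_funTS.
exists M; split; first exact: num_real.
by move=> z Mz x _; apply: (le_trans (fM x)); exact: ltW.
Qed.

Lemma cvg_invS : (n.+1%:R^-1 : R) @[n --> \oo] --> (0 : R).
Proof. exact: cvg_harmonic. Qed.

(* Abel summation: the transform of the weight [expR (- e * `|xi|)] is a Poisson kernel. *)
Lemma energy_cvg (f : R -> R) (M A : R) :
  measurable_fun setT f -> (forall x, `|f x| <= M) -> (forall x, A < `|x| -> f x = 0) ->
  \int[mu]_xi (expR (- (n.+1%:R^-1 * `|xi|)) * spec f xi) @[n --> \oo] -->
  2 * pi * \int[mu]_x (f x ^+ 2).
Proof.
move=> mf fM fA; have intf := bounded_support_integrable mf fM fA.
have M0 : 0 <= M by exact: le_trans (fM 0).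
have e0 n : 0 < n.+1%:R^-1 :> R by [].
pose k (e : R) (z : R * R) := f (z.1 - e * z.2).
have mk e : measurable_fun [set: TR * TR] (k e).
  apply: (measurableT_comp mf); apply: measurable_funB => //; exact: measurable_funM.
have -> : (fun n => \int[mu]_xi (expR (- (n.+1%:R^-1 * `|xi|)) * spec f xi)) =
    (fun n => \int[mu]_u (poisson 1 u * \int[mu]_x (f x * f (x - n.+1%:R^-1 * u)))).
  apply/funext => n; rewrite [LHS](energy_poisson (e0 n) intf).
  transitivity (\int[mu]_x (f x * \int[mu]_u (poisson 1 u * k n.+1%:R^-1 (x, u)))).
    by apply: eq_Rintegral => x _; rewrite poisson_conv.
  exact: (fubini_kernel intf integrable_poisson1 (mk _) (fun z => fM _)).
have -> : 2 * pi * \int[mu]_x (f x ^+ 2) = \int[mu]_u (poisson 1 u * \int[mu]_x (f x ^+ 2)).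
  rewrite RintegralZr//; last exact: integrable_poisson1.
  by congr (_ * _); rewrite /Rintegral integral_poisson1.
have bnd n u : `|\int[mu]_x (f x * f (x - n.+1%:R^-1 * u))| <= M * \int[mu]_x `|f x|.
  apply: Rintegral_bounded_le => //.
  by apply: (measurableT_comp mf); exact: measurable_funB.
apply: (@Rintegral_dct _ setT _ _ (fun u => M * (\int[mu]_x `|f x|) * poisson 1 u)) => //.
- move=> n; apply: measurable_funM; first exact: measurable_poisson.
  apply: (@measurable_Rintegral_param _ (fun z => f z.2 * f (z.2 - n.+1%:R^-1 * z.1))).
  apply: measurable_funM; first exact: (measurableT_comp mf).
  by apply: (measurableT_comp mf); apply: measurable_funB => //; exact: measurable_funM.
- apply: measurable_funM => //; exact: measurable_poisson.
- move=> u _; apply: cvgMl_tmp.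
  apply: (autocorrelation_cvg (t := fun n => - (n.+1%:R^-1 * u)) mf fM fA).
  by rewrite -oppr0 -(mul0r u); apply: cvgN; apply: cvgMr_tmp; exact: cvg_invS.
- exact: (integrableZl measurableT _ integrable_poisson1).
- by move=> n u _; rewrite normrM mulrC (ger0_norm (poisson_ge0 _ _))// ler_wpM2r// poisson_ge0.
Qed.

(** The weighted energies increase to the full energy by monotone convergence, while [energy_cvg]
    computes their limit from the Poisson side. *)
Lemma plancherel_bounded (f : R -> R) (M A : R) :
  measurable_fun setT f -> (forall x, `|f x| <= M) -> (forall x, A < `|x| -> f x = 0) ->
  (\int[mu]_xi (spec f xi)%:E = (2 * pi * \int[mu]_x (f x ^+ 2))%:E)%E.
Proof.
move=> mf fM fA; have intf := bounded_support_integrable mf fM fA.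
have e0 n : 0 < n.+1%:R^-1 :> R by [].
pose g (n : nat) (xi : R) := (expR (- (n.+1%:R^-1 * `|xi|)) * spec f xi)%:E.
have mg n : measurable_fun setT (g n).
  apply/measurable_EFinP; apply: measurable_funM.
    by apply: continuous_measurable_fun; exact: continuous_expRNabs.
  exact: measurable_spec.
have c1 := cvg_monotone_convergence (mu := mu) measurableT mg
  (fun n x _ => _ : 0 <= g n x)%E.
have {}c1 : (\int[mu]_x g n x @[n --> \oo] --> \int[mu]_x (spec f x)%:E)%E.
  under [X in _ --> X]eq_integral => x _.
    have -> : (spec f x)%:E = limn (g^~ x).
      apply/esym/cvg_lim => //; apply: cvg_EFin; first exact: nearW.
      rewrite /= -[spec f x in X in _ --> X]mul1r; apply: cvgMr_tmp.
      have h1 : - (n.+1%:R^-1 * `|x|) @[n --> \oo] --> (0 : R).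
        by rewrite -oppr0 -[X in - X](mul0r `|x|); apply: cvgN; apply: cvgMr_tmp; exact: cvg_invS.
      by have := cvg_comp _ _ h1 (@continuous_expR R 0); rewrite expR0.
    over.
  apply: c1.
    by move=> n x; rewrite lee_fin mulr_ge0 ?expR_ge0 ?spec_ge0.
  move=> x _ n m nm; rewrite lee_fin ler_wpM2r ?spec_ge0// ler_expR lerN2 ler_wpM2r//.
  by rewrite lef_pV2 ?posrE// ler_nat.
have c2 : (\int[mu]_x g n x @[n --> \oo] --> (2 * pi * \int[mu]_x (f x ^+ 2))%:E)%E.
  have -> : (fun n => \int[mu]_x g n x)%E =
     (fun n => (\int[mu]_xi (expR (- (n.+1%:R^-1 * `|xi|)) * spec f xi))%:E).
    apply/funext => n; rewrite /Rintegral fineK//.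
    pose L := \int[mu]_x `|f x|.
    apply: integrable_fin_num => //.
    apply: (@integrableM_bounded _ _ (spec f) (L ^+ 2 + L ^+ 2)).
    - exact: integrable_expRNabs.
    - exact: measurable_spec.
    - have L0 : 0 <= L by exact: Rintegral_ge0.
      move=> x; rewrite ger0_norm ?spec_ge0// /spec lerD// -(real_normK (num_real _)) lerXn2r
        ?nnegrE//.
        exact: cosT_le.
      exact: sinT_le.
  by apply: cvg_EFin; [exact: nearW|exact: (energy_cvg mf fM fA)].
exact: (cvg_unique _ c1 c2).
Qed.

Lemma cvg_sqr (u : nat -> R) (a : R) : u @ \oo --> a -> u n ^+ 2 @[n --> \oo] --> a ^+ 2.
Proof. by move=> ua; under eq_fun do rewrite expr2; rewrite expr2; exact: cvgM. Qed.

Definition trunc (f : R -> R) (n : nat) (x : R) :=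
  if (`|x| <= n%:R) && (`|f x| <= n%:R) then f x else 0.

Lemma measurable_trunc f n : measurable_fun setT f -> measurable_fun setT (trunc f n).
Proof.
move=> mf; apply: measurable_fun_ifT => //.
apply: measurable_and; apply: measurable_fun_ler => //; exact: measurableT_comp.
Qed.

Lemma trunc_norm f n x : `|trunc f n x| <= `|f x|.
Proof. by rewrite /trunc; case: ifP => // _; rewrite normr0. Qed.

Lemma trunc_le f n x : `|trunc f n x| <= n%:R.
Proof. by rewrite /trunc; case: ifP => [/andP[]//|_]; rewrite normr0. Qed.

Lemma trunc_supp f n x : n%:R < `|x| -> trunc f n x = 0.
Proof. by rewrite /trunc ltNge => /negPf ->. Qed.

Lemma trunc_near f x : \forall n \near \oo, trunc f n x = f x.
Proof.
near=> n; rewrite /trunc.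
have -> : `|x| <= n%:R by near: n; exact: nbhs_infty_ger.
by have -> : `|f x| <= n%:R by near: n; exact: nbhs_infty_ger.
Unshelve. all: by end_near. Qed.

Lemma trunc_cvg f x : trunc f n x @[n --> \oo] --> f x.
Proof. by apply: cvg_near_cst; exact: trunc_near. Qed.

Lemma cosT_cvg (f : R -> R) (f_ : nat -> R -> R) xi : mu.-integrable setT (EFin \o f) ->
  (forall n, measurable_fun setT (f_ n)) -> (forall n x, `|f_ n x| <= `|f x|) ->
  (forall x, f_ n x @[n --> \oo] --> f x) -> cosT (f_ n) xi @[n --> \oo] --> cosT f xi.
Proof.
move=> intf mf_ le_f cf; apply: (@Rintegral_dct _ setT _ _ (fun x => `|f x|)) => //.
- by move=> n; apply: measurable_funM => //; exact: measurable_cosM.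
- by apply: measurable_funM; [case/integrableP : intf => /measurable_EFinP|exact: measurable_cosM].
- by move=> x _; exact: cvgMr_tmp.
- exact: integrable_norm.
- by move=> n x _; rewrite normrM -[leRHS]mulr1 ler_pM// cos_abs_le1.
Qed.

Lemma sinT_cvg (f : R -> R) (f_ : nat -> R -> R) xi : mu.-integrable setT (EFin \o f) ->
  (forall n, measurable_fun setT (f_ n)) -> (forall n x, `|f_ n x| <= `|f x|) ->
  (forall x, f_ n x @[n --> \oo] --> f x) -> sinT (f_ n) xi @[n --> \oo] --> sinT f xi.
Proof.
move=> intf mf_ le_f cf; apply: (@Rintegral_dct _ setT _ _ (fun x => `|f x|)) => //.
- by move=> n; apply: measurable_funM => //; exact: measurable_sinM.
- by apply: measurable_funM; [case/integrableP : intf => /measurable_EFinP|exact: measurable_sinM].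
- by move=> x _; exact: cvgMr_tmp.
- exact: integrable_norm.
- by move=> n x _; rewrite normrM -[leRHS]mulr1 ler_pM// sin_abs_le1.
Qed.

Lemma cosTD (f g : R -> R) xi : mu.-integrable setT (EFin \o f) ->
  mu.-integrable setT (EFin \o g) ->
  cosT (fun x => f x + g x) xi = cosT f xi + cosT g xi.
Proof.
move=> intf intg; rewrite /cosT -RintegralD//; [|exact: integrableM_cos|exact: integrableM_cos].
by apply: eq_Rintegral => x _; rewrite mulrDl.
Qed.

Lemma sinTD (f g : R -> R) xi : mu.-integrable setT (EFin \o f) ->
  mu.-integrable setT (EFin \o g) ->
  sinT (fun x => f x + g x) xi = sinT f xi + sinT g xi.
Proof.
move=> intf intg; rewrite /sinT -RintegralD//; [|exact: integrableM_sin|exact: integrableM_sin].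
by apply: eq_Rintegral => x _; rewrite mulrDl.
Qed.

Lemma cosTZ (f : R -> R) c xi : mu.-integrable setT (EFin \o f) ->
  cosT (fun x => c * f x) xi = c * cosT f xi.
Proof.
move=> intf; rewrite /cosT -RintegralZl//; last exact: integrableM_cos.
by apply: eq_Rintegral => x _; rewrite mulrA.
Qed.

Lemma sinTZ (f : R -> R) c xi : mu.-integrable setT (EFin \o f) ->
  sinT (fun x => c * f x) xi = c * sinT f xi.
Proof.
move=> intf; rewrite /sinT -RintegralZl//; last exact: integrableM_sin.
by apply: eq_Rintegral => x _; rewrite mulrA.
Qed.

Lemma specD (f g : R -> R) xi : mu.-integrable setT (EFin \o f) ->
  mu.-integrable setT (EFin \o g) ->
  spec (fun x => f x + g x) xi = (cosT f xi + cosT g xi) ^+ 2 + (sinT f xi + sinT g xi) ^+ 2.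
Proof. by move=> intf intg; rewrite /spec cosTD// sinTD. Qed.

(** The transforms of the truncations converge at every point, and Fatou then gives one
    inequality. *)
Lemma plancherel_le (f : R -> R) : mu.-integrable setT (EFin \o f) ->
  mu.-integrable setT (EFin \o (fun x => f x ^+ 2)) ->
  (\int[mu]_xi (spec f xi)%:E <= (2 * pi * \int[mu]_x (f x ^+ 2))%:E)%E.
Proof.
move=> intf intf2.
have mf : measurable_fun setT f by case/integrableP : intf => /measurable_EFinP.
have c1 : \int[mu]_x (trunc f n x ^+ 2) @[n --> \oo] --> \int[mu]_x (f x ^+ 2).
  apply: (@Rintegral_dct _ setT _ _ (fun x => f x ^+ 2)) => //.
  - by move=> n; apply: measurable_funX; exact: measurable_trunc.
  - exact: measurable_funX.
  - by move=> x _; apply: cvg_sqr; exact: trunc_cvg.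
  - by move=> n x _; rewrite normrX -(real_normK (num_real (f x))) lerXn2r ?nnegrE// trunc_norm.
apply: (@ge0_integral_le_liminf _ setT (fun n => spec (trunc f n)) (spec f)
  (fun n => (2 * pi * \int[mu]_x (trunc f n x ^+ 2))%:E)) => //.
- by move=> n; apply: measurable_spec; exact: measurable_trunc.
- by move=> n x _; exact: spec_ge0.
- apply: aeW => xi _; apply: cvgD; apply: cvg_sqr.
    by apply: cosT_cvg => // [n|n x|x]; [exact: measurable_trunc|exact: trunc_norm|exact:
      trunc_cvg].
  by apply: sinT_cvg => // [n|n x|x]; [exact: measurable_trunc|exact: trunc_norm|exact: trunc_cvg].
- exact: measurable_spec.
- move=> n; rewrite (@plancherel_bounded _ n%:R n%:R)//.
  + exact: measurable_trunc.
  + exact: trunc_le.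
  + by move=> x; exact: trunc_supp.
- by apply: cvg_EFin; [exact: nearW|exact: cvgMl_tmp].
Qed.

Lemma integrable_mul (f g : R -> R) :
  measurable_fun setT f -> measurable_fun setT g ->
  mu.-integrable setT (EFin \o (fun x => f x ^+ 2)) ->
  mu.-integrable setT (EFin \o (fun x => g x ^+ 2)) ->
  mu.-integrable setT (EFin \o (fun x => f x * g x)).
Proof.
move=> mf mg if2 ig2; have iS := integrableD measurableT if2 ig2.
apply: (le_integrable measurableT _ _ iS).
  by apply/measurable_EFinP; exact: measurable_funM.
move=> x _ /=; rewrite lee_fin [leRHS]ger0_norm ?addr_ge0 ?sqr_ge0// normrM.
rewrite -(real_normK (num_real (f x))) -(real_normK (num_real (g x))).
have := sqr_ge0 (`|f x| - `|g x|); have := sqr_ge0 `|f x|; have := sqr_ge0 `|g x|.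
rewrite sqrrB; nra.
Qed.

Lemma integrable_sqD (f g : R -> R) (a b : R) :
  measurable_fun setT f -> measurable_fun setT g ->
  mu.-integrable setT (EFin \o (fun x => f x ^+ 2)) ->
  mu.-integrable setT (EFin \o (fun x => g x ^+ 2)) ->
  mu.-integrable setT (EFin \o (fun x => (a * f x + b * g x) ^+ 2)).
Proof.
move=> mf mg if2 ig2.
have -> : (fun x => (a * f x + b * g x) ^+ 2) =
  (fun x => a ^+ 2 * f x ^+ 2 + (b ^+ 2 * g x ^+ 2 + 2 * a * b * (f x * g x))).
  by apply/funext => x; ring.
have i1 := integrableZl measurableT (a ^+ 2) if2.
have i2 := integrableZl measurableT (b ^+ 2) ig2.
have i3 := integrableZl measurableT (2 * a * b) (integrable_mul mf mg if2 ig2).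
exact: (integrableD measurableT i1 (integrableD measurableT i2 i3)).
Qed.

Lemma plancherel_aux (P a s t d N : R) : a + s = 2 * t + 2 * d ->
  2 * (2 * P * t) <= N + 2 * P * s -> 2 * P * a <= N + 4 * P * d.
Proof.
move=> /eqP; rewrite addrC -subr_eq0 => /eqP H; have {H}-> : s = 2 * t + 2 * d - a by lra.
lra.
Qed.

(** Write f = t + D with t a truncation. In the parallelogram law for [spec], the exact energy of t
    and the upper bound [plancherel_le] for t - D leave a lower bound for the energy of f, with an
    error controlled by the integral of D^2, which tends to 0. *)
Lemma plancherel_real (f : R -> R) : mu.-integrable setT (EFin \o f) ->
  mu.-integrable setT (EFin \o (fun x => f x ^+ 2)) ->
  (\int[mu]_xi (spec f xi)%:E = (2 * pi * \int[mu]_x (f x ^+ 2))%:E)%E.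
Proof.
move=> intf intf2; apply/eqP; rewrite eq_le plancherel_le//=.
have mf : measurable_fun setT f by case/integrableP : intf => /measurable_EFinP.
have mt n := measurable_trunc n mf.
have it n : mu.-integrable setT (EFin \o trunc f n).
  apply: (le_integrable measurableT _ _ intf); first by apply/measurable_EFinP; exact: mt.
  by move=> x _; rewrite lee_fin trunc_norm.
have it2 n : mu.-integrable setT (EFin \o (fun x => trunc f n x ^+ 2)).
  apply: (le_integrable measurableT _ _ intf2).
    by apply/measurable_EFinP; apply: measurable_funX; exact: mt.
  by move=> x _; rewrite lee_fin !normrX lerXn2r ?nnegrE// trunc_norm.
pose D n x := f x - trunc f n x.
have DE n : D n = (fun x => 1 * f x + (-1) * trunc f n x) by apply/funext => x; rewrite /D; ring.
have mD n : measurable_fun setT (D n) by exact: measurable_funB.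
have iD n : mu.-integrable setT (EFin \o D n) by exact: (integrableB measurableT intf (it n)).
have iD2 n : mu.-integrable setT (EFin \o (fun x => D n x ^+ 2)).
  by rewrite DE; exact: integrable_sqD.
have c1 : \int[mu]_x (D n x ^+ 2) @[n --> \oo] --> \int[mu]_x (cst 0 x : R).
  apply: (@Rintegral_dct _ setT _ _ (fun x => f x ^+ 2)) => //.
  - by move=> n; exact: measurable_funX.
  - move=> x _; apply: cvg_near_cst; apply: filterS (trunc_near f x) => n.
    by rewrite /D => ->; rewrite subrr expr0n.
  - move=> n x _; rewrite normrX -(real_normK (num_real (f x))) lerXn2r ?nnegrE//.
    by rewrite /D /trunc; case: ifP => _; rewrite ?subr0// subrr normr0.
have I0 : \int[mu]_x (cst 0 x : R) = 0 by rewrite /Rintegral integral0.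
rewrite I0 in c1.
pose s n x := trunc f n x - D n x.
have isn n : mu.-integrable setT (EFin \o s n) by exact: (integrableB measurableT (it n) (iD n)).
have ms n : measurable_fun setT (s n) by exact: measurable_funB.
have is2 n : mu.-integrable setT (EFin \o (fun x => s n x ^+ 2)).
  have -> : s n = (fun x => 1 * trunc f n x + (-1) * D n x) by apply/funext => x; rewrite /s; ring.
  exact: integrable_sqD.
have fE n : f = (fun x => trunc f n x + D n x) by apply/funext => x; rewrite /D subrKC.
have sE n : s n = (fun x => trunc f n x + (-1) * D n x) by apply/funext => x; rewrite /s mulN1r.
have iND n : mu.-integrable setT (EFin \o (fun x => -1 * D n x)).
  exact: (integrableZl measurableT (-1) (iD n)).
have par xi n : spec f xi + spec (s n) xi = 2 * spec (trunc f n) xi + 2 * spec (D n) xi.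
  have -> : spec f xi = spec (fun x => trunc f n x + D n x) xi by rewrite -fE.
  rewrite sE (specD _ (it n) (iD n)) (specD _ (it n) (iND n)) (cosTZ _ _ (iD n)) (sinTZ _ _ (iD
    n)) /spec.
  ring.
have parI n : \int[mu]_x (f x ^+ 2) + \int[mu]_x (s n x ^+ 2) =
    2 * \int[mu]_x (trunc f n x ^+ 2) + 2 * \int[mu]_x (D n x ^+ 2).
  rewrite -RintegralD// -!RintegralZl// -RintegralD//; last 2 first.
    exact: (integrableZl measurableT 2 (it2 n)).
    exact: (integrableZl measurableT 2 (iD2 n)).
  by apply: eq_Rintegral => x _; rewrite /s /D; ring.
have pars n : ((2 * (2 * pi * \int[mu]_x (trunc f n x ^+ 2)))%:E <=
    \int[mu]_xi (spec f xi)%:E + (2 * pi * \int[mu]_x (s n x ^+ 2))%:E)%E.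
  apply: (@le_trans _ _ (\int[mu]_xi (spec f xi)%:E + \int[mu]_xi (spec (s n) xi)%:E)%E);
    last first.
    by rewrite leeD2l// plancherel_le.
  rewrite -ge0_integralD//; last 4 first.
  - by move=> x _; exact: spec_ge0.
  - by apply/measurable_EFinP; exact: measurable_spec.
  - by move=> x _; exact: spec_ge0.
  - by apply/measurable_EFinP; exact: measurable_spec.
  rewrite EFinM -(@plancherel_bounded (trunc f n) n%:R n%:R)//; last 2 first.
  - exact: trunc_le.
  - by move=> x; exact: trunc_supp.
  have ms_ : measurable_fun setT (EFin \o spec (trunc f n)).
    by apply/measurable_EFinP; exact: measurable_spec.
  have s0 x : setT x -> (0 <= (EFin \o spec (trunc f n)) x)%E by move=> _; rewrite lee_fin spec_ge0.
  rewrite -[X in (_ * X)%E]/(\int[mu]_xi (EFin \o spec (trunc f n)) xi)%E.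
  rewrite -(ge0_integralZl mu measurableT ms_ s0)//.
  apply: ge0_le_integral => //.
  - by move=> x _; rewrite mule_ge0// lee_fin spec_ge0.
  - by apply: measurable_funeM; apply/measurable_EFinP; exact: measurable_spec.
  - by apply: emeasurable_funD; apply/measurable_EFinP; exact: measurable_spec.
  - by move=> x _; rewrite -EFinM -EFinD lee_fin par lerDl mulr_ge0// spec_ge0.
have fin : (\int[mu]_xi (spec f xi)%:E)%E \is a fin_num.
  rewrite ge0_fin_numE; last by apply: integral_ge0 => x _; rewrite lee_fin spec_ge0.
  by apply: (le_lt_trans (plancherel_le intf intf2)); rewrite ltry.
rewrite -(fineK fin) lee_fin.
have c2 : fine (\int[mu]_xi (spec f xi)%:E)%E + 4 * pi * \int[mu]_x (D n x ^+ 2) @[n --> \oo] -->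
    fine (\int[mu]_xi (spec f xi)%:E)%E.
  by rewrite -[X in _ --> X]addr0 -[X in _ --> _ + X](mulr0 (4 * pi)); apply: cvgD;
    [exact: cvg_cst|exact: cvgMl_tmp].
rewrite -(cvg_lim (@Rhausdorff R) c2).
apply: limr_ge; first exact: (cvgP _ c2).
apply: nearW => n; have := pars n; rewrite -{1}(fineK fin) -EFinD lee_fin /=.
exact: plancherel_aux (parI n).
Qed.

End real_plancherel2.

(** * Hermitian forms and complex [L^2] *)

Section complex_parts.
Context {R : realType}.
Implicit Types z w : R[i].
Local Notation Re := (@complex.Re R).
Local Notation Im := (@complex.Im R).

Lemma complexP z w : Re z = Re w -> Im z = Im w -> z = w.
Proof. by case: z => a b; case: w => c d /= -> ->. Qed.

Lemma ReDE z w : Re (z + w) = Re z + Re w. Proof. by case: z; case: w. Qed.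
Lemma ImDE z w : Im (z + w) = Im z + Im w. Proof. by case: z; case: w. Qed.
Lemma ReNE z : Re (- z) = - Re z. Proof. by case: z. Qed.
Lemma ImNE z : Im (- z) = - Im z. Proof. by case: z. Qed.
Lemma ReME z w : Re (z * w) = Re z * Re w - Im z * Im w. Proof. by case: z; case: w. Qed.
Lemma ImME z w : Im (z * w) = Re z * Im w + Im z * Re w. Proof. by case: z; case: w. Qed.
Lemma ReCE z : Re z^* = Re z. Proof. by case: z. Qed.
Lemma ImCE z : Im z^* = - Im z. Proof. by case: z. Qed.

Definition ReImE := (ReDE, ImDE, ReNE, ImNE, ReME, ImME, ReCE, ImCE).

Lemma ReCMl (r : R) z : Re (r%:C * z) = r * Re z. Proof. by rewrite !ReImE /= mul0r subr0. Qed.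
Lemma ImCMl (r : R) z : Im (r%:C * z) = r * Im z. Proof. by rewrite !ReImE /= mul0r addr0. Qed.

Lemma sqnormE z : z * z^* = (sqnorm z)%:C.
Proof. by apply: complexP; rewrite !ReImE /sqnorm /=; ring. Qed.

Lemma sqnorm_ge0 z : 0 <= sqnorm z.
Proof. by rewrite addr_ge0// sqr_ge0. Qed.

Lemma sqnorm0 : sqnorm (0 : R[i]) = 0.
Proof. by rewrite /sqnorm /= expr0n addr0. Qed.

Lemma sqnorm_real (r : R) : sqnorm r%:C = r ^+ 2.
Proof. by rewrite /sqnorm /= expr0n addr0. Qed.

Lemma sqnorm_eq0 z : sqnorm z = 0 -> z = 0.
Proof.
case: z => a b; rewrite /sqnorm/= => /eqP; rewrite paddr_eq0 ?sqr_ge0//.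
by rewrite !sqrf_eq0 => /andP[/eqP -> /eqP ->].
Qed.

Lemma sqnormM z w : sqnorm (z * w) = sqnorm z * sqnorm w.
Proof. by rewrite /sqnorm !ReImE; ring. Qed.

Lemma sqnormC z : sqnorm z^* = sqnorm z.
Proof. by rewrite /sqnorm !ReImE sqrrN. Qed.

Lemma sqnormN z : sqnorm (- z) = sqnorm z.
Proof. by rewrite /sqnorm !ReImE !sqrrN. Qed.

Lemma sqnorm_expi (t : R) : sqnorm (expi t) = 1.
Proof. by rewrite /sqnorm/= cos2Dsin2. Qed.

Lemma expiD (s t : R) : expi (s + t) = expi s * expi t.
Proof. by apply: complexP; rewrite !ReImE /= ?cosD ?sinD; ring. Qed.

Lemma expi0 : expi 0 = 1 :> R[i].
Proof. by apply: complexP; rewrite /= ?cos0 ?sin0. Qed.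

Lemma expiN (t : R) : expi (- t) = (expi t)^*.
Proof. by apply: complexP; rewrite !ReImE /= ?cosN ?sinN. Qed.

Lemma expiNV (t : R) : (expi t)^-1 = expi (- t).
Proof.
have h : expi t * expi (- t) = 1 by rewrite -expiD subrr expi0.
have u : expi t \is a GRing.unit by apply/unitrPr; exists (expi (- t)).
by apply: (mulrI u); rewrite mulrV.
Qed.

Lemma sqnorm_parallelogram z w : sqnorm (z + w) + sqnorm (z - w) = 2 * sqnorm z + 2 * sqnorm w.
Proof. by rewrite /sqnorm !ReImE; ring. Qed.

Lemma sqnormD_le z w : sqnorm (z + w) <= 2 * sqnorm z + 2 * sqnorm w.
Proof. by rewrite -sqnorm_parallelogram lerDl sqnorm_ge0. Qed.

Lemma polar_Re z w : Re (z * w^*) = (sqnorm (z + w) - sqnorm (z - w)) / 4.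
Proof. by rewrite /sqnorm !ReImE; field. Qed.

Lemma polar_Im z w : Im (z * w^*) = (sqnorm (z + 'i * w) - sqnorm (z - 'i * w)) / 4.
Proof. by rewrite /sqnorm !ReImE /=; field. Qed.

Lemma Re_le_sqnorm z w : `|Re (z * w^*)| <= (sqnorm z + sqnorm w) / 2.
Proof.
rewrite /sqnorm !ReImE ler_norml; apply/andP.
have := sqr_ge0 (Re z - Re w); have := sqr_ge0 (Re z + Re w).
have := sqr_ge0 (Im z - Im w); have := sqr_ge0 (Im z + Im w).
by rewrite !sqrrB !sqrrD => ? ? ? ?; split; lra.
Qed.

Lemma Im_le_sqnorm z w : `|Im (z * w^*)| <= (sqnorm z + sqnorm w) / 2.
Proof.
rewrite /sqnorm !ReImE ler_norml; apply/andP.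
have := sqr_ge0 (Re z - Im w); have := sqr_ge0 (Re z + Im w).
have := sqr_ge0 (Im z - Re w); have := sqr_ge0 (Im z + Re w).
by rewrite !sqrrB !sqrrD => ? ? ? ?; split; lra.
Qed.

End complex_parts.

(** * Semidefinite Hermitian forms on a subspace *)

Section hermitian.
Context {R : realType} {E : lmodType R[i]}.
Local Notation Re := (@complex.Re R).
Local Notation Im := (@complex.Im R).

Definition subspace (H : set E) := H 0 /\ forall (c : R[i]) u v, H u -> H v -> H (c *: u + v).

(** Only semidefinite: the L^2 product vanishes on almost everywhere null functions, and the form <A
    u | v> of a positive operator may degenerate. All laws are restricted to H because integrals and
    sums are meaningful only there. *)
Definition hermitian (H : set E) (b : E -> E -> R[i]) :=
  [/\ forall (c : R[i]) u v w, H u -> H v -> H w -> b (c *: u + v) w = c * b u w + b v w,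
      forall u v, H u -> H v -> b v u = (b u v)^* &
      forall u, H u -> 0 <= Re (b u u)].

Variables (H : set E) (b : E -> E -> R[i]).
Hypotheses (sH : subspace H) (hb : hermitian H b).
Local Notation q u := (Re (b u u)).

Lemma subspaceD u v : H u -> H v -> H (u + v).
Proof. by move=> Hu Hv; rewrite -[u]scale1r; exact: sH.2. Qed.

Lemma subspaceZ c u : H u -> H (c *: u).
Proof. by move=> Hu; rewrite -[_ *: _]addr0; apply: sH.2 => //; exact: sH.1. Qed.

Lemma subspaceN u : H u -> H (- u).
Proof. by move=> Hu; rewrite -scaleN1r; exact: subspaceZ. Qed.

Lemma subspaceB u v : H u -> H v -> H (u - v).
Proof. by move=> Hu Hv; apply: subspaceD => //; exact: subspaceN. Qed.

Lemma hermDl u v w : H u -> H v -> H w -> b (u + v) w = b u w + b v w.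
Proof. by case: hb => h _ _ Hu Hv Hw; rewrite -[u]scale1r h// mul1r scale1r. Qed.

Lemma herm0l w : H w -> b 0 w = 0.
Proof.
move=> Hw; have := hermDl sH.1 sH.1 Hw; rewrite addr0 => /eqP.
by rewrite -subr_eq subrr eq_sym => /eqP.
Qed.

Lemma hermZl c u w : H u -> H w -> b (c *: u) w = c * b u w.
Proof.
by case: (hb) => h _ _ Hu Hw; rewrite -[c *: u]addr0 h// ?herm0l ?addr0//; exact: sH.1.
Qed.

Lemma hermNl u w : H u -> H w -> b (- u) w = - b u w.
Proof. by move=> Hu Hw; rewrite -scaleN1r hermZl// mulN1r. Qed.

Lemma hermBl u v w : H u -> H v -> H w -> b (u - v) w = b u w - b v w.
Proof. by move=> Hu Hv Hw; rewrite hermDl ?hermNl//; exact: subspaceN. Qed.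

Lemma hermC u v : H u -> H v -> b v u = (b u v)^*.
Proof. by case: hb => _ h _; exact: h. Qed.

Lemma hermDr u v w : H u -> H v -> H w -> b w (u + v) = b w u + b w v.
Proof.
move=> Hu Hv Hw; rewrite hermC ?hermDl//; last exact: subspaceD.
by rewrite (hermC Hu Hw) (hermC Hv Hw) -rmorphD.
Qed.

Lemma hermZr c u w : H u -> H w -> b w (c *: u) = c^* * b w u.
Proof.
move=> Hu Hw; rewrite hermC ?hermZl//; last exact: subspaceZ.
by rewrite (hermC Hu Hw) -rmorphM.
Qed.

Lemma hermNr u w : H u -> H w -> b w (- u) = - b w u.
Proof. by move=> Hu Hw; rewrite hermC ?hermNl ?rmorphN/= -?hermC//; exact: subspaceN. Qed.

Lemma hermBr u v w : H u -> H v -> H w -> b w (u - v) = b w u - b w v.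
Proof. by move=> Hu Hv Hw; rewrite hermDr ?hermNr//; exact: subspaceN. Qed.

Lemma herm_q_ge0 u : H u -> 0 <= q u.
Proof. by case: hb => _ _; exact. Qed.

Lemma herm_qE u : H u -> b u u = (q u)%:C.
Proof.
move=> Hu; apply: complexP => //=; have := congr1 Im (hermC Hu Hu).
by rewrite ImCE => h; lra.
Qed.

Lemma herm_qZD c u v : H u -> H v ->
  q (c *: u + v) = sqnorm c * q u + 2 * Re (c * b u v) + q v.
Proof.
move=> Hu Hv; have Hc : H (c *: u) by exact: subspaceZ.
rewrite hermDl ?hermDr ?hermZl ?hermZr//; try exact: subspaceD.
rewrite (herm_qE Hu) (hermC Hu Hv) !ReImE /sqnorm /=; ring.
Qed.

Lemma herm_qD u v : H u -> H v -> q (u + v) = q u + q v + 2 * Re (b u v).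
Proof.
move=> Hu Hv; rewrite -[u in LHS]scale1r herm_qZD// mul1r /sqnorm/=; ring.
Qed.

Lemma herm_qN u : H u -> q (- u) = q u.
Proof. by move=> Hu; rewrite hermNl ?hermNr ?opprK//; exact: subspaceN. Qed.

Lemma herm_qZ c u : H u -> q (c *: u) = sqnorm c * q u.
Proof.
move=> Hu; rewrite hermZl ?hermZr//; last exact: subspaceZ.
rewrite (herm_qE Hu) !ReImE /sqnorm /=; ring.
Qed.

Lemma herm_qB u v : H u -> H v -> q (u - v) = q u + q v - 2 * Re (b u v).
Proof.
move=> Hu Hv; rewrite herm_qD ?herm_qN//; last exact: subspaceN.
by rewrite hermNr// ReNE mulrN.
Qed.

Lemma herm_parallelogram u v : H u -> H v -> q (u + v) + q (u - v) = 2 * q u + 2 * q v.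
Proof. by move=> Hu Hv; rewrite herm_qD ?herm_qB//; ring. Qed.

Lemma herm_qD_le u v : H u -> H v -> q (u + v) <= 2 * q u + 2 * q v.
Proof.
by move=> Hu Hv; rewrite -herm_parallelogram// lerDl; apply: herm_q_ge0; exact: subspaceB.
Qed.

Lemma herm_CS u v : H u -> H v -> sqnorm (b u v) <= q u * q v.
Proof.
move=> Hu Hv.
(* The scalar t (b u v)^* makes the cross term real, which leaves a real quadratic in t. *)
have k t : 0 <= t ^+ 2 * sqnorm (b u v) * q u + 2 * t * sqnorm (b u v) + q v.
  have := herm_q_ge0 (sH.2 ((t%:C * (b u v)^*)) _ _ Hu Hv).
  rewrite herm_qZD// sqnormM sqnormC /(sqnorm t%:C)/= expr0n/= addr0.
  suff -> : Re (t%:C * (b u v)^* * b u v) = t * sqnorm (b u v) by rewrite mulrA.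
  by rewrite -mulrA [X in _ * X]mulrC sqnormE !ReImE/= mul0r subr0.
have qu := herm_q_ge0 Hu; have qv := herm_q_ge0 Hv; have s0 := sqnorm_ge0 (b u v).
move: qu; rewrite le_eqVlt => /predU1P[qu|qu].
  have [->|sN] := eqVneq (sqnorm (b u v)) 0; first by rewrite -qu mul0r.
  (* For q u = 0 the quadratic is affine in t, and at this t its value is -1. *)
  have := k (- (q v + 1) / (2 * sqnorm (b u v))); rewrite -qu mulr0 add0r.
  have -> : 2 * (- (q v + 1) / (2 * sqnorm (b u v))) * sqnorm (b u v) = - (q v + 1) by field.
  by move=> ?; lra.
have := k (- (q u)^-1).
have -> : (- (q u)^-1) ^+ 2 * sqnorm (b u v) * q u = sqnorm (b u v) / q u.
  by field; rewrite gt_eqF.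
have -> : 2 * - (q u)^-1 * sqnorm (b u v) = - 2 * (sqnorm (b u v) / q u) by ring.
move=> h; rewrite mulrC -ler_pdivrMr//; lra.
Qed.

Lemma herm_polar_Re u v : H u -> H v -> Re (b u v) = (q (u + v) - q (u - v)) / 4.
Proof. by move=> Hu Hv; rewrite herm_qD ?herm_qB//; field. Qed.

Lemma herm_polar_Im u v : H u -> H v -> Im (b u v) = (q (u + 'i *: v) - q (u - 'i *: v)) / 4.
Proof.
move=> Hu Hv; have Hi : H ('i *: v) by exact: subspaceZ.
by rewrite herm_qD ?herm_qB// (hermZr _ Hv Hu) !ReImE /=; field.
Qed.

Lemma herm_triangle u v : H u -> H v ->
  Num.sqrt (q (u + v)) <= Num.sqrt (q u) + Num.sqrt (q v).
Proof.
move=> Hu Hv.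
have [qu qv] := (herm_q_ge0 Hu, herm_q_ge0 Hv).
rewrite -(@ler_pXn2r _ 2)// ?nnegrE ?addr_ge0 ?sqrtr_ge0//.
rewrite sqrrD !sqr_sqrtr ?herm_q_ge0//; last exact: subspaceD.
rewrite herm_qD// -mulr_natr.
suff : Re (b u v) <= Num.sqrt (q u) * Num.sqrt (q v) by move=> ?; lra.
rewrite -sqrtrM// (le_trans (ler_norm _))// -sqrtr_sqr ler_sqrt; last by rewrite mulr_ge0.
by apply: le_trans (herm_CS Hu Hv); rewrite /sqnorm lerDl sqr_ge0.
Qed.

Lemma herm_dist_sqrt u v : H u -> H v ->
  `|Num.sqrt (q u) - Num.sqrt (q v)| <= Num.sqrt (q (u - v)).
Proof.
move=> Hu Hv; have Huv := subspaceB Hu Hv; have Hvu := subspaceB Hv Hu.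
rewrite ler_norml; apply/andP; split.
  rewrite lerNl opprB lerBlDl; have := herm_triangle Hu Hvu.
  by rewrite subrKC -(opprB v u) herm_qN//.
by rewrite lerBlDl; have := herm_triangle Hv Huv; rewrite subrKC.
Qed.

(** The square root of q is a seminorm, so the reverse triangle inequality applies to it; squaring
    returns to q. *)
Lemma herm_cvg (u_ : nat -> E) u : (forall n, H (u_ n)) -> H u ->
  q (u_ n - u) @[n --> \oo] --> 0 -> q (u_ n) @[n --> \oo] --> q u.
Proof.
move=> Hu_ Hu c.
have cs : Num.sqrt (q (u_ n - u)) @[n --> \oo] --> 0.
  by rewrite -sqrtr0; apply: (cvg_comp _ (@Num.sqrt R) c); exact: sqrt_continuous.
have c1 : Num.sqrt (q (u_ n)) @[n --> \oo] --> Num.sqrt (q u).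
  apply/cvgrPdist_le => /= e e0; move/cvgrPdist_le : cs => /(_ e e0).
  apply: filterS => n /=; rewrite sub0r normrN ger0_norm ?sqrtr_ge0// distrC.
  exact: le_trans (herm_dist_sqrt (Hu_ n) Hu).
have -> : (fun n => q (u_ n)) = (fun n => Num.sqrt (q (u_ n)) * Num.sqrt (q (u_ n))).
  by apply/funext => n; rewrite -expr2 sqr_sqrtr//; exact: herm_q_ge0.
have -> : q u = Num.sqrt (q u) * Num.sqrt (q u) by rewrite -expr2 sqr_sqrtr//; exact: herm_q_ge0.
exact: cvgM.
Qed.

Lemma herm_cvg0D (u_ v_ : nat -> E) u v : (forall n, H (u_ n)) -> H u ->
  (forall n, H (v_ n)) -> H v ->
  q (u_ n - u) @[n --> \oo] --> 0 -> q (v_ n - v) @[n --> \oo] --> 0 ->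
  q ((u_ n + v_ n) - (u + v)) @[n --> \oo] --> 0.
Proof.
move=> Hu_ Hu Hv_ Hv cu cv.
apply: (@squeeze_cvgr _ _ _ _ (cst 0) (fun n => 2 * q (u_ n - u) + 2 * q (v_ n - v))).
- apply: nearW => n /=; rewrite opprD addrACA herm_q_ge0 ?herm_qD_le//; try exact: subspaceB.
  by apply: subspaceD; exact: subspaceB.
- exact: cvg_cst.
- by rewrite -[X in _ --> X]addr0 -[X in _ --> X + X](mulr0 2); apply: cvgD; exact: cvgMl_tmp.
Qed.

Lemma herm_cvg0Z (u_ : nat -> E) u c : (forall n, H (u_ n)) -> H u ->
  q (u_ n - u) @[n --> \oo] --> 0 ->
  q ((c *: u_ n) - (c *: u)) @[n --> \oo] --> 0.
Proof.
move=> Hu_ Hu cu; have -> : (fun n => q ((c *: u_ n) - (c *: u))) = (fun n => sqnorm c * q (u_ n -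
  u)).
  by apply/funext => n; rewrite -scalerBr herm_qZ//; exact: subspaceB.
by rewrite -[X in _ --> X](mulr0 (sqnorm c)); exact: cvgMl_tmp.
Qed.

Lemma herm_cvg_ip (u_ v_ : nat -> E) u v : (forall n, H (u_ n)) -> H u ->
  (forall n, H (v_ n)) -> H v ->
  q (u_ n - u) @[n --> \oo] --> 0 -> q (v_ n - v) @[n --> \oo] --> 0 ->
  Re (b (u_ n) (v_ n)) @[n --> \oo] --> Re (b u v) /\
  Im (b (u_ n) (v_ n)) @[n --> \oo] --> Im (b u v).
Proof.
move=> Hu_ Hu Hv_ Hv cu cv.
have main (w_ : nat -> E) w : (forall n, H (w_ n)) -> H w -> q (w_ n - w) @[n --> \oo] --> 0 ->
   (q (u_ n + w_ n) - q (u_ n - w_ n)) / 4 @[n --> \oo] --> (q (u + w) - q (u - w)) / 4.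
  move=> Hw_ Hw cw; apply: cvgMr_tmp; apply: cvgB.
    apply: herm_cvg; [by move=> n; exact: subspaceD|exact: subspaceD|exact: herm_cvg0D].
  apply: herm_cvg; [by move=> n; exact: subspaceB|exact: subspaceB|].
  apply: herm_cvg0D => //; try (by move=> *; exact: subspaceN).
  have := @herm_cvg0Z w_ w (-1) Hw_ Hw cw.
  by under eq_fun do rewrite !scaleN1r.
split.
  under eq_fun do rewrite herm_polar_Re//; rewrite herm_polar_Re//; exact: main.
under eq_fun do rewrite herm_polar_Im//; rewrite herm_polar_Im//; apply: main.
- by move=> n; exact: subspaceZ.
- exact: subspaceZ.
- exact: herm_cvg0Z.
Qed.

End hermitian.

(** * Complex square-integrable functions *)

Section complex_L2.
Context {R : realType}.
Local Notation mu := (@lebesgue_measure R).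
Local Notation C := (Cplx R).
Local Notation Re := (@complex.Re R).
Local Notation Im := (@complex.Im R).
Implicit Types f g u v : R -> C.

Definition cmeas f := measurable_fun setT (Re \o f) /\ measurable_fun setT (Im \o f).

Definition cintegrable f :=
  mu.-integrable setT (EFin \o (Re \o f)) /\ mu.-integrable setT (EFin \o (Im \o f)).

Lemma cintegrable_cmeas f : cintegrable f -> cmeas f.
Proof. by case=> /integrableP[/measurable_EFinP ? _] /integrableP[/measurable_EFinP ? _]. Qed.

Lemma CL1P f : CLfun 1%:E f <-> cintegrable f.
Proof.
split; case=> h1 h2; split.
- exact: (Lfun1_integrable _ _).1 h1.
- exact: (Lfun1_integrable _ _).1 h2.
- exact: (Lfun1_integrable _ _).2 h1.
- exact: (Lfun1_integrable _ _).2 h2.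
Qed.

Lemma Lfun2P (h : R -> R) : h \in Lfun mu 2%:E <->
  measurable_fun setT h /\ mu.-integrable setT (EFin \o (fun x => h x ^+ 2)).
Proof.
split=> [hL|[mh ih]].
  split; last exact: Lfun2_integrable_sqr.
  by move: hL; rewrite inE => /andP[+ _]; rewrite inE.
rewrite inE; apply/andP; split; rewrite inE//=.
rewrite /finite_norm unlock /Lnorm poweR_lty//.
have := integrable_lty measurableT ih.
apply: le_lt_trans; rewrite le_eqVlt; apply/orP; left; apply/eqP.
apply: eq_integral => x _; rewrite [LHS]/=.
by rewrite powR_mulrn// real_normK// num_real.
Qed.

Lemma cmeas_sqnorm f : cmeas f -> measurable_fun setT (fun x => sqnorm (f x)).
Proof. by case=> m1 m2; apply: measurable_funD; exact: measurable_funX. Qed.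

Lemma CL2P f : CLfun 2%:E f <-> cmeas f /\ (L2nsq f < +oo)%E.
Proof.
have key (h : R -> R) : cmeas f -> measurable_fun setT h -> (forall x, h x ^+ 2 <= sqnorm (f x)) ->
    (L2nsq f < +oo)%E -> h \in Lfun mu 2%:E.
  move=> mf mh hle foo; apply/Lfun2P; split => //.
  have i2 : mu.-integrable setT (EFin \o (fun x => sqnorm (f x))).
    apply/integrableP; split; first by apply/measurable_EFinP; exact: cmeas_sqnorm.
    by under eq_integral => x _ do rewrite gee0_abs ?lee_fin ?sqnorm_ge0//.
  apply: (le_integrable measurableT _ _ i2).
    by apply/measurable_EFinP; exact: measurable_funX.
  by move=> x _; rewrite lee_fin !ger0_norm ?sqr_ge0 ?sqnorm_ge0.
split=> [[/Lfun2P[m1 i1] /Lfun2P[m2 i2]]|[mf foo]].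
  split; first by split.
  have := integrable_lty measurableT (integrableD measurableT i1 i2).
  by under eq_integral do rewrite -EFinD.
split; apply: key => //; try (by case: mf); rewrite /sqnorm /=.
- by move=> x; rewrite lerDl sqr_ge0.
- by move=> x; rewrite lerDr sqr_ge0.
Qed.

Lemma CL2_integrable f : CLfun 2%:E f -> mu.-integrable setT (EFin \o (fun x => sqnorm (f x))).
Proof.
move=> /CL2P[mf foo]; apply/integrableP; split.
  by apply/measurable_EFinP; exact: cmeas_sqnorm.
by under eq_integral => x _ do rewrite gee0_abs ?lee_fin ?sqnorm_ge0//.
Qed.

Lemma L2nsqE f : CLfun 2%:E f -> L2nsq f = (\int[mu]_x sqnorm (f x))%:E.
Proof. by move=> /CL2_integrable i; rewrite /Rintegral fineK//; exact: integrable_fin_num. Qed.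

Lemma L2nsq_ge0 f : (0 <= L2nsq f)%E.
Proof. by apply: integral_ge0 => x _; rewrite lee_fin sqnorm_ge0. Qed.

Lemma cmeasZD (c : R[i]) f g : cmeas f -> cmeas g -> cmeas (c *: f + g).
Proof.
move=> [f1 f2] [g1 g2]; split.
  have -> : Re \o (c *: f + g) = (fun x => Re c * Re (f x) - Im c * Im (f x) + Re (g x)).
    by apply/funext => x /=; rewrite -ReME -ReDE.
  by apply: measurable_funD => //; apply: measurable_funB; apply: measurable_funM.
have -> : Im \o (c *: f + g) = (fun x => Re c * Im (f x) + Im c * Re (f x) + Im (g x)).
  by apply/funext => x /=; rewrite -ImME -ImDE.
by apply: measurable_funD => //; apply: measurable_funD; apply: measurable_funM.
Qed.

Lemma cmeasM f g : cmeas f -> cmeas g -> cmeas (fun x => f x * g x).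
Proof.
move=> [f1 f2] [g1 g2]; split.
  have -> : Re \o (fun x => f x * g x) = (fun x => Re (f x) * Re (g x) - Im (f x) * Im (g x)).
    by apply/funext => x /=; rewrite ReME.
  by apply: measurable_funB; apply: measurable_funM.
have -> : Im \o (fun x => f x * g x) = (fun x => Re (f x) * Im (g x) + Im (f x) * Re (g x)).
  by apply/funext => x /=; rewrite ImME.
by apply: measurable_funD; apply: measurable_funM.
Qed.

Lemma cmeasC f : cmeas f -> cmeas (fun x => (f x)^*).
Proof.
move=> [f1 f2]; split.
  by have -> : Re \o (fun x => (f x)^*) = Re \o f by apply/funext => x /=; rewrite ReCE.
have -> : Im \o (fun x => (f x)^*) = (fun x => - Im (f x)) by apply/funext => x /=; rewrite ImCE.
exact: measurable_funN.
Qed.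

Lemma cmeas_cst (c : R[i]) : cmeas (fun=> c).
Proof. by split; exact: measurable_cst. Qed.

Lemma CL2_subspace : subspace (CLfun (R := R) 2%:E).
Proof.
split.
  apply/CL2P; split; first exact: cmeas_cst.
  by rewrite /L2nsq (eq_integral (fun=> 0%E)) ?integral0// => x _; rewrite sqnorm0.
move=> c f g fL gL; apply/CL2P.
have [[mf _] [mg _]] := ((CL2P f).1 fL, (CL2P g).1 gL).
have [ifn ig] := (CL2_integrable fL, CL2_integrable gL).
split; first exact: cmeasZD.
have iS := integrableD measurableT (integrableZl measurableT (2 * sqnorm c) ifn)
  (integrableZl measurableT 2 ig).
apply: le_lt_trans (integrable_lty measurableT iS).
apply: ge0_le_integral => //.
- by move=> x _; rewrite lee_fin sqnorm_ge0.
- by apply/measurable_EFinP; apply: cmeas_sqnorm; exact: cmeasZD.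
- exact: (measurable_int _ iS).
- move=> x _; rewrite /= -EFinM -EFinM -EFinD lee_fin (le_trans (sqnormD_le _ _))//.
  by rewrite -mulrA -sqnormM.
Qed.

Definition L2ip f g : R[i] := cint (fun x => f x * (g x)^*).

Lemma cintegrable_ip f g : CLfun 2%:E f -> CLfun 2%:E g -> cintegrable (fun x => f x * (g x)^*).
Proof.
move=> fL gL.
have [[mf _] [mg _]] := ((CL2P f).1 fL, (CL2P g).1 gL).
have iS := integrableD measurableT (CL2_integrable fL) (CL2_integrable gL).
have [m1 m2] := cmeasM mf (cmeasC mg).
split; apply: (le_integrable measurableT _ _ iS).
- by apply/measurable_EFinP; exact: m1.
- move=> x _; rewrite lee_fin [leRHS]ger0_norm; last by apply: addr_ge0; exact: sqnorm_ge0.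
  apply: (le_trans (Re_le_sqnorm _ _)).
  by rewrite ler_pdivrMr// ler_peMr ?ler1n// addr_ge0// sqnorm_ge0.
- by apply/measurable_EFinP; exact: m2.
- move=> x _; rewrite lee_fin [leRHS]ger0_norm; last by apply: addr_ge0; exact: sqnorm_ge0.
  apply: (le_trans (Im_le_sqnorm _ _)).
  by rewrite ler_pdivrMr// ler_peMr ?ler1n// addr_ge0// sqnorm_ge0.
Qed.

Lemma cintegrableZD (c : R[i]) f g : cintegrable f -> cintegrable g -> cintegrable (c *: f + g).
Proof.
move=> [f1 f2] [g1 g2]; split.
  have -> : Re \o (c *: f + g) = (fun x => Re c * Re (f x) - Im c * Im (f x) + Re (g x)).
    by apply/funext => x /=; rewrite -ReME -ReDE.
  exact: (integrableD measurableT (integrableB measurableT (integrableZl measurableT (Re c) f1)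
    (integrableZl measurableT (Im c) f2)) g1).
have -> : Im \o (c *: f + g) = (fun x => Re c * Im (f x) + Im c * Re (f x) + Im (g x)).
  by apply/funext => x /=; rewrite -ImME -ImDE.
exact: (integrableD measurableT (integrableD measurableT (integrableZl measurableT (Re c) f2)
  (integrableZl measurableT (Im c) f1)) g2).
Qed.

Lemma cintZD (c : R[i]) f g : cintegrable f -> cintegrable g ->
  cint (c *: f + g) = c * cint f + cint g.
Proof.
move=> [f1 f2] [g1 g2].
have [z1 z2] := (integrableZl measurableT (Re c) f1, integrableZl measurableT (Im c) f2).
have [z3 z4] := (integrableZl measurableT (Re c) f2, integrableZl measurableT (Im c) f1).
have [s1 s2] := (integrableB measurableT z1 z2, integrableD measurableT z3 z4).
apply: complexP; rewrite !ReImE /cint/=.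
  rewrite -RintegralZl// -[X in _ = _ - X + _]RintegralZl// -RintegralB// -RintegralD//.
  by apply: eq_Rintegral => x _; rewrite -ReME -ReDE.
rewrite -RintegralZl// -[X in _ = _ + X + _]RintegralZl// -RintegralD// -RintegralD//.
by apply: eq_Rintegral => x _; rewrite -ImME -ImDE.
Qed.

Lemma cintC f : cintegrable f -> cint (fun x => (f x)^*) = (cint f)^*.
Proof.
move=> [f1 f2]; apply: complexP; rewrite ?ReCE ?ImCE /cint/=.
  by apply: eq_Rintegral => x _; rewrite ReCE.
rewrite -[RHS]mulN1r -RintegralZl//; apply: eq_Rintegral => x _.
by rewrite mulN1r ImCE.
Qed.

Lemma L2_hermitian : hermitian (CLfun (R := R) 2%:E) L2ip.
Proof.
split.
- move=> c u v w uL vL wL; rewrite /L2ip -cintZD; try exact: cintegrable_ip.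
  congr cint; apply/funext => x; rewrite -[LHS]/((c * u x + v x) * (w x)^*).
  by rewrite mulrDl -mulrA.
- move=> u v uL vL; rewrite /L2ip -cintC; last exact: cintegrable_ip.
  by congr cint; apply/funext => x; apply: complexP; rewrite !ReImE; ring.
- by move=> u uL; apply: Rintegral_ge0 => x _; rewrite sqnormE/= sqnorm_ge0.
Qed.

Lemma L2ip_q f : Re (L2ip f f) = \int[mu]_x sqnorm (f x).
Proof. by apply: eq_Rintegral => x _; rewrite sqnormE. Qed.

Lemma L2nsq_q f : CLfun 2%:E f -> L2nsq f = (Re (L2ip f f))%:E.
Proof. by move=> fL; rewrite L2ip_q L2nsqE. Qed.

Lemma L2nsq_cvg (u_ : nat -> R -> C) u : (forall n, CLfun 2%:E (u_ n)) -> CLfun 2%:E u ->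
  (L2nsq (u_ n - u) @[n --> \oo] --> 0%E) <->
  (Re (L2ip (u_ n - u) (u_ n - u)) @[n --> \oo] --> (0 : R)).
Proof.
move=> Hu_ Hu.
have -> : (fun n => L2nsq (u_ n - u)) = (fun n => (Re (L2ip (u_ n - u) (u_ n - u)))%:E).
  by apply/funext => n; rewrite L2nsq_q//; exact: (subspaceB CL2_subspace).
split; last by move=> h; apply: cvg_EFin => //; exact: nearW.
by move=> /fine_cvgP[_].
Qed.

(** These unfolding equations give access to the constants in the sections where they are opaque. *)
Lemma L2ipE f g : L2ip f g = cint (fun x => f x * (g x)^*).
Proof. by []. Qed.

Lemma L2nsq_def f : L2nsq f = (\int[mu]_x (sqnorm (f x))%:E)%E.
Proof. by []. Qed.

Lemma fourier1E f xi : fourier1 f xi = cint (fun x => f x * expi (- (xi * x))).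
Proof. by []. Qed.

Lemma Re_cint f : Re (cint f) = \int[mu]_x Re (f x).
Proof. by []. Qed.

Lemma Im_cint f : Im (cint f) = \int[mu]_x Im (f x).
Proof. by []. Qed.

End complex_L2.

(** * Plancherel for complex functions in L^1 and L^2 *)

Section complex_plancherel.
Context {R : realType}.
Local Notation mu := (@lebesgue_measure R).
Local Notation TR := (measurableTypeR R).
Local Notation C := (Cplx R).
Local Notation Re := (@complex.Re R).
Local Notation Im := (@complex.Im R).
Implicit Types f g u v : R -> C.

Lemma cosT_reflect (h : R -> R) xi : cosT h (- xi) = cosT h xi.
Proof. by apply: eq_Rintegral => x _; rewrite mulNr cosN. Qed.

Lemma sinT_reflect (h : R -> R) xi : mu.-integrable setT (EFin \o h) ->
  sinT h (- xi) = - sinT h xi.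
Proof.
move=> ih; rewrite -[RHS]mulN1r /sinT -(RintegralZl (-1) measurableT (integrableM_sin xi ih)).
by apply: eq_Rintegral => x _; rewrite mulNr sinN mulrN mulN1r.
Qed.

Lemma ereal_double_eq (x : \bar R) (y : R) : (x + x = (2 * y)%:E)%E -> x = y%:E.
Proof. by case: x => [r| |]//; rewrite -EFinD => -[h]; congr EFin; lra. Qed.

Lemma fourier1_Re f xi : cintegrable f ->
  Re (fourier1 f xi) = cosT (Re \o f) xi + sinT (Im \o f) xi.
Proof.
move=> [f1 f2]; rewrite /fourier1 /cint/= -RintegralD//;
  [|exact: integrableM_cos|exact: integrableM_sin].
by apply: eq_Rintegral => x _; rewrite ReME /= cosN sinN mulrN opprK.
Qed.

Lemma fourier1_Im f xi : cintegrable f ->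
  Im (fourier1 f xi) = cosT (Im \o f) xi - sinT (Re \o f) xi.
Proof.
move=> [f1 f2]; rewrite /fourier1 /cint/= -RintegralB//;
  [|exact: integrableM_cos|exact: integrableM_sin].
by apply: eq_Rintegral => x _; rewrite ImME /= cosN sinN mulrN addrC.
Qed.

Lemma cmeas_fourier1 f : cintegrable f -> cmeas (fourier1 f).
Proof.
move=> fI; have [m1 m2] := cintegrable_cmeas fI; split.
  have -> : Re \o fourier1 f = (fun xi => cosT (Re \o f) xi + sinT (Im \o f) xi).
    by apply/funext => xi; exact: fourier1_Re.
  by apply: measurable_funD; [exact: measurable_cosT|exact: measurable_sinT].
have -> : Im \o fourier1 f = (fun xi => cosT (Im \o f) xi - sinT (Re \o f) xi).
  by apply/funext => xi; exact: fourier1_Im.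
by apply: measurable_funB; [exact: measurable_cosT|exact: measurable_sinT].
Qed.

Lemma cintegrable_expi f (t : R) : cintegrable f -> cintegrable (fun x => f x * expi (t * x)).
Proof.
move=> [f1 f2]; split.
  have -> : Re \o (fun x => f x * expi (t * x)) = (fun x => Re (f x) * cos (t * x) - Im (f x) *
    sin (t * x)).
    by apply/funext => x; rewrite /= ReME.
  exact: (integrableB measurableT (integrableM_cos t f1) (integrableM_sin t f2)).
have -> : Im \o (fun x => f x * expi (t * x)) = (fun x => Re (f x) * sin (t * x) + Im (f x) * cos
  (t * x)).
  by apply/funext => x; rewrite /= ImME.
exact: (integrableD measurableT (integrableM_sin t f1) (integrableM_cos t f2)).
Qed.

Lemma fourier1ZD (c : R[i]) f g : cintegrable f -> cintegrable g ->
  fourier1 (c *: f + g) = c *: fourier1 f + fourier1 g.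
Proof.
move=> fI gI; apply/funext => xi; rewrite /fourier1 -[RHS]/(c * _ + _) -cintZD.
- by congr cint; apply/funext => x; rewrite -[LHS]/((c * f x + g x) * _) mulrDl -mulrA.
- by under eq_fun do rewrite -mulNr; exact: cintegrable_expi.
- by under eq_fun do rewrite -mulNr; exact: cintegrable_expi.
Qed.

Lemma fourier1B f g : cintegrable f -> cintegrable g -> fourier1 (f - g) = fourier1 f - fourier1 g.
Proof.
move=> fI gI; have -> : f - g = (-1 : R[i]) *: g + f by rewrite scaleN1r addrC.
by rewrite fourier1ZD// scaleN1r addrC.
Qed.

(** In xi, [cosT] is even and [sinT] is odd, so adding the values at xi and -xi cancels the cross
    terms between the transforms of the real and imaginary parts. *)
Lemma sqnorm_fourier1_sym f xi : cintegrable f ->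
  sqnorm (fourier1 f xi) + sqnorm (fourier1 f (- xi)) =
  2 * spec (Re \o f) xi + 2 * spec (Im \o f) xi.
Proof.
move=> fI; rewrite /sqnorm !fourier1_Re// !fourier1_Im// !cosT_reflect !sinT_reflect;
  try (by case: fI).
rewrite /spec; ring.
Qed.

(** Reflection preserves the energy, so twice the energy is the integral of the symmetrized
    expression, and the real theorem applies to both parts. The halving takes place in the extended
    reals, since finiteness is part of the conclusion. *)
Lemma plancherel_complex f : CLfun 1%:E f -> CLfun 2%:E f ->
  CLfun 2%:E (fourier1 f) /\ L2nsq (fourier1 f) = ((2 * pi)%:E * L2nsq f)%E.
Proof.
move=> /CL1P fI fL; have [i1 i2] := fI.
have [/Lfun2P[m1 s1] /Lfun2P[m2 s2]] := fL.
have mF := cmeas_fourier1 fI; have mF2 := cmeas_sqnorm mF.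
have mE : measurable_fun setT (fun xi => (sqnorm (fourier1 f xi))%:E) by exact/measurable_EFinP.
have mEr : measurable_fun setT (fun xi : TR => (sqnorm (fourier1 f (- xi)))%:E).
  by apply/measurable_EFinP; apply: (measurableT_comp mF2); exact: oppr_measurable.
have F0 xi : (0 <= (sqnorm (fourier1 f xi))%:E)%E by rewrite lee_fin sqnorm_ge0.
have H : L2nsq (fourier1 f) = ((2 * pi)%:E * L2nsq f)%E.
  rewrite (L2nsqE fL) -EFinM; apply: ereal_double_eq.
  rewrite {2}/L2nsq -(ge0_integral_reflect mE F0) /L2nsq -ge0_integralD//.
  under eq_integral do rewrite -EFinD sqnorm_fourier1_sym//.
  under eq_integral do rewrite EFinD !EFinM.
  have ms1 : measurable_fun setT (fun x => (spec (Re \o f) x)%:E) by apply/measurable_EFinP;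
    exact: measurable_spec.
  have ms2 : measurable_fun setT (fun x => (spec (Im \o f) x)%:E) by apply/measurable_EFinP;
    exact: measurable_spec.
  rewrite ge0_integralD//; last 4 first.
  - by move=> x _; rewrite mule_ge0// lee_fin spec_ge0.
  - exact: measurable_funeM.
  - by move=> x _; rewrite mule_ge0// lee_fin spec_ge0.
  - exact: measurable_funeM.
  have s0 (h : R -> R) x : setT x -> (0 <= (spec h x)%:E)%E by rewrite lee_fin spec_ge0.
  rewrite (ge0_integralZl mu measurableT ms1 (s0 (Re \o f)))//.
  rewrite (ge0_integralZl mu measurableT ms2 (s0 (Im \o f)))//.
  rewrite !plancherel_real// -!EFinM -EFinD; congr EFin.
  have -> : \int[mu]_x sqnorm (f x) = \int[mu]_x (Re (f x) ^+ 2) + \int[mu]_x (Im (f x) ^+ 2).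
    by rewrite -RintegralD.
  by rewrite -[X in _ + X = _]/(2 * (2 * pi * _)); ring.
split=> //; apply/CL2P; split => //; rewrite H.
by rewrite L2nsqE// -EFinM ltry.
Qed.

Lemma plancherel_q f : CLfun 1%:E f -> CLfun 2%:E f ->
  Re (L2ip (fourier1 f) (fourier1 f)) = 2 * pi * Re (L2ip f f).
Proof.
move=> f1 f2; have [F2 /eqP] := plancherel_complex f1 f2.
by rewrite !L2nsq_q// -EFinM => /eqP[].
Qed.

End complex_plancherel.

(** * Completeness of L^2 *)

Section L2_complete.
Context {R : realType}.
Local Notation mu := (@lebesgue_measure R).
Local Notation TR := (measurableTypeR R).
Local Notation C := (Cplx R).
Local Notation Re := (@complex.Re R).
Local Notation Im := (@complex.Im R).
Implicit Types f g u v : R -> C.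

Lemma cvg_geometric_steps (a : nat -> R) (B : R) :
  (forall k, `|a k.+1 - a k| <= B * 2^-1 ^+ k) -> cvgn a.
Proof.
move=> aB.
have B0 : 0 <= B by have := aB 0%N; rewrite expr0 mulr1; apply: le_trans.
have cs : cvgn (series (fun k => a k.+1 - a k)).
  apply: normed_cvg; apply: (@series_le_cvg _ _ (geometric B 2^-1)).
  - by move=> n; exact: normr_ge0.
  - by move=> n; rewrite /geometric/= mulr_ge0// exprn_ge0// invr_ge0.
  - by move=> n; rewrite /geometric/=; exact: aB.
  - by apply: is_cvg_geometric_series; rewrite ger0_norm ?invr_ge0// invf_lt1 ?ltr1n.
have -> : a = (fun n => series (fun k => a k.+1 - a k) n + a 0%N).
  by apply/funext => n; rewrite /series/= telescope_sumr ?subrK.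
apply: is_cvgD => //; exact: is_cvg_cst.
Qed.

Lemma ae_lty (f : R -> \bar R) : measurable_fun setT f -> (forall x, 0 <= f x)%E ->
  (\int[mu]_x f x < +oo)%E -> {ae mu, forall x, (f x < +oo)%E}.
Proof.
move=> mf f0 foo; have iF : mu.-integrable setT f.
  apply/integrableP; split => //.
  by under eq_integral => x _ do rewrite gee0_abs//.
have := integrable_ae measurableT iF; apply: ae_imply => x /(_ I).
by rewrite fin_numElt => /andP[].
Qed.

Lemma measurable_if_mem (A : set R) (h : R -> R) : measurable A -> measurable_fun setT h ->
  measurable_fun setT (fun x => if x \in A then h x else 0).
Proof.
move=> mA mh; have := (measurable_restrictT h mA).1 (measurable_funTS mh).
by rewrite /patch.
Qed.

(** Riesz-Fischer: a rapidly convergent subsequence has a limit at almost every point, and Fatou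
    shows that the whole sequence tends to it in norm. *)
Lemma L2_complete (u_ : nat -> R -> C) : (forall n, CLfun 2%:E (u_ n)) ->
  (forall e : R, 0 < e -> exists N, forall m n, (N <= m)%N -> (N <= n)%N ->
     Re (L2ip (u_ m - u_ n) (u_ m - u_ n)) <= e) ->
  exists2 u, CLfun 2%:E u & Re (L2ip (u_ n - u) (u_ n - u)) @[n --> \oo] --> (0 : R).
Proof.
move=> uL cau; pose q u := Re (L2ip u u).
have sH := @CL2_subspace R.
have uB m n : CLfun 2%:E (u_ m - u_ n) by exact: (subspaceB sH).
have mB m n : cmeas (u_ m - u_ n) by case/CL2P : (uB m n).
have qE m n : L2nsq (u_ m - u_ n) = (q (u_ m - u_ n))%:E by exact: L2nsq_q.
(* The rate 8^-k is matched to the weights 4^k in S: the weighted squared norms are at most 2^-k,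
   hence summable, and where S is finite the steps of the subsequence are of order 2^-k. *)
have e8 k : 0 < 8^-1 ^+ k :> R by rewrite exprn_gt0// invr_gt0.
have /choice[Ns HNs] k := cau _ (e8 k).
pose phi := fix phi k := if k is k'.+1 then maxn (phi k').+1 (Ns k) else Ns 0%N.
have phiS k : (phi k < phi k.+1)%N by rewrite /= leq_maxl.
have phiN k : (Ns k <= phi k)%N by case: k => //= k; exact: leq_maxr.
have phiM k m : (k <= m)%N -> (phi k <= phi m)%N.
  elim: m => [|m ih]; first by rewrite leqn0 => /eqP ->.
  by rewrite leq_eqVlt => /predU1P[->//|/ih h]; exact: leq_trans h (ltnW (phiS m)).
have phik k : (k <= phi k)%N by elim: k => // k ih; exact: leq_ltn_trans ih (phiS k).
pose d k := u_ (phi k.+1) - u_ (phi k).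
have dq k : q (d k) <= 8^-1 ^+ k.
  by apply: HNs => //; apply: leq_trans (phiN k) _; exact: phiM.
pose S x := (\sum_(k <oo) (4 ^+ k * sqnorm (d k x))%:E)%E.
have t0 k x : (0 <= (4 ^+ k * sqnorm (d k x))%:E)%E by rewrite lee_fin mulr_ge0 ?sqnorm_ge0
  ?exprn_ge0.
have mt k : measurable_fun setT (fun x => (4 ^+ k * sqnorm (d k x))%:E).
  apply/measurable_EFinP; apply: measurable_funM => //; apply: cmeas_sqnorm; exact: mB.
have mS : measurable_fun setT S by apply: ge0_emeasurable_sum => // k x _ _; exact: t0.
have S0 x : (0 <= S x)%E by exact: nneseries_ge0.
have Soo : (\int[mu]_x S x < +oo)%E.
  rewrite /S integral_nneseries//.
  apply: (@le_lt_trans _ _ (\sum_(k <oo) (2 / (2 ^ k.+1)%:R)%:E)%E); last first.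
    by apply: (le_lt_trans (epsilon_trick0 xpredT _)) => //; rewrite ltry.
  apply: lee_nneseries => [k _ _|k _]; first by apply: integral_ge0 => x _; exact: t0.
  have -> : (\int[mu]_x (4 ^+ k * sqnorm (d k x))%:E)%E = (4 ^+ k * q (d k))%:E.
    under eq_integral do rewrite EFinM.
    have md : measurable_fun setT (fun x => (sqnorm (d k x))%:E).
      by apply/measurable_EFinP; apply: cmeas_sqnorm; exact: mB.
    have d0 x : setT x -> (0 <= (sqnorm (d k x))%:E)%E by rewrite lee_fin sqnorm_ge0.
    rewrite (ge0_integralZl mu measurableT md d0) ?lee_fin ?exprn_ge0//.
    by rewrite -/(L2nsq (d k)) qE EFinM.
  rewrite lee_fin; have -> : 2 / (2 ^ k.+1)%:R = 4 ^+ k * 8^-1 ^+ k :> R.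
    rewrite -exprMn natrX exprS invfM mulrA divff// mul1r -exprVn; congr (_ ^+ _).
    by field.
  by rewrite ler_wpM2l ?exprn_ge0//; exact: dq.
have aeS := ae_lty mS S0 Soo.
pose A := [set x | (S x < +oo)%E].
have mA : measurable A by rewrite -[A]setTI; exact: emeasurable_fun_infty_o.
have cvgRI (P : R[i] -> R) : (forall z w, P (z - w) = P z - P w) ->
  (forall z, `|P z| ^+ 2 <= sqnorm z) ->
    forall x, A x -> cvgn (fun k => P (u_ (phi k) x)).
  move=> PB Ple x Ax; set B := fine (S x).
  have B0 : 0 <= B by exact: fine_ge0.
  (* B + 1 serves in place of the square root of B, since B <= (B + 1)^2. *)
  apply: (@cvg_geometric_steps _ (B + 1)) => k; rewrite -PB.
  rewrite -(@ler_pXn2r _ 2)// ?nnegrE//; last by rewrite mulr_ge0 ?addr_ge0// exprn_ge0// invr_ge0.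
  apply: (le_trans (Ple _)).
  have h : 4 ^+ k * sqnorm (d k x) <= B.
    rewrite -lee_fin /B fineK; last by rewrite ge0_fin_numE.
    rewrite /S (@nneseriesD1 _ _ k)//.
    by rewrite leeDl//; apply: nneseries_ge0.
  have {}h : sqnorm (d k x) <= B * (2^-1 ^+ k) ^+ 2.
    rewrite -exprM mulnC exprM -[2^-1 ^+ 2]/(2^-1 * 2^-1) -invfM -natrM exprVn -/4%:R.
    by rewrite ler_pdivlMr ?exprn_gt0// mulrC.
  apply: (le_trans h); rewrite exprMn ler_wpM2r ?sqr_ge0//; nra.
pose v k : R -> C := fun x => if x \in A then u_ (phi k) x else 0.
pose u : R -> C := fun x => if x \in A then lim (Re (u_ (phi k) x) @[k --> \oo]) +i* lim (Im (u_
  (phi k) x) @[k --> \oo]) else 0.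
have vR x : Re (v k x) @[k --> \oo] --> Re (u x).
  rewrite /v /u; case: ifPn => [/set_mem Ax|_]; last exact: cvg_cst.
  apply: (cvgRI Re) => //; first by move=> z w; rewrite ReDE ReNE.
  by move=> z; rewrite real_normK ?num_real// /sqnorm lerDl sqr_ge0.
have vI x : Im (v k x) @[k --> \oo] --> Im (u x).
  rewrite /v /u; case: ifPn => [/set_mem Ax|_]; last exact: cvg_cst.
  apply: (cvgRI Im) => //; first by move=> z w; rewrite ImDE ImNE.
  by move=> z; rewrite real_normK ?num_real// /sqnorm lerDr sqr_ge0.
have mv k : cmeas (v k).
  have /CL2P[[m1 m2] _] := uL (phi k).
  split.
    have -> : Re \o v k = (fun x => if x \in A then Re (u_ (phi k) x) else 0).
      by apply/funext => x; rewrite /v /=; case: ifP.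
    exact: measurable_if_mem.
  have -> : Im \o v k = (fun x => if x \in A then Im (u_ (phi k) x) else 0).
    by apply/funext => x; rewrite /v /=; case: ifP.
  exact: measurable_if_mem.
have mu_ : cmeas u.
  split.
    by apply: (@measurable_fun_cvg _ _ _ _ (fun k => Re \o v k)) => [k|x _];
      [case: (mv k)|exact: vR].
  by apply: (@measurable_fun_cvg _ _ _ _ (fun k => Im \o v k)) => [k|x _]; [case: (mv k)|exact: vI].
have key e n N : (forall m, (N <= m)%N -> q (u_ m - u_ n) <= e) -> (L2nsq (u - u_ n)%R <= e%:E)%E.
  move=> Hn; apply: (@ge0_integral_le_liminf _ setT (fun k x => sqnorm (u_ (phi (k + N)%N) x - u_
    n x)) _ (fun=> e%:E)) => //.
  - by move=> k; apply: (cmeas_sqnorm (mB (phi (k + N)%N) n)).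
  - by move=> k x _; exact: sqnorm_ge0.
  - move: aeS; apply: ae_imply => x Ax _.
    have c1 : Re (u_ (phi k) x) @[k --> \oo] --> Re (u x).
      by have := vR x; rewrite /v mem_set.
    have c2 : Im (u_ (phi k) x) @[k --> \oo] --> Im (u x).
      by have := vI x; rewrite /v mem_set.
    have c1' := cvg_comp _ _ (@cvg_addnr N) c1; have c2' := cvg_comp _ _ (@cvg_addnr N) c2.
    by rewrite /sqnorm; apply: cvgD; apply: cvg_sqr; under eq_fun do rewrite ?ReDE ?ImDE ?ReNE
      ?ImNE;
      rewrite ?ReDE ?ImDE ?ReNE ?ImNE; (apply: cvgB; last exact: cvg_cst).
  - apply: (@cmeas_sqnorm _ (u - u_ n)); have /CL2P[mn _] := uL n.
    by have := cmeasZD (-1) mn mu_; rewrite scaleN1r addrC.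
  - by move=> k; rewrite -/(L2nsq _) qE lee_fin; apply: Hn; apply: leq_trans (phik _);
    exact: leq_addl.
  - exact: cvg_cst.
have uL2 : CLfun 2%:E u.
  have [N HN] := cau 1 ltr01.
  have h := key 1 N N (fun m Nm => HN m N Nm (leqnn N)).
  have uuN : CLfun 2%:E (u - u_ N).
    apply/CL2P; split; last by apply: le_lt_trans h _; rewrite ltry.
    have /CL2P[mN _] := uL N.
    by have := cmeasZD (-1) mN mu_; rewrite scaleN1r addrC.
  by rewrite -(subrK (u_ N) u); exact: (subspaceD sH).
exists u => //; apply/cvgrPdist_le => /= e e0.
have [N HN] := cau e e0; exists N => // n /= Nn.
have unL : CLfun 2%:E (u_ n - u) by exact: (subspaceB sH).
rewrite sub0r normrN ger0_norm; last exact: (herm_q_ge0 (L2_hermitian)).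
rewrite -lee_fin -L2nsq_q// -opprB.
have := key e n N (fun m Nm => HN m n Nm Nn).
by rewrite (_ : L2nsq (- (u - u_ n)) = L2nsq (u - u_ n))//; apply: eq_integral => x _;
  rewrite -[X in sqnorm X]/(- ((u - u_ n) x)) sqnormN.
Qed.

End L2_complete.

(** * Fourier transform on [L^2] *)

Section fourier_L2.
Context {R : realType}.
Local Notation mu := (@lebesgue_measure R).
Local Notation TR := (measurableTypeR R).
Local Notation C := (Cplx R).
Local Notation Re := (@complex.Re R).
Local Notation Im := (@complex.Im R).
Implicit Types f g u v F G : R -> C.
Local Notation q u := (Re (L2ip u u)).
Let sH := @CL2_subspace R.
Let hH := @L2_hermitian R.

Local Arguments L2ip : simpl never.
Local Arguments fourier1 : simpl never.
Local Arguments sqnorm : simpl never.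

Definition ctrunc (f : R -> C) (n : nat) : R -> C :=
  fun x => if x \in `[- n%:R, n%:R]%classic then f x else 0.

Lemma Re_ctrunc f n : Re \o ctrunc f n = (fun x => if x \in `[- n%:R,
  n%:R]%classic then Re (f x) else 0).
Proof. by apply/funext => x /=; rewrite /ctrunc; case: ifP. Qed.

Lemma Im_ctrunc f n : Im \o ctrunc f n = (fun x => if x \in `[- n%:R,
  n%:R]%classic then Im (f x) else 0).
Proof. by apply/funext => x /=; rewrite /ctrunc; case: ifP. Qed.

Lemma cmeas_ctrunc f n : cmeas f -> cmeas (ctrunc f n).
Proof. by move=> [m1 m2]; split; rewrite ?Re_ctrunc ?Im_ctrunc; exact: measurable_if_mem. Qed.

Lemma L2_bounded_support_integrable (D : set TR) (h : R -> R) : measurable D -> (mu D < +oo)%E ->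
  measurable_fun setT h -> mu.-integrable setT (EFin \o (fun x => h x ^+ 2)) ->
  mu.-integrable setT (EFin \o (fun x => if x \in D then h x else 0)).
Proof.
move=> mD Doo mh ih.
have -> : (fun x => if x \in D then h x else 0) = (h \_ D) by rewrite /patch.
rewrite -restrict_EFin; have Hk := (integrable_mkcond (mu := mu) (EFin \o h) mD).1; apply: Hk.
(* On a set of finite measure, 1 + h^2 is an integrable bound for [|h|]. *)
have i1 : mu.-integrable D (EFin \o cst (1 : R)).
  apply/integrableP; split; first exact/measurable_EFinP.
  by rewrite (eq_integral (cst 1%E)) ?integral_cst ?mul1e// => x _; rewrite /= normr1.
have i2 := integrableD mD i1 (integrableS measurableT mD (@subsetT _ _) ih).
apply: (le_integrable mD _ _ i2).
  by apply/measurable_EFinP; exact: measurable_funTS.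
move=> x _; rewrite lee_fin [leRHS]ger0_norm ?addr_ge0 ?sqr_ge0//.
rewrite -[leRHS]/(1 + h x ^+ 2) -(real_normK (num_real (h x))).
have := sqr_ge0 (`|h x| - 1); have := sqr_ge0 `|h x|; rewrite sqrrB expr1n mulr1; lra.
Qed.

Lemma ctrunc_L1 f n : CLfun 2%:E f -> CLfun 1%:E (ctrunc f n).
Proof.
move=> [/Lfun2P[m1 i1] /Lfun2P[m2 i2]]; apply/CL1P.
pose E := `[- n%:R, n%:R]%classic : set R.
have Eoo : (mu E < +oo)%E.
  by rewrite /E lebesgue_measure_itv/= lte_fin; case: ifP => // _; rewrite -EFinB ltry.
by split; rewrite ?Re_ctrunc ?Im_ctrunc; apply: L2_bounded_support_integrable.
Qed.

Lemma ctrunc_L2 f n : CLfun 2%:E f -> CLfun 2%:E (ctrunc f n).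
Proof.
move=> fL; have [mf foo] := (CL2P f).1 fL; apply/CL2P; split; first exact: cmeas_ctrunc.
apply: le_lt_trans foo; apply: ge0_le_integral => //.
- by move=> x _; rewrite lee_fin sqnorm_ge0.
- by apply/measurable_EFinP; apply: (cmeas_sqnorm (cmeas_ctrunc n mf)).
- by apply/measurable_EFinP; exact: (cmeas_sqnorm mf).
- by move=> x _; rewrite lee_fin /ctrunc; case: ifP => // _; rewrite sqnorm0 sqnorm_ge0.
Qed.

Lemma ctrunc_cvg f : CLfun 2%:E f -> q (ctrunc f n - f) @[n --> \oo] --> (0 : R).
Proof.
move=> fL; have [mf foo] := (CL2P f).1 fL.
have -> : 0 = \int[mu]_x (cst 0 x : R) by rewrite /Rintegral integral0.
under eq_fun do rewrite L2ip_q.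
apply: (@Rintegral_dct _ setT _ _ (fun x => sqnorm (f x))) => //.
- move=> n; apply: cmeas_sqnorm.
  by have := cmeasZD (-1) mf (cmeas_ctrunc n mf); rewrite scaleN1r addrC.
- move=> x _; apply: cvg_near_cst; near=> n.
  rewrite -[X in sqnorm X]/(ctrunc f n x - f x) /ctrunc mem_set ?subrr ?sqnorm0//=.
  by rewrite in_itv/= -ler_norml; near: n; exact: nbhs_infty_ger.
- exact: CL2_integrable.
- move=> n x _; rewrite ger0_norm ?sqnorm_ge0// -[X in sqnorm X]/(ctrunc f n x - f x) /ctrunc.
  by case: ifP => _; rewrite ?subrr ?sqnorm0 ?sqnorm_ge0// sub0r sqnormN.
Unshelve. all: by end_near. Qed.

Lemma L2_cvg_cauchy (u_ : nat -> R -> C) u : (forall n, CLfun 2%:E (u_ n)) -> CLfun 2%:E u ->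
  q (u_ n - u) @[n --> \oo] --> (0 : R) ->
  forall e, 0 < e -> exists N, forall m n, (N <= m)%N -> (N <= n)%N -> q (u_ m - u_ n) <= e.
Proof.
move=> uL_ uL cu e e0; have e4 : 0 < e / 4 by rewrite divr_gt0.
move/cvgrPdist_le : cu => /(_ _ e4)[N _ HN]; exists N => m n Nm Nn.
have uB k : CLfun 2%:E (u_ k - u) by exact: subspaceB.
have Hk k : (N <= k)%N -> q (u_ k - u) <= e / 4.
  move=> Nk; have h : `|0 - q (u_ k - u)| <= e / 4 := HN k Nk.
  by rewrite sub0r normrN ger0_norm ?(herm_q_ge0 hH)// in h.
have hm := Hk m Nm; have hn := Hk n Nn.
have -> : u_ m - u_ n = (u_ m - u) - (u_ n - u) by rewrite opprB addrA subrK.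
apply: (le_trans (herm_qD_le sH hH (uB m) (subspaceN sH (uB n)))).
rewrite (herm_qN sH hH (uB n)); lra.
Qed.

(** The truncations converge to f, so by Plancherel their transforms form a Cauchy sequence, and
    completeness gives the limit. *)
Lemma is_fourier_exists f : CLfun 2%:E f -> exists F, is_fourier f F.
Proof.
move=> fL; pose u n := ctrunc f n.
have u1 n : CLfun 1%:E (u n) by exact: ctrunc_L1.
have u2 n : CLfun 2%:E (u n) by exact: ctrunc_L2.
have cu := ctrunc_cvg fL.
have p0 : 0 < 2 * pi :> R by rewrite mulr_gt0 ?pi_gt0.
have [] := @L2_complete _ (fun n => fourier1 (u n)).
- by move=> n; case: (plancherel_complex (u1 n) (u2 n)).
- move=> e e0; have [N HN] := L2_cvg_cauchy u2 fL cu (divr_gt0 e0 p0).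
  exists N => m n Nm Nn; rewrite -fourier1B; try exact/CL1P.
  rewrite plancherel_q; last exact: subspaceB.
    by rewrite mulrC -ler_pdivlMr//; exact: HN.
  apply/CL1P; have := cintegrableZD (-1) ((CL1P _).1 (u1 n)) ((CL1P _).1 (u1 m)).
  by rewrite scaleN1r addrC.
- move=> F FL cF; exists F; split => //; exists u; split => //.
    exact/(L2nsq_cvg u2 fL).
  by apply/(@L2nsq_cvg _ (fun n => fourier1 (u n))) => // n;
    case: (plancherel_complex (u1 n) (u2 n)).
Qed.

Lemma is_fourierP f F : CLfun 2%:E f -> is_fourier f F <->
  CLfun 2%:E F /\ exists u : nat -> R -> C,
    [/\ forall m, cintegrable (u m) /\ CLfun 2%:E (u m),
        q (u m - f) @[m --> \oo] --> (0 : R),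
        forall m, CLfun 2%:E (fourier1 (u m)) &
        q (fourier1 (u m) - F) @[m --> \oo] --> (0 : R)].
Proof.
move=> fL; split=> [[FL [u [u12 cu cF]]]|[FL [u [u12 cu u2 cF]]]]; split => //; exists u.
  have u2 m := (plancherel_complex (u12 m).1 (u12 m).2).1.
  split => //.
  - by move=> m; split; [apply/CL1P; case: (u12 m)|case: (u12 m)].
  - by apply/L2nsq_cvg => // m; case: (u12 m).
  - by apply/(@L2nsq_cvg _ (fun n => fourier1 (u n))).
split.
- by move=> m; split; [apply/CL1P; case: (u12 m)|case: (u12 m)].
- by apply/L2nsq_cvg => // m; case: (u12 m).
- by apply/(@L2nsq_cvg _ (fun n => fourier1 (u n))).
Qed.

Lemma is_fourier_q f F : CLfun 2%:E f -> is_fourier f F -> q F = 2 * pi * q f.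
Proof.
move=> fL /is_fourierP-/(_ fL)[FL [u [u12 cu u2 cF]]].
have c1 := herm_cvg sH hH (fun m => (u12 m).2) fL cu.
have c2 := herm_cvg sH hH u2 FL cF.
apply: (cvg_unique _ c2); first exact: Rhausdorff.
have -> : (fun n => q (fourier1 (u n))) = (fun n => 2 * pi * q (u n)).
  by apply/funext => n; apply: plancherel_q; [apply/CL1P|]; case: (u12 n).
exact: cvgMl_tmp.
Qed.

Lemma is_fourierZD (c : R[i]) f g F G : CLfun 2%:E f -> CLfun 2%:E g ->
  is_fourier f F -> is_fourier g G -> is_fourier (c *: f + g) (c *: F + G).
Proof.
move=> fL gL /is_fourierP-/(_ fL)[FL [u [u12 cu u2 cF]]] /is_fourierP-/(_ gL)[GL [v [v12 cv v2
  cG]]].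
apply/is_fourierP; first exact: sH.2.
split; first exact: sH.2.
exists (fun m => c *: u m + v m).
have E m : fourier1 (c *: u m + v m) = c *: fourier1 (u m) + fourier1 (v m).
  by apply: fourier1ZD; [case: (u12 m)|case: (v12 m)].
have uL m := (u12 m).2; have vL m := (v12 m).2; have cuL m := subspaceZ sH c (uL m).
split.
- move=> m; split; last by apply: sH.2; [case: (u12 m)|case: (v12 m)].
  by apply: cintegrableZD; [case: (u12 m)|case: (v12 m)].
- exact: (herm_cvg0D sH hH cuL (subspaceZ sH c fL) vL gL (herm_cvg0Z sH hH c uL fL cu) cv).
- by move=> m; rewrite E; exact: sH.2.
- under eq_fun do rewrite E.
  exact: (herm_cvg0D sH hH (fun m => subspaceZ sH c (u2 m)) (subspaceZ sH c FL) v2 GL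
    (herm_cvg0Z sH hH c u2 FL cF) cG).
Qed.

Lemma L2_q_eq0_ae u : CLfun 2%:E u -> q u = 0 -> {ae mu, forall x, u x = 0}.
Proof.
move=> uL u0; have [mu_ _] := (CL2P u).1 uL.
have : L2nsq u = 0%E by rewrite L2nsq_q// u0.
have mE : measurable_fun setT (fun x => (sqnorm (u x))%:E).
  by apply/measurable_EFinP; exact: cmeas_sqnorm.
move=> h0; have h1 : (\int[mu]_x `|(sqnorm (u x))%:E| = 0)%E.
  by rewrite -h0; apply: eq_integral => x _; rewrite gee0_abs// lee_fin sqnorm_ge0.
have := (ae_eq_integral_abs mu measurableT mE).1 h1.
by apply: ae_imply => x /(_ I) [/sqnorm_eq0].
Qed.

(** The difference of two versions is a transform of 0, and [is_fourier_q] makes its norm vanish. *)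
Lemma is_fourier_unique f F G : CLfun 2%:E f -> is_fourier f F -> is_fourier f G ->
  {ae mu, forall x, F x = G x}.
Proof.
move=> fL fF fG; have := is_fourierZD (-1) fL fL fG fF.
rewrite !scaleN1r addNr => h0.
have q0 : q (- G + F) = 0.
  by rewrite (is_fourier_q sH.1 h0) (herm0l sH hH sH.1)/= mulr0.
have L : CLfun 2%:E (- G + F) by case: h0.
have := L2_q_eq0_ae L q0; apply: ae_imply => x /eqP.
by rewrite -[_ x]/(- G x + F x) addrC subr_eq0 => /eqP.
Qed.

Lemma fourierP f : CLfun 2%:E f -> is_fourier f (fourier f).
Proof.
move=> fL; have [F fF] := is_fourier_exists fL.
exact: (@xgetPex _ 0 [set F | is_fourier f F] (ex_intro _ F fF)).
Qed.

Lemma fourier_ae_eq f F : CLfun 2%:E f -> is_fourier f F -> {ae mu, forall x, fourier f x = F x}.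
Proof. by move=> fL fF; apply: (is_fourier_unique fL) => //; exact: fourierP. Qed.

(* The set of versions from which [fourier] chooses depends only on the almost everywhere class. *)
Lemma fourier_congr f g : CLfun 2%:E f -> CLfun 2%:E g -> q (f - g) = 0 -> fourier f = fourier g.
Proof.
move=> fL gL fg0; rewrite /fourier; congr xget; apply/seteqP.
have key h k F : CLfun 2%:E h -> CLfun 2%:E k -> q (h - k) = 0 -> is_fourier h F -> is_fourier k F.
  move=> hL kL hk0 /is_fourierP-/(_ hL)[FL [u [u12 cu u2 cF]]].
  apply/is_fourierP => //; split => //; exists u; split => //.
  have uh m : CLfun 2%:E (u m - h) by apply: (subspaceB sH) => //; case: (u12 m).
  have hk : CLfun 2%:E (h - k) by exact: (subspaceB sH).
  apply: (@squeeze_cvgr _ _ _ _ (cst 0) (fun m => 2 * q (u m - h) + 2 * q (h - k))).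
  - apply: nearW => m /=.
    have -> : u m - k = (u m - h) + (h - k) by rewrite addrA subrK.
    by rewrite (herm_q_ge0 hH) ?(herm_qD_le sH hH)//; exact: (subspaceD sH).
  - exact: cvg_cst.
  - rewrite hk0 mulr0 -[X in _ --> X]addr0 -[X in _ --> X + _](mulr0 2).
    by apply: cvgD; [exact: cvgMl_tmp|exact: cvg_cst].
split=> F /=; first exact: key.
apply: key => //; rewrite -opprB (herm_qN sH hH)//; exact: (subspaceB sH).
Qed.

Lemma is_fourier_ip f g F G : CLfun 2%:E f -> CLfun 2%:E g -> is_fourier f F -> is_fourier g G ->
  L2ip F G = (2 * pi)%:C * L2ip f g.
Proof.
move=> fL gL fF gG; have [FL GL] := (fF.1, gG.1).
have fq c : q (F + c *: G) = 2 * pi * q (f + c *: g).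
  rewrite addrC [f + _]addrC; apply: is_fourier_q; first exact: sH.2.
  exact: is_fourierZD.
apply: complexP; rewrite ?ReCMl ?ImCMl.
  rewrite (herm_polar_Re sH hH)// (herm_polar_Re sH hH fL gL).
  have := fq 1; have := fq (-1); rewrite !scaleN1r !scale1r => -> ->; ring.
rewrite (herm_polar_Im sH hH)// (herm_polar_Im sH hH fL gL).
have := fq 'i; have := fq (- 'i); rewrite !scaleNr => -> ->; ring.
Qed.

End fourier_L2.

Section fourier_surj.
Context {R : realType}.
Local Notation mu := (@lebesgue_measure R).
Local Notation TR := (measurableTypeR R).
Local Notation C := (Cplx R).
Local Notation Re := (@complex.Re R).
Local Notation Im := (@complex.Im R).
Implicit Types f g u v F G : R -> C.
Local Notation q u := (Re (L2ip u u)).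
Let sH := @CL2_subspace R.
Let hH := @L2_hermitian R.
Local Opaque L2ip fourier1 L2nsq cint.

Lemma cint0 : cint (0 : R -> C) = 0.
Proof. by apply: complexP; rewrite ?Re_cint ?Im_cint /Rintegral integral0. Qed.

Lemma cintegrable0 : cintegrable (0 : R -> C).
Proof. by split; rewrite (_ : _ \o _ = cst 0)//; exact: integrable0. Qed.

Lemma cosT_dual (a c : R -> R) : mu.-integrable setT (EFin \o a) ->
  mu.-integrable setT (EFin \o c) ->
  \int[mu]_xi (c xi * cosT a xi) = \int[mu]_x (a x * cosT c x).
Proof.
move=> ia ic.
have mk : measurable_fun [set: TR * TR] (fun z : TR * TR => cos (z.1 * z.2) : TR).
  by apply: (measurableT_comp measurable_cos); exact: measurable_mulp.
rewrite /cosT (fubini_kernel ic ia mk (fun z => cos_abs_le1 _)).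
by apply: eq_Rintegral => x _; congr (_ * _); apply: eq_Rintegral => y _; rewrite /= (mulrC y).
Qed.

Lemma sinT_dual (a c : R -> R) : mu.-integrable setT (EFin \o a) ->
  mu.-integrable setT (EFin \o c) ->
  \int[mu]_xi (c xi * sinT a xi) = \int[mu]_x (a x * sinT c x).
Proof.
move=> ia ic.
have mk : measurable_fun [set: TR * TR] (fun z : TR * TR => sin (z.1 * z.2) : TR).
  by apply: (measurableT_comp measurable_sin); exact: measurable_mulp.
rewrite /sinT (fubini_kernel ic ia mk (fun z => sin_abs_le1 _)).
by apply: eq_Rintegral => x _; congr (_ * _); apply: eq_Rintegral => y _; rewrite /= (mulrC y).
Qed.

Definition ifourier1 G : R -> C := fun x => ((2 * pi)^-1)%:C * fourier1 G (- x).

Lemma integrable_cosT_mul (a c : R -> R) : mu.-integrable setT (EFin \o a) ->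
  mu.-integrable setT (EFin \o c) ->
  mu.-integrable setT (EFin \o (fun xi => c xi * cosT a xi)).
Proof.
move=> ia ic; apply: (@integrableM_bounded _ c (cosT a) (\int[mu]_x `|a x|)) => //.
  by apply: measurable_cosT; case/integrableP : ia => /measurable_EFinP.
by move=> xi; exact: cosT_le.
Qed.

Lemma integrable_sinT_mul (a c : R -> R) : mu.-integrable setT (EFin \o a) ->
  mu.-integrable setT (EFin \o c) ->
  mu.-integrable setT (EFin \o (fun xi => c xi * sinT a xi)).
Proof.
move=> ia ic; apply: (@integrableM_bounded _ c (sinT a) (\int[mu]_x `|a x|)) => //.
  by apply: measurable_sinT; case/integrableP : ia => /measurable_EFinP.
by move=> xi; exact: sinT_le.
Qed.

Lemma ifourier1_Re G x : cintegrable G ->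
  Re (ifourier1 G x) = (2 * pi)^-1 * (cosT (Re \o G) x - sinT (Im \o G) x).
Proof.
move=> GI; rewrite /ifourier1 ReCMl fourier1_Re// cosT_reflect sinT_reflect//.
by case: GI.
Qed.

Lemma ifourier1_Im G x : cintegrable G ->
  Im (ifourier1 G x) = (2 * pi)^-1 * (cosT (Im \o G) x + sinT (Re \o G) x).
Proof.
move=> GI; rewrite /ifourier1 ImCMl fourier1_Im// cosT_reflect sinT_reflect ?opprK//.
by case: GI.
Qed.

(** Fubini for each cosine and sine transform, followed by a regrouping of the four resulting
    integrals: up to the factor 2 pi, [ifourier1] is the adjoint of [fourier1]. *)
Lemma fourier1_adjoint f G : cintegrable f -> cintegrable G ->
  Re (L2ip (fourier1 f) G) = 2 * pi * Re (L2ip f (ifourier1 G)).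
Proof.
move=> fI GI; have [[a1 b1] [c1 d1]] := (fI, GI).
have p0 : 2 * pi != 0 :> R by rewrite mulf_neq0 ?gt_eqF// ?pi_gt0.
set a := Re \o f in a1; set b := Im \o f in b1; set c := Re \o G in c1; set d := Im \o G in d1.
transitivity (\int[mu]_xi ((c xi * cosT a xi + c xi * sinT b xi) + (d xi * cosT b xi - d xi * sinT
  a xi))).
  rewrite L2ipE Re_cint; apply: eq_Rintegral => xi _.
  rewrite !ReImE (fourier1_Re _ fI) (fourier1_Im _ fI) /a /b /c /d/=; ring.
have [i1 i2] := (integrable_cosT_mul a1 c1, integrable_sinT_mul b1 c1).
have [i3 i4] := (integrable_cosT_mul b1 d1, integrable_sinT_mul a1 d1).
rewrite (RintegralD measurableT (integrableD measurableT i1 i2) (integrableB measurableT i3 i4)).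
rewrite (RintegralD measurableT i1 i2) (RintegralB measurableT i3 i4).
rewrite (cosT_dual a1 c1) (sinT_dual b1 c1) (cosT_dual b1 d1) (sinT_dual a1 d1).
have [j1 j2] := (integrable_cosT_mul c1 a1, integrable_sinT_mul c1 b1).
have [j3 j4] := (integrable_cosT_mul d1 b1, integrable_sinT_mul d1 a1).
have alg (A B C D : R) : A + B + (C - D) = A - D + (B + C) by ring.
rewrite alg -(RintegralB measurableT j1 j4) -(RintegralD measurableT j2 j3).
pose T1 x := a x * cosT c x - a x * sinT d x.
pose T2 x := b x * sinT c x + b x * cosT d x.
have iT1 : mu.-integrable setT (EFin \o T1) by exact: (integrableB measurableT j1 j4).
have iT2 : mu.-integrable setT (EFin \o T2) by exact: (integrableD measurableT j2 j3).
rewrite -[LHS](RintegralD measurableT iT1 iT2).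
have iT : mu.-integrable setT (EFin \o (fun x => T1 x + T2 x)) by exact: (integrableD measurableT
  iT1 iT2).
have -> : Re (L2ip f (ifourier1 G)) = \int[mu]_x ((2 * pi)^-1 * (T1 x + T2 x)).
  rewrite L2ipE Re_cint; apply: eq_Rintegral => x _.
  rewrite ReME ReCE ImCE (ifourier1_Re _ GI) (ifourier1_Im _ GI) /T1 /T2 /a /b.
  by rewrite -[(Re \o f) x]/(Re (f x)) -[(Im \o f) x]/(Im (f x)); ring.
by rewrite (RintegralZl (2 * pi)^-1 measurableT iT) mulrA mulfV// mul1r.
Qed.

Lemma ifourier1_plancherel G : CLfun 1%:E G -> CLfun 2%:E G ->
  CLfun 2%:E (ifourier1 G) /\ q (ifourier1 G) = (2 * pi)^-1 * q G.
Proof.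
move=> G1 G2; have GI := (CL1P G).1 G1.
have p0 : 2 * pi != 0 :> R by rewrite mulf_neq0 ?gt_eqF// ?pi_gt0.
have [FL FE] := plancherel_complex G1 G2.
have [[m1 m2] _] := (CL2P _).1 FL.
have mr : cmeas (fun x => fourier1 G (- x)).
  by split; [apply: (measurableT_comp m1)|apply: (measurableT_comp m2)]; exact: oppr_measurable.
have h : L2nsq (fun x => fourier1 G (- x)) = L2nsq (fourier1 G).
  rewrite !L2nsq_def; apply: (ge0_integral_reflect (f := fun x => (sqnorm (fourier1 G x))%:E)).
    by apply/measurable_EFinP; exact: cmeas_sqnorm.
  by move=> x; rewrite lee_fin sqnorm_ge0.
have rL : CLfun 2%:E (fun x => fourier1 G (- x)).
  by apply/CL2P; split; [exact: mr|rewrite h; case: ((CL2P _).1 FL)].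
have -> : ifourier1 G = ((2 * pi)^-1)%:C *: (fun x => fourier1 G (- x) : C) by [].
split; first exact: (subspaceZ sH _ rL).
rewrite (herm_qZ sH hH _ rL).
have -> : q (fun x => fourier1 G (- x)) = q (fourier1 G).
  have e := L2nsq_q rL; rewrite h (L2nsq_q FL) in e; exact: (esym (EFin_inj e)).
rewrite (plancherel_q G1 G2) sqnorm_real.
have alg (P x : R) : P != 0 -> P^-1 ^+ 2 * (P * x) = P^-1 * x by move=> P0; field.
exact: alg.
Qed.

Lemma ifourier1B f g : cintegrable f -> cintegrable g ->
  ifourier1 (f - g) = ifourier1 f - ifourier1 g.
Proof.
by move=> fI gI; apply/funext => x; rewrite /ifourier1 fourier1B// -mulrBr.
Qed.

(** No pointwise inversion is involved. Let f be the limit in norm of the inverse transforms of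
    truncations of G, and H its transform. Plancherel gives q H = q G, and adjointness gives Re <H |
    G> = q G; hence q (H - G) = 0. *)
Lemma fourier_surj G : CLfun 2%:E G -> exists2 f, CLfun 2%:E f & is_fourier f G.
Proof.
move=> GL; pose u n := ctrunc G n.
have u1 n : CLfun 1%:E (u n) by exact: ctrunc_L1.
have u2 n : CLfun 2%:E (u n) by exact: ctrunc_L2.
have cu : q (u n - G) @[n --> \oo] --> (0 : R) := ctrunc_cvg GL.
have p0 : 0 < 2 * pi :> R by rewrite mulr_gt0 ?pi_gt0.
have pN : 2 * pi != 0 :> R by rewrite gt_eqF.
have v2 n := (ifourier1_plancherel (u1 n) (u2 n)).1.
have uI n := (CL1P _).1 (u1 n).
have [] := @L2_complete _ (fun n => ifourier1 (u n)) v2.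
  move=> e e0; have [N HN] := L2_cvg_cauchy u2 GL cu (mulr_gt0 p0 e0).
  exists N => m n Nm Nn; rewrite -ifourier1B//.
  rewrite (ifourier1_plancherel _ _).2; last exact: subspaceB.
    by rewrite mulrC ler_pdivrMr// mulrC; exact: HN.
  by apply/CL1P; have := cintegrableZD (-1) (uI n) (uI m); rewrite scaleN1r addrC.
move=> f fL cf; exists f => //.
have fH := fourierP fL; set H := fourier f in fH.
have HL : CLfun 2%:E H by case: fH.
have qf : q f = (2 * pi)^-1 * q G.
  have c1 := herm_cvg sH hH v2 fL cf; have c2 := herm_cvg sH hH u2 GL cu.
  apply: (cvg_unique _ c1); first exact: Rhausdorff.
  have -> : (fun n => q (ifourier1 (u n))) = (fun n => (2 * pi)^-1 * q (u n)).
    by apply/funext => n; exact: (ifourier1_plancherel (u1 n) (u2 n)).2.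
  exact: cvgMl_tmp.
have qH : q H = q G by rewrite (is_fourier_q fL fH) qf mulrA mulfV// mul1r.
have HG : Re (L2ip H G) = q G.
  have [_ [s [s12 cs sF2 cH]]] := (is_fourierP H fL).1 fH.
  have s2 m := (s12 m).2.
  have [c1 _] := herm_cvg_ip sH hH sF2 HL u2 GL cH cu.
  have [c2 _] := herm_cvg_ip sH hH s2 fL v2 fL cs cf.
  apply: (cvg_unique _ c1); first exact: Rhausdorff.
  have -> : (fun n => Re (L2ip (fourier1 (s n)) (u n))) = (fun n => 2 * pi * Re (L2ip (s n)
    (ifourier1 (u n)))).
    by apply/funext => n; apply: fourier1_adjoint => //; case: (s12 n).
  have -> : q G = 2 * pi * q f by rewrite qf mulrA mulfV// mul1r.
  exact: cvgMl_tmp.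
have q0 : q (H - G) = 0 by rewrite (herm_qB sH hH)// HG qH; ring.
have HGL : CLfun 2%:E (H - G) by exact: (subspaceB sH).
(* A null function is a version of the transform of 0; adding this one to H yields G itself as a
   version. *)
have z0 : is_fourier (0 : R -> C) (G - H).
  have GHL : CLfun 2%:E (G - H) by exact: (subspaceB sH).
  have qGH : q (G - H) = 0 by rewrite -opprB (herm_qN sH hH).
  have f10 : fourier1 (0 : R -> C) = 0.
    apply/funext => xi; rewrite fourier1E (_ : (fun x => _) = 0) ?cint0//.
    by apply/funext => x; rewrite mul0r.
  apply/(is_fourierP _ sH.1); split => //; exists (fun=> 0); split.
  - move=> _; split; last exact: sH.1.
    exact: cintegrable0.
  - by rewrite subrr (herm0l sH hH sH.1); exact: cvg_cst.
  - by move=> _; rewrite f10; exact: sH.1.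
  - by rewrite f10 sub0r (herm_qN sH hH)// qGH; exact: cvg_cst.
have := is_fourierZD 1 sH.1 fL z0 fH.
by rewrite !scale1r add0r subrK.
Qed.

End fourier_surj.

(** * The Fourier transform of a translate *)

Section fourier_translate.
Context {R : realType}.
Local Notation mu := (@lebesgue_measure R).
Local Notation TR := (measurableTypeR R).
Local Notation C := (Cplx R).
Local Notation Re := (@complex.Re R).
Local Notation Im := (@complex.Im R).
Implicit Types f g u v F G : R -> C.
Local Notation q u := (Re (L2ip u u)).
Let sH := @CL2_subspace R.
Let hH := @L2_hermitian R.
Local Opaque L2ip fourier1 L2nsq cint.

Lemma cmeas_translate b f : cmeas f -> cmeas (fun x => f (x + b)).
Proof.
by move=> [m1 m2]; split; [apply: (measurableT_comp m1)|apply: (measurableT_comp m2)];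
  exact: measurable_funD.
Qed.

Lemma L2nsq_translate b f : cmeas f -> L2nsq (fun x => f (x + b)) = L2nsq f.
Proof.
move=> mf; rewrite !L2nsq_def; apply: (ge0_integral_translate b (f := fun x => (sqnorm (f x))%:E)).
  by apply/measurable_EFinP; exact: cmeas_sqnorm.
by move=> x; rewrite lee_fin sqnorm_ge0.
Qed.

Lemma CL2_translate b f : CLfun 2%:E f -> CLfun 2%:E (fun x => f (x + b)).
Proof.
by move=> /CL2P[mf foo]; apply/CL2P; rewrite L2nsq_translate//; split => //; exact: cmeas_translate.
Qed.

Lemma q_translate b f : CLfun 2%:E f -> q (fun x => f (x + b)) = q f.
Proof.
move=> fL; apply: EFin_inj; rewrite -!L2nsq_q//; last exact: CL2_translate.
by apply: L2nsq_translate; case/CL2P : fL.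
Qed.

Lemma cint_translate b f : cmeas f -> cint (fun x => f (x + b)) = cint f.
Proof.
move=> [m1 m2]; apply: complexP; rewrite ?Re_cint ?Im_cint.
  exact: (Rintegral_translate b m1).
exact: (Rintegral_translate b m2).
Qed.

Lemma cmeas_expi t : cmeas (fun x : R => expi (t * x)).
Proof. by split; [exact: measurable_cosM|exact: measurable_sinM]. Qed.

Lemma fourier1_translate b f : cintegrable f ->
  fourier1 (fun x => f (x + b)) = (fun xi => expi (b * xi) * fourier1 f xi).
Proof.
move=> fI; apply/funext => xi; rewrite !fourier1E.
have E := cint_translate b (cmeasM (cintegrable_cmeas fI) (cmeas_expi (- xi))).
under [in RHS]eq_fun do rewrite -mulNr.
rewrite -E.
have I0 : cintegrable (fun x => f (x + b) * expi (- xi * (x + b))).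
  have [i1 i2] := cintegrable_expi (- xi) fI.
  by split; [exact: (integrable_translate b i1)|exact: (integrable_translate b i2)].
have := cintZD (expi (b * xi)) I0 (@cintegrable0 R).
rewrite cint0 !addr0 => <-; congr cint; apply/funext => x.
rewrite -[RHS]/(expi (b * xi) * (f (x + b) * expi (- xi * (x + b)))) mulrCA -expiD.
by congr (_ * expi _); ring.
Qed.

Lemma CL2_expi b F : CLfun 2%:E F -> CLfun 2%:E (fun xi => expi (b * xi) * F xi) /\
  q (fun xi => expi (b * xi) * F xi) = q F.
Proof.
move=> FL; have [mF foo] := (CL2P F).1 FL.
have E : L2nsq (fun xi => expi (b * xi) * F xi) = L2nsq F.
  by rewrite !L2nsq_def; apply: eq_integral => x _; rewrite sqnormM sqnorm_expi mul1r.
have L : CLfun 2%:E (fun xi => expi (b * xi) * F xi).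
  by apply/CL2P; rewrite E; split => //; apply: cmeasM => //; exact: cmeas_expi.
by split => //; apply: EFin_inj; rewrite -!L2nsq_q.
Qed.

Lemma is_fourier_translate b f F : CLfun 2%:E f -> is_fourier f F ->
  is_fourier (fun x => f (x + b)) (fun xi => expi (b * xi) * F xi).
Proof.
move=> fL /is_fourierP-/(_ fL)[FL [u [u12 cu u2 cF]]].
apply/is_fourierP; first exact: CL2_translate.
split; first by case: (CL2_expi b FL).
exists (fun m x => u m (x + b)); split.
- move=> m; split; last by apply: CL2_translate; case: (u12 m).
  have [[i1 i2] _] := u12 m.
  by split; [exact: (integrable_translate b i1)|exact: (integrable_translate b i2)].
- have -> : (fun m => q ((fun x => u m (x + b)) - (fun x => f (x + b)))) = (fun m => q (u m - f)).
    apply/funext => m; rewrite -(@q_translate b (u m - f))//.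
    by apply: (subspaceB sH) => //; case: (u12 m).
  exact: cu.
- by move=> m; rewrite fourier1_translate; [case: (CL2_expi b (u2 m))|case: (u12 m)].
- have -> : (fun m => q (fourier1 (fun x => u m (x + b)) - (fun xi => expi (b * xi) * F xi))) =
            (fun m => q (fourier1 (u m) - F)).
    apply/funext => m; rewrite fourier1_translate; last by case: (u12 m).
    rewrite -(CL2_expi b (subspaceB sH (u2 m) FL)).2.
    have -> // : (fun xi => expi (b * xi) * fourier1 (u m) xi) - (fun xi => expi (b * xi) * F xi) =
        ((fun xi => expi (b * xi) * (fourier1 (u m) - F) xi) : R -> C).
    by apply/funext => xi; exact: (esym (mulrBr _ _ _)).
  exact: cF.
Qed.

End fourier_translate.

(** * Unconditional sums and the space [l^2] *)

Section esum_extra.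
Context {R : realType} {I : choiceType}.
Implicit Types (D : set I) (u v : I -> R).

Lemma esum_fin_num D (u : I -> \bar R) : (forall i, D i -> 0 <= u i)%E ->
  (\esum_(i in D) u i < +oo)%E -> (\esum_(i in D) u i)%E \is a fin_num.
Proof. by move=> u0 uoo; rewrite ge0_fin_numE//; exact: esum_ge0. Qed.

Lemma esum_leP D u (c : R) :
  (forall s : seq I, uniq s -> (forall i, i \in s -> D i) -> \sum_(i <- s) u i <= c) ->
  (\esum_(i in D) (u i)%:E <= c%:E)%E.
Proof.
move=> h; apply: ge_ereal_sup => _ [X [finX XD] <-].
rewrite fsbig_finite//= sumEFin lee_fin; apply: h; first exact: finmap.fset_uniq.
by move=> i; rewrite in_fset_set// inE; exact: XD.
Qed.

Lemma esum_ge_seq D u (s : seq I) : uniq s -> (forall i, i \in s -> D i) ->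
  ((\sum_(i <- s) u i)%:E <= \esum_(i in D) (u i)%:E)%E.
Proof.
move=> us sD; apply: ereal_sup_ubound; exists [set` s]; first by split => // i /= /sD.
by rewrite -fsbig_seq// sumEFin.
Qed.

Lemma esum_ge1 D u i : (forall i, D i -> 0 <= u i) -> D i ->
  ((u i)%:E <= \esum_(i in D) (u i)%:E)%E.
Proof.
move=> u0 Di; rewrite (esumID [set i]); last by move=> j Dj; rewrite lee_fin u0.
rewrite setI1 mem_set// esum_set1 ?lee_fin ?u0//; apply: leeDl; apply: esum_ge0 => j [Dj _].
by rewrite lee_fin u0.
Qed.

Lemma esumZ_le D u (r : R) : 0 <= r -> (forall i, D i -> 0 <= u i) ->
  (\esum_(i in D) (r * u i)%:E <= r%:E * \esum_(i in D) (u i)%:E)%E.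
Proof.
move=> r0 u0; apply: ge_ereal_sup => _ [X [finX XD] <-].
rewrite fsbig_finite//= sumEFin -mulr_sumr EFinM lee_wpmul2l//.
apply: esum_ge_seq; first exact: finmap.fset_uniq.
by move=> i; rewrite in_fset_set// inE; exact: XD.
Qed.

Lemma esumZ D u (r : R) : 0 <= r -> (forall i, D i -> 0 <= u i) ->
  (\esum_(i in D) (r * u i)%:E = r%:E * \esum_(i in D) (u i)%:E)%E.
Proof.
move=> r0 u0; apply/eqP; rewrite eq_le esumZ_le//=.
have [->|rN0] := eqVneq r 0; first by rewrite mul0e; apply: esum_ge0 => i _; rewrite mul0r.
have {}r0 : 0 < r by rewrite lt_neqAle eq_sym rN0.
rewrite muleC -lee_pdivlMr// muleC.
have := @esumZ_le D (fun i => r * u i) r^-1.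
rewrite invr_ge0 => /(_ (ltW r0)) h; apply: le_trans (h _); last first.
  by move=> i Di; rewrite mulr_ge0 ?u0// ltW.
by rewrite le_eqVlt; apply/orP; left; apply/eqP/eq_esum => i Di; rewrite mulKf// gt_eqF.
Qed.

(** The positive and negative parts that define [rsum] may be replaced by any difference of
    nonnegative summable families; the linearity of [rsum] rests on this freedom. *)
Lemma rsum_sub D (a u v : I -> R) :
  (forall i, D i -> 0 <= u i) -> (forall i, D i -> 0 <= v i) ->
  (\esum_(i in D) (u i)%:E < +oo)%E -> (\esum_(i in D) (v i)%:E < +oo)%E ->
  (forall i, D i -> a i = u i - v i) ->
  summable D (EFin \o a) /\
  rsum D a = fine (\esum_(i in D) (u i)%:E) - fine (\esum_(i in D) (v i)%:E).
Proof.
move=> u0 v0 uoo voo auv.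
have su : summable D (EFin \o u).
  by rewrite /summable (eq_esum (b := fun i => (u i)%:E))// => i Di; rewrite gee0_abs// lee_fin u0.
have sv : summable D (EFin \o v).
  by rewrite /summable (eq_esum (b := fun i => (v i)%:E))// => i Di; rewrite gee0_abs// lee_fin v0.
have fu : (\esum_(i in D) (u i)%:E)%E \is a fin_num by apply: esum_fin_num => // i Di;
  rewrite lee_fin u0.
have fv : (\esum_(i in D) (v i)%:E)%E \is a fin_num by apply: esum_fin_num => // i Di;
  rewrite lee_fin v0.
have := summableB su sv.
have -> : summable D ((EFin \o u) \- (EFin \o v))%E = summable D (EFin \o a).
  by rewrite /summable; congr (_ < _)%E; apply: eq_esum => i Di; rewrite /= auv.
move=> sa; split => //; rewrite /rsum.
have -> : (\esum_(i in D) (EFin \o a)^\+ i = \esum_(i in D) ((EFin \o u) \- (EFin \o v))%E^\+ i)%E.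
  by apply: eq_esum => i Di; rewrite !funeposE /= auv.
have -> : (\esum_(i in D) (EFin \o a)^\- i = \esum_(i in D) ((EFin \o u) \- (EFin \o v))%E^\- i)%E.
  by apply: eq_esum => i Di; rewrite !funenegE /= auv.
have f1 : (\esum_(i in D) ((EFin \o u) \- (EFin \o v))%E^\+ i)%E \is a fin_num.
  apply: esum_fin_num => [i _|]; first exact: funepos_ge0.
  apply: le_lt_trans uoo; apply: le_esum => i Di; rewrite funeposE /= -EFinB -EFin_max lee_fin
    ge_max.
  by have := u0 i Di; have := v0 i Di => ? ?; apply/andP; split; lra.
have f2 : (\esum_(i in D) ((EFin \o u) \- (EFin \o v))%E^\- i)%E \is a fin_num.
  apply: esum_fin_num => [i _|]; first exact: funeneg_ge0.
  apply: le_lt_trans voo; apply: le_esum => i Di; rewrite funenegE /= -EFin_max lee_fin ge_max.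
  by have := u0 i Di; have := v0 i Di => ? ?; apply/andP; split; lra.
by rewrite -fineB// (esumB su sv)// ?fineB//.
Qed.

Lemma eq_rsum D (u v : I -> R) : (forall i, D i -> u i = v i) -> rsum D u = rsum D v.
Proof.
by move=> uv; rewrite /rsum; congr (fine _ - fine _); apply: eq_esum => i Di;
  rewrite ?funeposE ?funenegE /= uv.
Qed.

Lemma eq_csum D (u v : I -> R[i]) : (forall i, D i -> u i = v i) -> csum D u = csum D v.
Proof. by move=> uv; rewrite /csum; congr Complex; apply: eq_rsum => i Di; rewrite uv. Qed.

End esum_extra.

(** * Linearity of unconditional sums *)

Section rsum_linear.
Context {R : realType} {I : choiceType}.
Implicit Types (D : set I) (a b : I -> R) (f g : I -> R[i]).
Local Notation Re := (@complex.Re R).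
Local Notation Im := (@complex.Im R).

Lemma summable_split D a : summable D (EFin \o a) -> exists u v : I -> R,
  [/\ (forall i, 0 <= u i) /\ (forall i, 0 <= v i),
   (\esum_(i in D) (u i)%:E < +oo)%E, (\esum_(i in D) (v i)%:E < +oo)%E & forall i,
     a i = u i - v i].
Proof.
move=> sa; exists (fun i => Num.max (a i) 0), (fun i => Num.max (- a i) 0); split.
- by split=> i; rewrite le_max lexx orbT.
- by apply: le_lt_trans (sa); apply: le_esum => i _; rewrite lee_fin ge_max ler_norm normr_ge0.
- by apply: le_lt_trans (sa); apply: le_esum => i _;
  rewrite lee_fin ge_max -normrN ler_norm normr_ge0.
- move=> i; have [h|h] := leP (a i) 0.
    by rewrite max_l ?oppr_ge0// sub0r opprK.
  by rewrite max_r ?subr0// oppr_le0 ltW.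
Qed.

Lemma rsumD D a b : summable D (EFin \o a) -> summable D (EFin \o b) ->
  summable D (EFin \o (fun i => a i + b i)) /\
  rsum D (fun i => a i + b i) = rsum D a + rsum D b.
Proof.
move=> /summable_split[u [v [[u0 v0] uoo voo auv]]] /summable_split[u' [v' [[u0' v0'] uoo' voo'
  buv]]].
have [_ ->] := rsum_sub (fun i _ => u0 i) (fun i _ => v0 i) uoo voo (fun i _ => auv i).
have [_ ->] := rsum_sub (fun i _ => u0' i) (fun i _ => v0' i) uoo' voo' (fun i _ => buv i).
have fin (w : I -> R) : (forall i, 0 <= w i) -> (\esum_(i in D) (w i)%:E < +oo)%E ->
    (\esum_(i in D) (w i)%:E)%E \is a fin_num 
  by move=> w0 woo; apply: esum_fin_num => // i _; rewrite lee_fin.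
have ad (w w' : I -> R) : (forall i, 0 <= w i) -> (forall i, 0 <= w' i) ->
    (\esum_(i in D) (w i + w' i)%:E = \esum_(i in D) (w i)%:E + \esum_(i in D) (w' i)%:E)%E.
  by move=> w0 w0'; rewrite -esumD// => i _; rewrite lee_fin.
have [] := @rsum_sub _ _ D (fun i => a i + b i) (fun i => u i + u' i) (fun i => v i + v' i).
- by move=> i _; rewrite addr_ge0.
- by move=> i _; rewrite addr_ge0.
- by rewrite ad// lte_add_pinfty.
- by rewrite ad// lte_add_pinfty.
- by move=> i _; rewrite auv buv; ring.
move=> s ->; split => //; rewrite !ad// !fineD ?fin//; ring.
Qed.

Lemma rsumN D a : summable D (EFin \o a) ->
  summable D (EFin \o (fun i => - a i)) /\ rsum D (fun i => - a i) = - rsum D a.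
Proof.
move=> /summable_split[u [v [[u0 v0] uoo voo auv]]].
have [_ ->] := rsum_sub (fun i _ => u0 i) (fun i _ => v0 i) uoo voo (fun i _ => auv i).
have [] := @rsum_sub _ _ D (fun i => - a i) v u (fun i _ => v0 i) (fun i _ => u0 i) voo uoo.
  by move=> i _; rewrite auv opprB.
by move=> ? ->; split => //; rewrite opprB.
Qed.

Lemma rsumZ_ge0 D a (r : R) : 0 <= r -> summable D (EFin \o a) ->
  summable D (EFin \o (fun i => r * a i)) /\ rsum D (fun i => r * a i) = r * rsum D a.
Proof.
move=> r0 /summable_split[u [v [[u0 v0] uoo voo auv]]].
have [_ ->] := rsum_sub (fun i _ => u0 i) (fun i _ => v0 i) uoo voo (fun i _ => auv i).
have fin (w : I -> R) : (forall i, 0 <= w i) -> (\esum_(i in D) (w i)%:E < +oo)%E ->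
    (\esum_(i in D) (w i)%:E)%E \is a fin_num 
  by move=> w0 woo; apply: esum_fin_num => // i _; rewrite lee_fin.
have [] := @rsum_sub _ _ D (fun i => r * a i) (fun i => r * u i) (fun i => r * v i).
- by move=> i _; rewrite mulr_ge0.
- by move=> i _; rewrite mulr_ge0.
- by rewrite esumZ// -(fineK (fin _ u0 uoo)) -EFinM ltry.
- by rewrite esumZ// -(fineK (fin _ v0 voo)) -EFinM ltry.
- by move=> i _; rewrite auv mulrBr.
by move=> s ->; split => //; rewrite !esumZ// !fineM ?fin// mulrBr.
Qed.

Lemma rsumZ D a (r : R) : summable D (EFin \o a) ->
  summable D (EFin \o (fun i => r * a i)) /\ rsum D (fun i => r * a i) = r * rsum D a.
Proof.
move=> sa; have [r0|r0] := leP 0 r; first exact: rsumZ_ge0.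
have [s e] := rsumN sa; have r0' : 0 <= - r by rewrite oppr_ge0 ltW.
have := rsumZ_ge0 r0' s; have -> : (fun i => - r * - a i) = (fun i => r * a i).
  by apply/funext => i; rewrite mulrNN.
by rewrite e mulrNN.
Qed.

Definition csummable D f := summable D (EFin \o (fun i => Re (f i))) /\
  summable D (EFin \o (fun i => Im (f i))).

Lemma has_csumE D f s : has_csum D f s <-> csummable D f /\ csum D f = s.
Proof. by split=> [[? ? ?]|[[? ?] ?]]. Qed.

Lemma csumZD D (c : R[i]) f g : csummable D f -> csummable D g ->
  csummable D (fun i => c * f i + g i) /\ csum D (fun i => c * f i + g i) = c * csum D f + csum D g.
Proof.
move=> [fr fi] [gr gi]; rewrite /csummable /csum.
have [s1 e1] := rsumZ (Re c) fr; have [s2 e2] := rsumZ (- Im c) fi.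
have [s3 e3] := rsumZ (Re c) fi; have [s4 e4] := rsumZ (Im c) fr.
have [s5 e5] := rsumD s1 s2; have [s6 e6] := rsumD s3 s4.
have [s7 e7] := rsumD s5 gr; have [s8 e8] := rsumD s6 gi.
have E1 : (fun i => Re (c * f i + g i)) = (fun i => Re c * Re (f i) + - Im c * Im (f i) + Re (g i)).
  by apply/funext => i; rewrite !ReImE mulNr.
have E2 : (fun i => Im (c * f i + g i)) = (fun i => Re c * Im (f i) + Im c * Re (f i) + Im (g i)).
  by apply/funext => i; rewrite !ReImE.
rewrite E1 E2 e7 e8 e5 e6 e1 e2 e3 e4; split => //.
by apply: complexP; rewrite !ReImE /= ?mulNr.
Qed.

Lemma csumC D f : csummable D f -> csum D (fun i => (f i)^*) = (csum D f)^*.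
Proof.
move=> [fr fi]; rewrite /csum; have [_ e] := rsumN fi.
apply: complexP; rewrite !ReImE /=; first by apply: eq_rsum => i _; rewrite ReImE.
by rewrite -e; apply: eq_rsum => i _; rewrite ReImE.
Qed.

Lemma csum_delta D (f : I -> R[i]) p : D p -> (forall i, i != p -> f i = 0) -> csum D f = f p.
Proof.
move=> Dp f0.
have key (h : I -> R) : (forall i, i != p -> h i = 0) -> rsum D h = h p.
  move=> h0; rewrite /rsum.
  have e (w : I -> \bar R) : (forall i, i != p -> w i = 0%E) -> (0 <= w p)%E ->
      (\esum_(i in D) w i = w p)%E.
    move=> w0 wp; have wge i : (0 <= w i)%E by have [->|/w0 ->] := eqVneq i p.
    rewrite (esumID [set p])// setI1 mem_set// esum_set1// esum1 ?adde0// => i [_ /= ip].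
    by apply: w0; apply/eqP.
  rewrite !e ?funepos_ge0 ?funeneg_ge0//.
  - rewrite funeposE funenegE /= -!EFin_max /=; have [hp|hp] := leP (h p) 0.
      by rewrite max_l ?oppr_ge0// sub0r opprK.
    by rewrite max_r ?subr0// oppr_le0 ltW.
  - by move=> i /h0 hi; rewrite funenegE /= hi oppr0 maxxx.
  - by move=> i /h0 hi; rewrite funeposE /= hi maxxx.
by rewrite /csum !key => [|i /f0 ->|i /f0 ->]//; case: (f p).
Qed.

End rsum_linear.

(** * The Hilbert space that contains the fibers *)

Section l2_space.
Context {R : realType} {n : nat}.
Local Notation C := (Cplx R).
Local Notation E := (int * 'I_n -> C).
Local Notation Re := (@complex.Re R).
Local Notation Im := (@complex.Im R).
Local Notation idx := [set: int * 'I_n].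
Implicit Types (a b : E) (W : set E).

Lemma l2_nsq_ge0 a : (0 <= l2_nsq a)%E.
Proof. by apply: esum_ge0 => p _; rewrite lee_fin sqnorm_ge0. Qed.

Lemma l2_fin a : l2 a -> l2_nsq a \is a fin_num.
Proof. by move=> la; rewrite ge0_fin_numE ?l2_nsq_ge0. Qed.

Lemma l2_zero : l2 (0 : E).
Proof. by rewrite /l2/= /l2_nsq esum1// => p _; rewrite sqnorm0. Qed.

Lemma l2_subspace : subspace (@l2 R n).
Proof.
split=> [|c u v lu lv]; first exact: l2_zero.
apply: (@le_lt_trans _ _ ((2 * sqnorm c)%:E * l2_nsq u + 2%:E * l2_nsq v)%E); last first.
  by rewrite -(fineK (l2_fin lu)) -(fineK (l2_fin lv)) -!EFinM -EFinD ltry.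
rewrite -!esumZ// ?mulr_ge0 ?sqnorm_ge0//; try by move=> i _; exact: sqnorm_ge0.
rewrite -esumD; try by move=> i _; rewrite lee_fin !mulr_ge0 ?sqnorm_ge0.
by apply: le_esum => p _; rewrite -EFinD lee_fin (le_trans (sqnormD_le _ _))// sqnormM mulrA.
Qed.

Lemma csummable_l2 a b : l2 a -> l2 b -> csummable idx (fun p => a p * (b p)^*).
Proof.
move=> la lb.
have h (f : int * 'I_n -> R) : (forall p, `|f p| <= (sqnorm (a p) + sqnorm (b p)) / 2) ->
    summable idx (EFin \o f).
  move=> fle; apply: (@le_lt_trans _ _ (l2_nsq a + l2_nsq b)%E); last exact: lte_add_pinfty.
  rewrite -esumD; try by move=> i _; rewrite lee_fin sqnorm_ge0.
  apply: le_esum => p _; rewrite -EFinD lee_fin (le_trans (fle p))//.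
  by have := sqnorm_ge0 (a p); have := sqnorm_ge0 (b p) => ? ?; lra.
by split; apply: h => p; [exact: Re_le_sqnorm|exact: Im_le_sqnorm].
Qed.

Lemma l2_q a : l2 a -> l2_nsq a = (Re (l2_inner a a))%:E.
Proof.
move=> la; rewrite -(fineK (l2_fin la)); congr EFin.
rewrite /l2_inner /csum /=.
have z0 : (\esum_(p in idx) (0 : R)%:E < +oo)%E by rewrite esum1.
have aE p : idx p -> Re (a p * (a p)^*) = sqnorm (a p) - 0 by rewrite sqnormE subr0.
have [_ ->] := rsum_sub (fun p _ => sqnorm_ge0 (a p)) (fun p _ => lexx 0) la z0 aE.
by rewrite [in X in _ - X]esum1// subr0.
Qed.

Lemma l2_hermitian : hermitian (@l2 R n) (@l2_inner R n).
Proof.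
split=> [c u v w lu lv lw|u v lu lv|u lu].
- rewrite /l2_inner.
  have [_ <-] := csumZD c (csummable_l2 lu lw) (csummable_l2 lv lw).
  by apply: eq_csum => p _; rewrite mulrDl mulrA.
- rewrite /l2_inner -csumC; last exact: csummable_l2.
  by apply: eq_csum => p _; apply: complexP; rewrite !ReImE; ring.
- by rewrite -lee_fin -l2_q// l2_nsq_ge0.
Qed.

Lemma l2_delta p : l2 (delta p : E).
Proof.
rewrite /l2/= /l2_nsq (esumID [set p])//; last by move=> i _; rewrite lee_fin sqnorm_ge0.
rewrite setI1 mem_set// esum_set1 ?lee_fin ?sqnorm_ge0// esum1 ?adde0 ?ltry// => i [_ /= /eqP ip].
by rewrite /delta (negbTE ip) sqnorm0.
Qed.

Lemma l2_inner_deltar a p : l2_inner a (delta p) = a p.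
Proof.
rewrite /l2_inner (@csum_delta _ _ _ _ p)//.
  by rewrite /delta eqxx rmorph1 mulr1.
by move=> i ip; rewrite /delta (negbTE ip) rmorph0 mulr0.
Qed.

Lemma l2_inner_deltal a p : l2 a -> l2_inner (delta p) a = (a p)^*.
Proof.
by move=> la; rewrite (hermC l2_hermitian la (l2_delta p)) l2_inner_deltar.
Qed.

Lemma sqnorm_le_q a p : l2 a -> sqnorm (a p) <= Re (l2_inner a a).
Proof.
move=> la; rewrite -lee_fin -l2_q//.
by apply: (@esum_ge1 _ _ _ (fun p => sqnorm (a p))) => // i _; exact: sqnorm_ge0.
Qed.

Lemma l2_cvg0E (u_ : nat -> E) : (forall m, l2 (u_ m)) ->
  (l2_nsq (u_ m) @[m --> \oo] --> 0%E) <-> Re (l2_inner (u_ m) (u_ m)) @[m --> \oo] --> (0 : R).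
Proof.
move=> lu; have -> : (fun m => l2_nsq (u_ m)) = EFin \o (fun m => Re (l2_inner (u_ m) (u_ m))).
  by apply/funext => m /=; exact: l2_q.
by split=> h; [have := fine_cvg h; exact|apply: cvg_EFin => //; exact: nearW].
Qed.

Lemma cvg_sum_seq (I : Type) (s : seq I) (f : nat -> I -> R) (l : I -> R) :
  (forall i, f m i @[m --> \oo] --> l i) ->
  \sum_(i <- s) f m i @[m --> \oo] --> \sum_(i <- s) l i.
Proof.
move=> fl; elim: s => [|i s ih].
  by rewrite big_nil; under eq_fun do rewrite big_nil; exact: cvg_cst.
by rewrite big_cons; under eq_fun do rewrite big_cons; exact: cvgD.
Qed.

Lemma real_cauchy_cvg (x : nat -> R) :
  (forall e, 0 < e -> exists N, forall m k, (N <= m)%N -> (N <= k)%N -> `|x m - x k| <= e) ->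
  cvgn x.
Proof.
move=> cau; apply/cauchy_cvgP/cauchy_exP => e e0.
have [|N hN] := cau (e / 2); first by rewrite divr_gt0.
exists (x N); exists N => //= m Nm; rewrite -ball_normE /=.
by apply: le_lt_trans (hN N m (leqnn N) Nm) _; lra.
Qed.

(** Each coordinate converges. The Cauchy bound passes to the limit on every finite set of indices,
    and [l2_nsq] is the supremum over such sets. *)
Lemma l2_complete (u_ : nat -> E) : (forall m, l2 (u_ m)) ->
  (forall e : R, 0 < e -> exists N, forall m k, (N <= m)%N -> (N <= k)%N ->
     Re (l2_inner (u_ m - u_ k) (u_ m - u_ k)) <= e) ->
  exists2 u, l2 u & Re (l2_inner (u_ m - u) (u_ m - u)) @[m --> \oo] --> (0 : R).
Proof.
move=> lu cau.
have lB m k : l2 (u_ m - u_ k) by exact: (subspaceB l2_subspace).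
have cp p : cvgn (fun m => Re (u_ m p)) /\ cvgn (fun m => Im (u_ m p)).
  split; apply: real_cauchy_cvg => e e0; have [N hN] := cau (e ^+ 2) (exprn_gt0 _ e0);
    exists N => m k Nm Nk; rewrite -(@ler_pXn2r _ 2)// ?nnegrE ?(ltW e0)//;
    rewrite real_normK ?num_real//; apply: le_trans (hN m k Nm Nk);
    apply: le_trans (sqnorm_le_q p (lB m k)); rewrite /sqnorm !ReImE.
  - by rewrite lerDl sqr_ge0.
  - by rewrite lerDr sqr_ge0.
pose u : E := fun p => (lim (Re (u_ m p) @[m --> \oo])) +i* (lim (Im (u_ m p) @[m --> \oo])).
have key m (e : R) : (\forall k \near \oo, Re (l2_inner (u_ m - u_ k) (u_ m - u_ k)) <= e) ->
    (l2_nsq (u_ m - u)%R <= e%:E)%E.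
  move=> he; apply: esum_leP => s us _.
  have c : (\sum_(p <- s) sqnorm ((u_ m - u_ k) p)) @[k --> \oo] --> \sum_(p <- s) sqnorm ((u_ m -
    u) p).
    apply: cvg_sum_seq => p; rewrite /sqnorm !ReImE /=.
    under eq_fun do rewrite !ReImE.
    have [c1 c2] := cp p.
    by apply: cvgD; rewrite !expr2; apply: cvgM; apply: cvgB => //; exact: cvg_cst.
  apply: (@cvgr_to_le _ _ _ _ _ _ _ c).
  apply: filterS he => k; apply: le_trans.
  by rewrite -lee_fin -l2_q//; apply: esum_ge_seq.
have lu0 : l2 u.
  have [N hN] := cau 1 ltr01.
  have lN : l2 (u_ N - u).
    apply: (@le_lt_trans _ _ 1%:E); last exact: ltry.
    by apply: key; exists N => //= k Nk; exact: hN.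
  by have := subspaceB l2_subspace (lu N) lN; rewrite opprB subrKC.
exists u => //; apply/cvgr0Pnorm_le => e e0.
have [N hN] := cau e e0.
exists N => //= m Nm; have lm : l2 (u_ m - u) by exact: (subspaceB l2_subspace).
rewrite ger0_norm ?(herm_q_ge0 l2_hermitian)// -lee_fin -l2_q//.
by apply: key; exists N => //= k Nk; exact: hN.
Qed.

End l2_space.

(** * Orthogonal projection onto a closed subspace *)

Section projection.
Context {R : realType} {n : nat}.
Local Notation C := (Cplx R).
Local Notation E := (int * 'I_n -> C).
Local Notation Re := (@complex.Re R).
Local Notation Im := (@complex.Im R).
Local Notation proj := Defs.proj.
Local Notation q u := (Re (l2_inner u u)).
Variable W : set E.
Hypothesis cW : closed_subspace l2 l2_nsq W.
Let sH := @l2_subspace R n.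
Let hb := @l2_hermitian R n.
Implicit Types a b w : E.

Lemma closed_subspaceP : subspace W.
Proof. by case: cW. Qed.

Let sW := closed_subspaceP.

Lemma closed_subspace_l2 w : W w -> l2 w.
Proof. by case: cW => h _ _ _; exact: h. Qed.

Let Wl := closed_subspace_l2.

(** A sequence in W that minimizes the distance to a converges, and perturbing the minimizer along a
    vector of W forces orthogonality. *)
Lemma proj_exists a : l2 a -> exists b, W b /\ forall w, W w -> l2_inner (a - b) w = 0.
Proof.
move=> la; pose S := [set q (a - w) | w in W].
have S0 x : S x -> 0 <= x.
  by move=> [w Ww <-]; apply: (herm_q_ge0 hb); apply: (subspaceB sH) => //; exact: Wl.
have hS : has_inf S.
  by split; [exists (q (a - 0)); exists 0 => //; exact: sW.1|exists 0 => x /S0].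
set d := inf S.
have dle w : W w -> d <= q (a - w) by move=> Ww; apply: ge_inf; [case: hS|exists w].
have /choice[w_ hw] : forall m : nat, exists w, W w /\ q (a - w) <= d + m.+1%:R^-1.
  move=> m; have [|_ [w Ww <-] hlt] := @inf_adherent _ S m.+1%:R^-1 _ hS.
    by rewrite invr_gt0.
  by exists w; split => //; exact: ltW.
have lw m : l2 (w_ m) by exact: Wl (hw m).1.
have laB m : l2 (a - w_ m) by exact: (subspaceB sH).
(* The midpoint of w_m and w_k lies in W, so its squared distance to a is at least d; the
   parallelogram law turns this into a bound on q (w_m - w_k). *)
have cauq m k : q (w_ m - w_ k) <= 2 * m.+1%:R^-1 + 2 * k.+1%:R^-1.
  have := herm_parallelogram sH hb (laB k) (laB m).
  have -> : a - w_ k - (a - w_ m) = w_ m - w_ k 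
    by apply/funext => p; apply: complexP; rewrite !ReImE /=; ring.
  have -> : a - w_ k + (a - w_ m) = (2 : R)%:C *: (a - (2^-1 : R)%:C *: (w_ m + w_ k)).
    by apply/funext => p; apply: complexP; rewrite !ReImE /=; field.
  have Wm : W ((2^-1 : R)%:C *: (w_ m + w_ k)).
    by apply: (subspaceZ sW); apply: (subspaceD sW); exact: (hw _).1.
  rewrite (herm_qZ sH hb); last by apply: (subspaceB sH) => //; exact: Wl.
  rewrite sqnorm_real; have := dle _ Wm; have := (hw m).2; have := (hw k).2 => h1 h2 h3 h4.
  have alg (A X B1 B2 D t s : R) : D <= A -> B1 <= D + t -> B2 <= D + s ->
    2 ^+ 2 * A + X = 2 * B1 + 2 * B2 -> X <= 2 * s + 2 * t by move=> ? ? ? ?; lra.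
  exact: alg h3 h1 h2 h4.
have [|w lw0 cw] := @l2_complete R n w_ lw.
  move=> e e0; have e4 : 0 < e / 4 by rewrite divr_gt0.
  have := @cvg_harmonic R; move/cvgr0Pnorm_le => /(_ _ e4) [N _ hN].
  exists N => m k Nm Nk; apply: le_trans (cauq m k) _.
  have := hN m Nm; have := hN k Nk; rewrite /harmonic /= !ger0_norm ?invr_ge0// => h1 h2.
  have alg (s t : R) : s <= e / 4 -> t <= e / 4 -> 2 * t + 2 * s <= e by move=> ? ?; lra.
  exact: alg h1 h2.
have Ww : W w.
  case: cW => _ _ _ h; apply: (h w_ w) => //; first by move=> m; exact: (hw m).1.
  by apply/(l2_cvg0E (fun m => subspaceB sH (lw m) lw0)).
have law : l2 (a - w) by exact: (subspaceB sH).
have qd : q (a - w) <= d.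
  have c1 : q (a - w_ m) @[m --> \oo] --> q (a - w).
    apply: (herm_cvg sH hb) => //.
    have -> // : (fun m => q (a - w_ m - (a - w))) = (fun m => q (w_ m - w)).
    apply/funext => m; rewrite -(herm_qN sH hb); last exact: (subspaceB sH).
    have -> // : - (a - w_ m - (a - w)) = w_ m - w.
    by apply/funext => p; apply: complexP; rewrite !ReImE /=; ring.
  have c2 : d + m.+1%:R^-1 @[m --> \oo] --> d.
    rewrite -[X in _ --> X]addr0; apply: cvgD; [exact: cvg_cst|exact: cvg_harmonic].
  by apply: (ler_cvg_to c1 c2); apply: nearW => m; exact: (hw m).2.
exists w; split => // v Wv; apply: sqnorm_eq0.
set t := l2_inner (a - w) v; have lv := Wl Wv; have qv := herm_q_ge0 hb lv.
(* The optimal factor would be 1 / q v; this one also covers q v = 0, and r q v <= 1 is all that the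
   estimate uses. *)
set r := (q v + 1)^-1; have r0 : 0 < r by rewrite invr_gt0; lra.
have := dle _ (sW.2 (r%:C * t) _ _ Wv Ww).
have -> : a - ((r%:C * t) *: v + w) = (- (r%:C * t)) *: v + (a - w).
  by apply/funext => p; apply: complexP; rewrite !ReImE /=; ring.
rewrite (herm_qZD sH hb)// sqnormN sqnormM sqnorm_real (hermC hb law lv) -/t.
have -> : Re (- (r%:C * t) * t^*) = - r * sqnorm t.
  by rewrite mulNr -mulrA sqnormE ReNE ReCMl mulNr.
have rq : r * q v <= 1 by rewrite mulrC ler_pdivrMr; lra.
have t0 := sqnorm_ge0 t => h.
have : 0 <= r * (sqnorm t * (r * q v - 2)).
  have -> : r * (sqnorm t * (r * q v - 2)) = r ^+ 2 * sqnorm t * q v + 2 * (- r * sqnorm t) by ring.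
  lra.
rewrite pmulr_rge0// => h2; apply/eqP; rewrite eq_le t0 andbT.
have : sqnorm t * (r * q v - 2) <= sqnorm t * (-1) by apply: ler_wpM2l => //; lra.
lra.
Qed.

Lemma projP a : l2 a -> W (proj W a) /\ forall w, W w -> l2_inner (a - proj W a) w = 0.
Proof.
move=> la; rewrite /proj; have [b hb'] := proj_exists la.
by case: xgetP => [b' _ //|] /(_ b hb').
Qed.

Lemma proj_in a : l2 a -> W (proj W a). Proof. by move/projP => []. Qed.

Lemma proj_l2 a : l2 a -> l2 (proj W a). Proof. by move/proj_in/Wl. Qed.

Lemma projE a w : l2 a -> W w -> l2_inner (proj W a) w = l2_inner a w.
Proof.
move=> la Ww; have [Wp h] := projP la; have := h _ Ww.
by rewrite (hermBl sH hb la (proj_l2 la) (Wl Ww)) => /eqP; rewrite subr_eq0 => /eqP ->.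
Qed.

Lemma proj_unique a b : l2 a -> W b -> (forall w, W w -> l2_inner b w = l2_inner a w) ->
  proj W a = b.
Proof.
move=> la Wb h; have Wp := proj_in la; have Wd := subspaceB sW Wp Wb.
have ld := Wl Wd.
have q0 : q (proj W a - b) = 0.
  by rewrite (hermBl sH hb)// ?h// ?projE ?subrr//; apply: Wl.
apply/funext => p; apply/eqP; rewrite -subr_eq0; apply/eqP/sqnorm_eq0/eqP.
by rewrite eq_le sqnorm_ge0 andbT -q0; exact: (sqnorm_le_q p ld).
Qed.

Lemma proj_adj a b : l2 a -> l2 b -> l2_inner (proj W a) b = l2_inner a (proj W b).
Proof.
move=> la lb; rewrite -(projE la (proj_in lb)).
rewrite (hermC hb lb (proj_l2 la)) -(projE lb (proj_in la)).
by rewrite -(hermC hb) //; exact: proj_l2.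
Qed.

Lemma proj_q a : l2 a -> q (proj W a) = Re (l2_inner a (proj W a)).
Proof. by move=> la; rewrite projE//; exact: proj_in. Qed.

Lemma proj_q_le a : l2 a -> q (proj W a) <= q a.
Proof.
move=> la; have lp := proj_l2 la.
have := herm_q_ge0 hb (subspaceB sH la lp); rewrite (herm_qB sH hb)// -proj_q//; lra.
Qed.

Lemma projZD (c : R[i]) a b : l2 a -> l2 b -> proj W (c *: a + b) = c *: proj W a + proj W b.
Proof.
move=> la lb; apply: proj_unique; first exact: sH.2.
  by apply: sW.2; exact: proj_in.
move=> w Ww; have lw := Wl Ww.
rewrite (hermDl hb (subspaceZ sH c (proj_l2 la)) (proj_l2 lb) lw).
rewrite (hermDl hb (subspaceZ sH c la) lb lw) !(hermZl sH hb)// ?projE//.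
exact: proj_l2.
Qed.

End projection.

(** * Positive and trace-class operators *)

Section gram_schmidt.
Context {R : realType} {E : lmodType R[i]}.
Local Notation Re := (@complex.Re R).
Variables (H : set E) (b : E -> E -> R[i]).
Hypotheses (sH : subspace H) (hb : hermitian H b).
Variable e : nat -> E.
Hypothesis He : forall k, H (e k).
Local Notation q u := (Re (b u u)).

(* A vector of zero seminorm is normalized to [0], since [0^-1 = 0]. *)
Definition gs_vec (L : E -> E) (v : E) : E := ((Num.sqrt (q (L v)))^-1)%:C *: L v.

(** The recursion runs on the remainder operator, because the next vector arises by applying the
    current remainder to [e k]. The vectors themselves are then read off as [gs]. *)
Fixpoint gs_rem (k : nat) : E -> E :=
  if k is j.+1 then fun a => gs_rem j a - b a (gs_vec (gs_rem j) (e j)) *: gs_vec (gs_rem j) (e j)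
  else id.

Definition gs (k : nat) : E := gs_vec (gs_rem k) (e k).

Lemma gs_remS k a : gs_rem k.+1 a = gs_rem k a - b a (gs k) *: gs k.
Proof. by []. Qed.

Lemma gs_remH k a : H a -> H (gs_rem k a).
Proof.
elim: k a => [//|k ih] a Ha; rewrite gs_remS; apply: (subspaceB sH); first exact: ih.
by apply: (subspaceZ sH); apply: (subspaceZ sH); exact: ih.
Qed.

Lemma gsH k : H (gs k).
Proof. by apply: (subspaceZ sH); exact: gs_remH. Qed.

Lemma gs_remE k a : gs_rem k a = a - \sum_(j < k) b a (gs j) *: gs j.
Proof.
elim: k => [|k ih]; first by rewrite big_ord0 subr0.
by rewrite gs_remS ih big_ord_recr opprD addrA.
Qed.

Lemma gs_rem_linear k c u v : H u -> H v -> gs_rem k (c *: u + v) = c *: gs_rem k u + gs_rem k v.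
Proof.
move=> Hu Hv; elim: k => [//|k ih]; rewrite !gs_remS ih.
rewrite (hermDl hb (subspaceZ sH c Hu) Hv (gsH k)) (hermZl sH hb _ Hu (gsH k)).
by rewrite scalerDl scalerBr -scalerA opprD addrACA.
Qed.

(** The projection property of the remainder is assumed here and in [gs_norm], since both serve in
    the inductive step that proves it, [gs_P]. *)
Lemma gs_ip k : (forall a c, H a -> H c -> b (gs_rem k a) (gs_rem k c) = b (gs_rem k a) c) ->
  forall a, H a -> b (gs_rem k a) (gs k) = b a (gs k).
Proof.
move=> P a Ha; have Hr := gs_remH k (He k); have HL := gs_remH k Ha.
rewrite /gs /gs_vec !(hermZr sH hb)//; congr (_ * _).
by rewrite [RHS](hermC hb Hr Ha) -(P _ _ (He k) Ha) -(hermC hb Hr HL).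
Qed.

Lemma gs_norm k (P : forall a c, H a -> H c -> b (gs_rem k a) (gs_rem k c) = b (gs_rem k a) c) :
  b (gs k) (gs k) = 1 \/ gs k = 0.
Proof.
have Hr := gs_remH k (He k); set r := q (gs_rem k (e k)).
have r0 : 0 <= r by exact: (herm_q_ge0 hb).
have [rz|rN0] := eqVneq r 0; [right|left].
  by rewrite /gs /gs_vec -/r rz sqrtr0 invr0 scale0r.
rewrite (herm_qE hb (gsH k)) /gs /gs_vec (herm_qZ sH hb)// -/r sqnorm_real exprVn sqr_sqrtr//.
by rewrite mulVf.
Qed.

(** For the form b the remainder is an orthogonal projection. In the induction the new vector either
    has norm 1 or is 0 itself, and in both cases the extra terms cancel. *)
Lemma gs_P k a c : H a -> H c -> b (gs_rem k a) (gs_rem k c) = b (gs_rem k a) c.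
Proof.
elim: k a c => [//|k ih] a c Ha Hc; rewrite !gs_remS.
have [Hg Hra Hrc] := And3 (gsH k) (gs_remH k Ha) (gs_remH k Hc).
have Hcg := subspaceZ sH (b c (gs k)) Hg; have Hag := subspaceZ sH (b a (gs k)) Hg.
rewrite !(hermBl sH hb)//; last exact: (subspaceB sH).
rewrite (hermBr sH hb Hrc Hcg Hra) (hermBr sH hb Hrc Hcg Hag) (hermZr sH hb _ Hg Hra).
rewrite (hermZl sH hb _ Hg Hrc) (hermZl sH hb _ Hg Hcg) (hermZr sH hb _ Hg Hg).
rewrite (hermZl sH hb _ Hg Hc) ih// (gs_ip ih Ha).
have -> : b (gs k) (gs_rem k c) = (b c (gs k))^* by rewrite (hermC hb Hrc Hg) (gs_ip ih Hc).
have -> : b (gs k) c = (b c (gs k))^* by exact: (hermC hb).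
have [->|->] := gs_norm ih; first by ring.
by rewrite (hermC hb sH.1 Ha) (herm0l sH hb)// rmorph0; ring.
Qed.

Lemma gs_qS k a : H a -> q (gs_rem k.+1 a) = q (gs_rem k a) - sqnorm (b a (gs k)).
Proof.
move=> Ha; have [Hg Hra] := (gsH k, gs_remH k Ha).
rewrite gs_P// gs_remS (hermBl sH hb)//; last exact: (subspaceZ sH).
by rewrite (hermZl sH hb)// (hermC hb Ha Hg) sqnormE ReDE ReNE gs_P.
Qed.

Lemma gs_q k a : H a -> q a = \sum_(j < k) sqnorm (b a (gs j)) + q (gs_rem k a).
Proof.
move=> Ha; elim: k => [|k ih]; first by rewrite big_ord0 add0r.
by rewrite big_ord_recr /= -/(gs k) gs_qS// {1}ih; ring.
Qed.

Lemma gs_null j k : (j < k)%N -> q (gs_rem k (e j)) = 0.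
Proof.
elim: k => [//|k ih]; rewrite ltnS leq_eqVlt => /orP[/eqP ->|jk]; last first.
  apply/eqP; rewrite eq_le (herm_q_ge0 hb (gs_remH _ (He j))) andbT gs_qS// ih//.
  by rewrite sub0r oppr_le0 sqnorm_ge0.
rewrite gs_qS// -(gs_ip (@gs_P k) (He k)) /gs /gs_vec.
have Hr := gs_remH k (He k); set r := q (gs_rem k (e k)).
have r0 : 0 <= r by exact: (herm_q_ge0 hb).
rewrite (hermZr sH hb)// (herm_qE hb)// -/r sqnormM sqnormC !sqnorm_real exprVn sqr_sqrtr//.
by have [->|rN0] := eqVneq r 0; [ring|field].
Qed.

Lemma gs_null_sum k m (c : nat -> R[i]) : (m <= k)%N ->
  H (\sum_(j < m) c j *: e j) /\ q (gs_rem k (\sum_(j < m) c j *: e j)) = 0.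
Proof.
elim: m => [_|m ih mk].
  rewrite big_ord0; split; first exact: sH.1.
  apply/eqP; rewrite eq_le (herm_q_ge0 hb (gs_remH _ sH.1)) andbT.
  rewrite -[leRHS]/(Re (0 : R[i])) -(herm0l sH hb sH.1) [in leRHS](gs_q k sH.1) lerDr.
  by apply: sumr_ge0 => *; exact: sqnorm_ge0.
have [Hs q0] := ih (ltnW mk); rewrite big_ord_recr /= addrC; split.
  by apply: sH.2.
rewrite gs_rem_linear// (herm_qZD sH hb); try exact: gs_remH.
rewrite q0 gs_null// mulr0 add0r addr0.
have := herm_CS sH hb (gs_remH k (He m)) (gs_remH k Hs); rewrite q0 mulr0 => h.
have -> : b (gs_rem k (e m)) (gs_rem k (\sum_(j < m) c j *: e j)) = 0.
  by apply: sqnorm_eq0; apply/eqP; rewrite eq_le h sqnorm_ge0.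
by rewrite !mulr0.
Qed.

(** Best approximation: subtracting a combination of the first k vectors e changes the remainder of
    a only by a vector of zero seminorm, and passing to the remainder never increases q. *)
Lemma gs_le k a (c : nat -> R[i]) : H a ->
  q (gs_rem k a) <= q (a - \sum_(j < k) c j *: e j).
Proof.
move=> Ha; have [Hs q0] := @gs_null_sum k k c (leqnn k).
set s := \sum_(j < k) _ in Hs q0 *; have Has := subspaceB sH Ha Hs.
have -> : gs_rem k a = 1 *: gs_rem k (a - s) + gs_rem k s.
  by rewrite -gs_rem_linear// scale1r subrK.
rewrite (herm_qZD sH hb); try exact: gs_remH.
have := herm_CS sH hb (gs_remH k Has) (gs_remH k Hs); rewrite q0 mulr0 => h.
have -> : b (gs_rem k (a - s)) (gs_rem k s) = 0.
  by apply: sqnorm_eq0; apply/eqP; rewrite eq_le h sqnorm_ge0.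
have -> : sqnorm (1 : R[i]) = 1 by rewrite (sqnorm_real 1) expr1n.
have -> : Re (1 * 0) = 0 by rewrite mulr0.
rewrite mul1r mulr0 !addr0.
by rewrite [in leRHS](gs_q k Has) lerDr; apply: sumr_ge0 => *; exact: sqnorm_ge0.
Qed.

End gram_schmidt.

(** * Expansion of a positive operator *)

Section positive_operators.
Context {R : realType} {n : nat}.
Local Notation C := (Cplx R).
Local Notation E := (int * 'I_n -> C).
Local Notation Re := (@complex.Re R).
Local Notation Im := (@complex.Im R).
Local Notation q u := (Re (l2_inner u u)).
Local Notation idx := [set: int * 'I_n].
Let sH := @l2_subspace R n.
Let hb := @l2_hermitian R n.
Implicit Types (a u v : E) (A B : E -> E).

(** The coordinate vectors in the order of the encoding of their indices by natural numbers; a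
    number that encodes nothing gives 0, which Gram-Schmidt tolerates. *)
Definition basis_seq (j : nat) : E :=
  if pickle_inv j is Some p then delta p else 0.

Definition coef_seq a (j : nat) : R[i] :=
  if pickle_inv j is Some p then a p else 0.

Lemma l2_basis_seq j : l2 (basis_seq j).
Proof. by rewrite /basis_seq; case: pickle_inv => [p|]; [exact: l2_delta|exact: l2_zero]. Qed.

Lemma basis_sumE a k p :
  (\sum_(j < k) coef_seq a j *: basis_seq j) p = if (pickle p < k)%N then a p else 0.
Proof.
elim: k => [|k ih]; first by rewrite big_ord0.
rewrite big_ord_recr -[LHS]/((\sum_(j < k) coef_seq a j *: basis_seq j) p +
  coef_seq a k * basis_seq k p) ih ltnS [in RHS]leq_eqVlt.
have [<-|pk] /= := eqVneq (pickle p) k.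
  by rewrite ltnn add0r /coef_seq /basis_seq pickleK_inv /delta eqxx mulr1.
rewrite [X in _ + X](_ : _ = 0) ?addr0// /coef_seq /basis_seq.
case: (pickle_inv k) (@pickle_invK (int * 'I_n)%type k) => [p' /= pp'|_]; last by rewrite mul0r.
rewrite /delta; case: eqVneq => [pe|]; last by rewrite mulr0.
by move: pk; rewrite pe pp' eqxx.
Qed.

(** Some finite set X of indices carries all but e of the squared norm. Once k exceeds the codes of
    X, the tail is supported off X. *)
Lemma l2_tail a : l2 a ->
  (forall k, l2 (a - \sum_(j < k) coef_seq a j *: basis_seq j)) /\
  q (a - \sum_(j < k) coef_seq a j *: basis_seq j) @[k --> \oo] --> (0 : R).
Proof.
move=> la; pose t (k : nat) : E := a - \sum_(j < k) coef_seq a j *: basis_seq j.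
rewrite -/(t _); change ((forall k, l2 (t k)) /\ q (t k) @[k --> \oo] --> (0 : R)).
have tE k p : t k p = if (pickle p < k)%N then 0 else a p.
  rewrite /t -[LHS]/(a p - (\sum_(j < k) coef_seq a j *: basis_seq j) p) basis_sumE.
  by case: ifP => _; rewrite ?subrr ?subr0.
have lt k : l2 (t k).
  apply: le_lt_trans la; apply: le_esum => p _; rewrite lee_fin tE.
  by case: ifP => // _; rewrite sqnorm0 sqnorm_ge0.
split => //; apply/cvgr0Pnorm_le => e e0.
have : (l2_nsq a - e%:E < l2_nsq a)%E.
  by rewrite -(fineK (l2_fin la)) -EFinB lte_fin ltrBlDr ltrDl.
move=> /ereal_sup_gt[_ [X [finX _] <-]] aX.
exists (\max_(p <- finmap.enum_fset (fset_set X)) (pickle p).+1)%N => //= k kX.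
rewrite ger0_norm ?(herm_q_ge0 hb)// -lee_fin -l2_q//.
have : (l2_nsq (t k) + \sum_(p \in X) (sqnorm (a p))%:E <= l2_nsq a)%E.
  rewrite -esum_fset//; last by move=> *; rewrite lee_fin sqnorm_ge0.
  rewrite [leRHS](esumID X); last by move=> *; rewrite lee_fin sqnorm_ge0.
  rewrite [leLHS]addeC !setTI; apply: leeD => //; rewrite /l2_nsq [leRHS]esum_mkcond;
    apply: le_esum => p _.
  rewrite tE; case: ifPn => [_|kp]; first by rewrite sqnorm0; case: ifP => _;
    rewrite lee_fin ?sqnorm_ge0.
  rewrite mem_set//= => Xp; move/negP : kp; apply; apply: leq_trans kX.
  by apply: (@leq_bigmax_seq _ _ _ (fun p => (pickle p).+1)) => //; rewrite in_fset_set// inE.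
move: aX; rewrite -(fineK (l2_fin la)) -(fineK (l2_fin (lt k))).
have /fineK <- : (\sum_(p \in X) (sqnorm (a p))%:E)%E \is a fin_num.
  by rewrite fsbig_finite//= sumEFin.
by rewrite -EFinB lte_fin -EFinD !lee_fin => h1 h2; lra.
Qed.

Lemma bounded_opE A : bounded_op A -> exists2 M, 0 <= M & forall a, l2 a -> q (A a) <= M * q a.
Proof.
move=> [lA _ [M hM]]; exists `|M| => // a la; have := hM a la.
rewrite !l2_q//; last exact: lA.
rewrite -EFinM lee_fin => h; apply: le_trans h _; apply: ler_wpM2r; last exact: ler_norm.
exact: (herm_q_ge0 hb).
Qed.

(** Nonnegativity in [R[i]] includes a zero imaginary part. Applied to u + v and to 'i u + v, this
    gives the symmetry. *)
Lemma positive_hermitian A : positive_op A -> hermitian l2 (fun u v => l2_inner (A u) v).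
Proof.
move=> [[lA linA _] posA].
have lin c u v w : l2 u -> l2 v -> l2 w ->
    l2_inner (A (c *: u + v)) w = c * l2_inner (A u) w + l2_inner (A v) w.
  move=> lu lv lw; rewrite linA//.
  rewrite (hermDl hb (subspaceZ sH c (lA _ lu)) (lA _ lv) lw) (hermZl sH hb)//; exact: lA.
have im u : l2 u -> Im (l2_inner (A u) u) = 0.
  by move=> /posA; rewrite lecE => /andP[/eqP ->].
split=> //; last first.
  by move=> u /posA; rewrite lecE => /andP[_].
move=> u v lu lv; have [lAu lAv] := (lA _ lu, lA _ lv).
have key c : Im (c^* * l2_inner (A v) u + c * l2_inner (A u) v) = 0.
  have := im _ (sH.2 c _ _ lu lv); rewrite lin//; last exact: sH.2.
  rewrite !(hermDr sH hb (subspaceZ sH c lu) lv)// !(hermZr sH hb)// mulrDr.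
  have := im _ lu; have := im _ lv; have e := sqnormE c; rewrite mulrA e.
  by rewrite !ReImE /= mul0r addr0 => -> -> ; rewrite mulr0 add0r addr0 addrC.
move: (key 1) (key 'i); move: (l2_inner (A v) u) (l2_inner (A u) v) => z w.
by rewrite !ReImE /= => k1 k2; apply: complexP; rewrite !ReImE; lra.
Qed.

Lemma positive_q_le A : positive_op A -> exists2 M, 0 <= M & forall a, l2 a ->
  Re (l2_inner (A a) a) <= M * q a.
Proof.
(* From q (A a - a) >= 0: twice Re <A a | a> is at most q (A a) + q a. *)
move=> pA; have [M M0 hM] := bounded_opE pA.1; exists (M + 1); first by rewrite addr_ge0.
move=> a la; have lA : l2 (A a) by case: pA => -[h _ _] _; exact: h.
have := herm_q_ge0 hb (subspaceB sH lA la); rewrite (herm_qB sH hb)//.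
have := hM _ la; have := herm_q_ge0 hb lA; have := herm_q_ge0 hb la => h1 h2 h3 h4; lra.
Qed.

(** The x_j are the Gram-Schmidt vectors of the coordinate basis for the form of A. Their remainder
    is the best one for that form, so it is dominated by the tail of a in the coordinate basis, on
    which the form is at most a multiple of the squared norm. *)
Lemma positive_expansion A : positive_op A -> exists x : nat -> E,
  (forall j, l2 (x j)) /\ forall a, l2 a ->
  let d k := a - \sum_(j < k) l2_inner (A a) (x j) *: x j in
  [/\ forall k, l2 (d k),
    forall k, Re (l2_inner (A a) a) =
      \sum_(j < k) sqnorm (l2_inner (A a) (x j)) + Re (l2_inner (A (d k)) (d k)) &
    Re (l2_inner (A (d k)) (d k)) @[k --> \oo] --> (0 : R)].
Proof.
move=> pA; have hA := positive_hermitian pA.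
pose x := gs (fun u v => l2_inner (A u) v) basis_seq.
have lx j : l2 (x j) by exact: (gsH _ sH l2_basis_seq).
exists x; split => // a la d.
have dE k : d k = gs_rem (fun u v => l2_inner (A u) v) basis_seq k a by rewrite gs_remE.
have ld k : l2 (d k) by rewrite dE; exact: (gs_remH _ sH l2_basis_seq).
split=> // [k|]; first by rewrite dE; exact: (gs_q sH hA l2_basis_seq).
have [M M0 hM] := positive_q_le pA; have [lt ct] := l2_tail la.
apply: (@squeeze_cvgr _ _ _ _ (cst 0)
  (fun k => M * q (a - \sum_(j < k) coef_seq a j *: basis_seq j))).
- apply: nearW => k; rewrite (herm_q_ge0 hA (ld k)) /=.
  by apply: le_trans (hM _ (lt k)); rewrite dE; exact: (gs_le sH hA l2_basis_seq k (coef_seq a) la).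
- exact: cvg_cst.
- by rewrite -(mulr0 M); exact: cvgMl_tmp.
Qed.

End positive_operators.

(** * Traces and expansions of operators *)

Section traces.
Context {R : realType} {n : nat}.
Local Notation C := (Cplx R).
Local Notation E := (int * 'I_n -> C).
Local Notation proj := Defs.proj.
Local Notation Re := (@complex.Re R).
Local Notation Im := (@complex.Im R).
Local Notation q u := (Re (l2_inner u u)).
Local Notation idx := [set: int * 'I_n].
Let sH := @l2_subspace R n.
Let hb := @l2_hermitian R n.
Implicit Types (a u v : E) (A B : E -> E) (W : set E).

Lemma esum_nat_cvg (u : nat -> R) (c : R) : (forall j, 0 <= u j) ->
  \sum_(j < k) u j @[k --> \oo] --> c -> (\esum_(j in [set: nat]) (u j)%:E = c%:E)%E.
Proof.
move=> u0 cu; rewrite -nneseries_esumT; last by move=> j; rewrite lee_fin.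
apply/cvg_lim => //; have -> : (fun k => \sum_(0 <= j < k) (u j)%:E)%E = EFin \o (fun k => \sum_(j
  < k) u j).
  by apply/funext => k /=; rewrite sumEFin big_mkord.
by apply: cvg_EFin => //; exact: nearW.
Qed.

Lemma cvg_esum_nat (u : nat -> R) : (forall j, 0 <= u j) ->
  (\esum_(j in [set: nat]) (u j)%:E < +oo)%E ->
  \sum_(j < k) u j @[k --> \oo] --> fine (\esum_(j in [set: nat]) (u j)%:E)%E.
Proof.
move=> u0 uoo; have ufin := esum_fin_num (D := setT) (u := fun j => (u j)%:E) (fun j _ => u0 j) uoo.
have u0' j : xpredT j -> (0 <= (u j)%:E)%E by rewrite lee_fin.
have := @is_cvg_nneseries_cond R (fun j => (u j)%:E) xpredT 0%N (fun j _ => u0' j).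
rewrite -nneseries_esumT in ufin uoo *; last by move=> j; rewrite lee_fin.
move=> /cvg_ex[l cl]; move: ufin; have -> := cvg_lim _ cl => //.
move=> lfin; have -> : (fun k => \sum_(j < k) u j) = fine \o (fun k => \sum_(0 <= j < k) (u
  j)%:E)%E.
  by apply/funext => k; rewrite /= sumEFin big_mkord.
by apply: fine_cvg; rewrite fineK.
Qed.

Lemma esum_swap (I J : choiceType) (D : set I) (F : set J) (f : I -> J -> \bar R) :
  (forall i j, D i -> F j -> 0 <= f i j)%E ->
  (\esum_(i in D) \esum_(j in F) f i j = \esum_(j in F) \esum_(i in D) f i j)%E.
Proof.
move=> f0; rewrite esum_esum// esum_esum; last by move=> j i Fj Di; exact: f0.
rewrite (reindex_esum (D `*`` fun=> F) _ (fun x : I * J => (x.2, x.1)))//.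
split=> [[i j] [] //= |[i j] [i' j'] _ _ [-> ->] //|[j i] [/= Fj Di]].
by exists (i, j).
Qed.

(** Symmetry of the form gives <A a | x_j> = <a | A x_j>, so that y_j = A x_j works; the sequence
    does not depend on a. *)
Lemma positive_esum A : positive_op A -> exists y : nat -> E, (forall j, l2 (y j)) /\
  forall a, l2 a -> (Re (l2_inner (A a) a))%:E = (\esum_(j in [set: nat]) (sqnorm (l2_inner a (y
    j)))%:E)%E.
Proof.
move=> pA; have hA := positive_hermitian pA; have [x [lx hx]] := positive_expansion pA.
have lA a : l2 a -> l2 (A a) by case: pA => -[h _ _] _; exact: h.
exists (fun j => A (x j)); split=> [j|a la]; first exact: lA.
have [ld qd cd] := hx a la; apply/esym/esum_nat_cvg => [j|]; first exact: sqnorm_ge0.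
have -> : (fun k => \sum_(j < k) sqnorm (l2_inner a (A (x j)))) = (fun k => Re (l2_inner (A a) a) -
   Re (l2_inner (A (a - \sum_(j < k) l2_inner (A a) (x j) *: x j)) (a - \sum_(j < k) l2_inner (A
     a) (x j) *: x j))).
  apply/funext => k; rewrite (qd k) addrK; apply: eq_bigr => j _.
  by rewrite (hermC hb (lA _ (lx j)) la) -(hermC hA (lx j) la).
by rewrite -[X in _ --> X]subr0; apply: cvgB => //; exact: cvg_cst.
Qed.

Lemma trace_pos_proj A (y : nat -> E) W : closed_subspace l2 l2_nsq W ->
  (forall a, l2 a -> l2 (A a)) -> (forall j, l2 (y j)) ->
  (forall a, l2 a -> (Re (l2_inner (A a) a))%:E = \esum_(j in [set: nat]) (sqnorm (l2_inner a (y
    j)))%:E)%E ->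
  trace_pos (fun a => proj W (A (proj W a))) = (\esum_(j in [set: nat]) l2_nsq (proj W (y j)))%E.
Proof.
move=> cW lA ly hy; rewrite /l2_nsq esum_swap; last by move=> *; rewrite lee_fin sqnorm_ge0.
apply: eq_esum => p _; have lp := l2_delta (R := R) p; have lPp := proj_l2 cW lp.
rewrite (proj_adj cW (lA _ lPp) lp) hy//; apply: eq_esum => j _.
by rewrite (proj_adj cW lp (ly j)) (l2_inner_deltal p (proj_l2 cW (ly j))) sqnormC.
Qed.

(** Both sides are double sums of nonnegative terms indexed by j, exchanged by Tonelli. The frame
    identity enters only at the y_j, which is what later allows a common null set. *)
Lemma trace_pos_frame A (y : nat -> E) W (I : choiceType) (D : set I) (e : I -> E) :
  closed_subspace l2 l2_nsq W -> (forall a, l2 a -> l2 (A a)) -> (forall j, l2 (y j)) ->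
  (forall i, D i -> l2 (e i)) ->
  (forall a, l2 a -> (Re (l2_inner (A a) a))%:E = \esum_(j in [set: nat]) (sqnorm (l2_inner a (y
    j)))%:E)%E ->
  (forall j, l2_nsq (proj W (y j)) = \esum_(i in D) (sqnorm (l2_inner (y j) (e i)))%:E)%E ->
  trace_pos (fun a => proj W (A (proj W a))) = (\esum_(i in D) (Re (l2_inner (A (e i)) (e
    i)))%:E)%E.
Proof.
move=> cW lA ly le hy fr; rewrite (trace_pos_proj cW lA ly hy).
rewrite (eq_esum (fun j _ => fr j)) esum_swap; last by move=> *; rewrite lee_fin sqnorm_ge0.
apply: eq_esum => i Di; rewrite hy; last exact: le.
apply: eq_esum => j _.
by rewrite (hermC hb (le _ Di) (ly j)) sqnormC.
Qed.

(** Take the x_j of the expansion of B = |A|, and g_j = B x_j, h_j = A x_j. The remainder of a has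
    vanishing form for B, and q (A d) = q (B d) carries this over to A, without polar decomposition.
    The sum of the q (g_j) is the trace of B, and q (h_j) = q (g_j). *)
Lemma trace_class_expansion A : trace_class A -> exists g h : nat -> E,
  [/\ forall j, l2 (g j) /\ l2 (h j),
      (\esum_(j in [set: nat]) l2_nsq (g j) < +oo)%E,
      (\esum_(j in [set: nat]) l2_nsq (h j) < +oo)%E &
      forall a c, l2 a -> l2 c ->
        Re (\sum_(j < k) l2_inner a (g j) * l2_inner (h j) c) @[k --> \oo] --> Re (l2_inner (A a)
          c) /\
        Im (\sum_(j < k) l2_inner a (g j) * l2_inner (h j) c) @[k --> \oo] --> Im (l2_inner (A a)
          c)].
Proof.
move=> [bA [B [pB [S [bS adS BBS]]] trB]].
have lA a : l2 a -> l2 (A a) by case: bA => h _ _; exact: h.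
have linA c u v : l2 u -> l2 v -> A (c *: u + v) = c *: A u + A v by case: bA => _ h _; exact: h.
have lB a : l2 a -> l2 (B a) by case: pB => -[h _ _] _; exact: h.
have hB := positive_hermitian pB; have [x [lx hx]] := positive_expansion pB.
have BE u v : l2 u -> l2 v -> l2_inner (B u) v = l2_inner u (B v).
  by move=> lu lv; rewrite (hermC hb (lB _ lv) lu) -(hermC hB lv lu).
have qAB a : l2 a -> q (A a) = q (B a).
  by move=> la; rewrite adS//; [rewrite -BBS// -BE//; exact: lB|exact: lA].
have gE : (\esum_(j in [set: nat]) l2_nsq (B (x j)) = trace_pos B)%E.
  rewrite /l2_nsq esum_swap; last by move=> *; rewrite lee_fin sqnorm_ge0.
  apply: eq_esum => p _; have lp := l2_delta (R := R) p.
  have [ld qd cd] := hx _ lp; apply: esum_nat_cvg => [j|]; first exact: sqnorm_ge0.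
  have -> : (fun k => \sum_(j < k) sqnorm (B (x j) p)) = (fun k => Re (l2_inner (B (delta p))
    (delta p)) -
     Re (l2_inner (B (delta p - \sum_(j < k) l2_inner (B (delta p)) (x j) *: x j)) (delta p -
       \sum_(j < k) l2_inner (B (delta p)) (x j) *: x j))).
    apply/funext => k; rewrite (qd k) addrK; apply: eq_bigr => j _.
    by rewrite BE// l2_inner_deltal ?sqnormC//; exact: lB.
  by rewrite -[X in _ --> X]subr0; apply: cvgB => //; exact: cvg_cst.
exists (fun j => B (x j)), (fun j => A (x j)); split.
- by move=> j; split; [exact: lB|exact: lA].
- by rewrite gE.
- have e j : l2_nsq (A (x j)) = l2_nsq (B (x j)).
    by rewrite (l2_q (lA _ (lx j))) (l2_q (lB _ (lx j))) (qAB _ (lx j)).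
  by rewrite (eq_esum (fun j _ => e j)) gE.
move=> a c la lc; have [d [dE ld cd]] : exists d : nat -> E,
    [/\ forall k, d k = a - \sum_(j < k) l2_inner (B a) (x j) *: x j, forall k, l2 (d k) &
     Re (l2_inner (B (d k)) (d k)) @[k --> \oo] --> (0 : R)].
  by have [ld _ cd] := hx _ la; eexists; split; [by []|exact: ld|exact: cd].
have [M M0 hM] := positive_q_le pB.
(* Cauchy-Schwarz for the form of B at v and B v: the square of q (B v) is at most <B v | v> <B B v
   | B v>, hence at most <B v | v> M q (B v). *)
have qBd v : l2 v -> q (B v) <= M * Re (l2_inner (B v) v).
  move=> lv; have lBv := lB _ lv; have := herm_CS sH hB lv lBv; have := hM _ lBv.
  rewrite [X in sqnorm X](herm_qE hb lBv) sqnorm_real; have q0 := herm_q_ge0 hb lBv.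
  have r0 := herm_q_ge0 hB lv.
  have [->|qN0] := eqVneq (q (B v)) 0; first by rewrite mulr_ge0.
  have qp : 0 < q (B v) by rewrite lt_neqAle eq_sym qN0.
  move=> h1 h2; rewrite -(ler_pM2r qp).
  apply: le_trans (_ : _ <= Re (l2_inner (B v) v) * (M * q (B v))) _.
    by rewrite -expr2; apply: le_trans h2 _; apply: ler_wpM2l.
  by rewrite mulrCA mulrA.
have cAd : q (A (d k)) @[k --> \oo] --> (0 : R).
  apply: (@squeeze_cvgr _ _ _ _ (cst 0) (fun k => M * Re (l2_inner (B (d k)) (d k)))).
  - apply: nearW => k; rewrite (herm_q_ge0 hb (lA _ (ld k))) (qAB _ (ld k)) /=;
    exact: (qBd _ (ld k)).
  - exact: cvg_cst.
  - by rewrite -(mulr0 M); exact: cvgMl_tmp.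
have lAd k : l2 (A (d k)) by exact: lA.
have sE k : \sum_(j < k) l2_inner a (B (x j)) * l2_inner (A (x j)) c = l2_inner (A a - A (d k)) c.
  have lin m : l2 (\sum_(j < m) l2_inner (B a) (x j) *: x j) /\
     l2_inner (A (\sum_(j < m) l2_inner (B a) (x j) *: x j)) c =
     \sum_(j < m) l2_inner a (B (x j)) * l2_inner (A (x j)) c.
    elim: m => [|m [lm ih]].
      rewrite !big_ord0; split; first exact: sH.1.
      have := linA 0 _ _ sH.1 sH.1; rewrite !scale0r addr0 add0r => _.
      have := linA 1 _ _ sH.1 sH.1; rewrite !scale1r addr0 => /eqP.
      by rewrite -subr_eq subrr eq_sym => /eqP ->; exact: (herm0l sH hb).
    rewrite !big_ord_recr /= addrC; split; first exact: sH.2.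
    rewrite linA// (hermDl hb)// ?(hermZl sH hb)// ?ih ?BE//; first by rewrite addrC.
    + exact: lA.
    + by apply: (subspaceZ sH); exact: lA.
    + exact: lA.
  have [ls <-] := lin k; congr (l2_inner _ c); apply/eqP; rewrite -subr_eq0; apply/eqP.
  rewrite -[in A a](subrK (\sum_(j < k) l2_inner (B a) (x j) *: x j) a) -dE.
  by rewrite -[d k]scale1r linA// !scale1r addrAC subrr add0r subrr.
have cc : q (c - c) @[k --> \oo] --> (0 : R).
  by rewrite subrr (herm0l sH hb sH.1); exact: cvg_cst.
have lAa := lA _ la.
have [||c1 c2] := @herm_cvg_ip R _ _ _ sH hb (fun k => A a - A (d k)) (fun=> c) (A a) c _ lAa
  (fun=> lc) lc _ cc.
- by move=> k; exact: (subspaceB sH).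
- have -> // : (fun k => q (A a - A (d k) - A a)) = (fun k => q (A (d k))).
  by apply/funext => k; rewrite addrAC subrr add0r (herm_qN sH hb).
by split; under eq_fun do rewrite sE.
Qed.

End traces.

(** * The frame formula for trace-class operators *)

Section trace_class_frames.
Context {R : realType} {n : nat}.
Local Notation C := (Cplx R).
Local Notation E := (int * 'I_n -> C).
Local Notation proj := Defs.proj.
Local Notation Re := (@complex.Re R).
Local Notation Im := (@complex.Im R).
Local Notation q u := (Re (l2_inner u u)).
Local Notation idx := [set: int * 'I_n].
Let sH := @l2_subspace R n.
Let hb := @l2_hermitian R n.
Implicit Types (a u v : E) (A B : E -> E) (W : set E).

Lemma l2_nsq_delta u : (l2_nsq u = \esum_(p in idx) (sqnorm (l2_inner u (delta p)))%:E)%E.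
Proof. by apply: eq_esum => p _; rewrite l2_inner_deltar. Qed.

Local Opaque l2_inner l2_nsq.

(** Tonelli for two nonnegative arrays of finite total; the finite totals make all row and column
    sums finite, so that the results can be subtracted. *)
Lemma rsum_double (I : choiceType) (D : set I) (U V : nat -> I -> R) (a : I -> R) :
  (forall j i, 0 <= U j i) -> (forall j i, 0 <= V j i) ->
  (\esum_(j in [set: nat]) \esum_(i in D) (U j i)%:E < +oo)%E ->
  (\esum_(j in [set: nat]) \esum_(i in D) (V j i)%:E < +oo)%E ->
  (forall i, D i -> \sum_(j < k) (U j i - V j i) @[k --> \oo] --> a i) ->
  summable D (EFin \o a) /\
  rsum D a = rsum [set: nat] (fun j => fine (\esum_(i in D) (U j i)%:E)%E - fine (\esum_(i in D)
    (V j i)%:E)%E).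
Proof.
move=> U0 V0 Uoo Voo ca.
have row (X : nat -> I -> R) : (forall j i, 0 <= X j i) ->
    (\esum_(j in [set: nat]) \esum_(i in D) (X j i)%:E < +oo)%E ->
    [/\ forall i, D i -> (\esum_(j in [set: nat]) (X j i)%:E < +oo)%E,
        (\esum_(i in D) (fine (\esum_(j in [set: nat]) (X j i)%:E)%E)%:E =
          \esum_(j in [set: nat]) \esum_(i in D) (X j i)%:E)%E &
        (\esum_(j in [set: nat]) (fine (\esum_(i in D) (X j i)%:E)%E)%:E =
          \esum_(j in [set: nat]) \esum_(i in D) (X j i)%:E)%E].
  move=> X0 Xoo.
  have f1 j : (\esum_(i in D) (X j i)%:E < +oo)%E.
    apply: le_lt_trans Xoo; rewrite [leRHS](esumID [set j])//; last first.
      by move=> k _; apply: esum_ge0 => *; rewrite lee_fin.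
    rewrite setTI esum_set1; last by apply: esum_ge0 => *; rewrite lee_fin.
    by rewrite leeDl//; apply: esum_ge0 => k _; apply: esum_ge0 => *; rewrite lee_fin.
  have Xoo' : (\esum_(i in D) \esum_(j in [set: nat]) (X j i)%:E < +oo)%E.
    by rewrite esum_swap// => *; rewrite lee_fin.
  have f2 i : D i -> (\esum_(j in [set: nat]) (X j i)%:E < +oo)%E.
    move=> Di; apply: le_lt_trans Xoo'; rewrite [leRHS](esumID [set i])//; last first.
      by move=> k _; apply: esum_ge0 => *; rewrite lee_fin.
    rewrite setI1 mem_set// esum_set1; last by apply: esum_ge0 => *; rewrite lee_fin.
    by rewrite leeDl//; apply: esum_ge0 => k _; apply: esum_ge0 => *; rewrite lee_fin.
  split=> //.
    rewrite esum_swap; last by move=> *; rewrite lee_fin.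
    by apply: eq_esum => i Di; rewrite fineK//; apply: esum_fin_num => [j _|];
      [rewrite lee_fin|exact: f2].
  by apply: eq_esum => j _; rewrite fineK//; apply: esum_fin_num => // i _; rewrite lee_fin.
have [U1 U2 U3] := row U U0 Uoo; have [V1 V2 V3] := row V V0 Voo.
have fine0 (J : choiceType) (F : set J) (x : J -> R) : (forall j, 0 <= x j) ->
    0 <= fine (\esum_(j in F) (x j)%:E)%E.
  by move=> x0; apply: fine_ge0; apply: esum_ge0 => *; rewrite lee_fin.
have aE i : D i -> a i = fine (\esum_(j in [set: nat]) (U j i)%:E)%E - fine (\esum_(j in [set:
  nat]) (V j i)%:E)%E.
  move=> Di; have c1 := cvg_esum_nat (fun j => U0 j i) (U1 i Di).
  have c2 := cvg_esum_nat (fun j => V0 j i) (V1 i Di).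
  have c4 := ca i Di.
  have e : (fun k => \sum_(j < k) (U j i - V j i)) =
     (fun k : nat => \sum_(j < k) U j i) \- (fun k : nat => \sum_(j < k) V j i).
    by apply/funext => k /=; rewrite sumrB.
  by rewrite e in c4; apply: (cvg_unique (@Rhausdorff R) c4); exact: cvgB.
have [s1 ->] := @rsum_sub _ _ D a (fun i => fine (\esum_(j in [set: nat]) (U j i)%:E)%E)
    (fun i => fine (\esum_(j in [set: nat]) (V j i)%:E)%E) (fun i _ => fine0 _ _ _ (fun j => U0 j
      i))
    (fun i _ => fine0 _ _ _ (fun j => V0 j i))
    (eq_ind_r (fun x => x < +oo)%E Uoo U2) (eq_ind_r (fun x => x < +oo)%E Voo V2) aE.
split => //.
have [_ ->] := @rsum_sub _ _ [set: nat] (fun j => fine (\esum_(i in D) (U j i)%:E)%E - fine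
  (\esum_(i in D) (V j i)%:E)%E)
    (fun j => fine (\esum_(i in D) (U j i)%:E)%E) (fun j => fine (\esum_(i in D) (V j i)%:E)%E)
    (fun j _ => fine0 _ _ _ (U0 j)) (fun j _ => fine0 _ _ _ (V0 j))
    (eq_ind_r (fun x => x < +oo)%E Uoo U3) (eq_ind_r (fun x => x < +oo)%E Voo V3) (fun j _ =>
      erefl).
by rewrite U2 U3 V2 V3.
Qed.

(** The scalars of the polarization identity: for each j the frame identity is invoked at four
    vectors only, a countable family in all. *)
Definition fourth_roots : seq R[i] := [:: 1; -1; 'i; - 'i].

(* Polarization splits [F i] into series of nonnegative terms, which can be exchanged with the
   sum over [i]. *)
Lemma csum_expansion (I : choiceType) (D : set I) (e : I -> E) (z w : nat -> E) (Q : E ->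
  E) (F : I -> R[i]) :
  (forall i, D i -> l2 (e i)) -> (forall j, l2 (z j) /\ l2 (w j)) ->
  (forall u, l2 u -> l2 (Q u) /\ (l2_nsq (Q u) <= l2_nsq u)%E) ->
  (forall c u v, l2 u -> l2 v -> Q (c *: u + v) = c *: Q u + Q v) ->
  (forall j c, c \in fourth_roots ->
    l2_nsq (Q (c *: w j + z j)%R) = \esum_(i in D) (sqnorm (l2_inner (c *: w j + z j)%R (e
      i)))%:E)%E ->
  (\esum_(j in [set: nat]) l2_nsq (w j) < +oo)%E ->
  (\esum_(j in [set: nat]) l2_nsq (z j) < +oo)%E ->
  (forall i, D i ->
    Re (\sum_(j < k) l2_inner (z j) (e i) * (l2_inner (w j) (e i))^*) @[k --> \oo] --> Re (F i) /\
    Im (\sum_(j < k) l2_inner (z j) (e i) * (l2_inner (w j) (e i))^*) @[k --> \oo] --> Im (F i)) ->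
  csummable D F /\
  csum D F = rsum [set: nat] (fun j => Re (l2_inner (Q (z j)) (Q (w j)))) +i*
             rsum [set: nat] (fun j => Im (l2_inner (Q (z j)) (Q (w j)))).
Proof.
move=> le lzw lQ linQ fr woo zoo cF.
have lz j := (lzw j).1; have lw j := (lzw j).2.
(* Real and imaginary parts are treated together: [prt] is [Re] with c = 1, or [Im] with c = 'i. *)
have key (c : R[i]) (prt : R[i] -> R) : c \in fourth_roots -> - c \in fourth_roots ->
    (forall x y, prt (x * y^*) = (sqnorm (c * y + x) - sqnorm (- c * y + x)) / 4) ->
    (forall u v, l2 u -> l2 v -> prt (l2_inner u v) = (q (c *: v + u) - q (- c *: v + u)) / 4) ->
    (forall (s : nat -> R[i]) k, prt (\sum_(j < k) s j) = \sum_(j < k) prt (s j)) ->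
    sqnorm c = 1 ->
    (forall i, D i -> prt (\sum_(j < k) l2_inner (z j) (e i) * (l2_inner (w j) (e i))^*) @[k -->
      \oo] --> prt (F i)) ->
    summable D (EFin \o (fun i => prt (F i))) /\ rsum D (fun i => prt (F i)) =
    rsum [set: nat] (fun j => prt (l2_inner (Q (z j)) (Q (w j)))).
  move=> cin Ncin pE pq psum c1 cp.
  have lcwz d j : l2 (d *: w j + z j) by exact: sH.2.
  have nE d j : d \in fourth_roots ->
      (\esum_(i in D) (sqnorm (l2_inner (d *: w j + z j) (e i)) / 4)%R%:E = (q (Q (d *: w j + z
        j)) / 4)%R%:E)%E.
    move=> din; under eq_esum do rewrite mulrC.
    rewrite esumZ ?invr_ge0//; last by move=> i _; exact: sqnorm_ge0.
    by rewrite -(fr j d din) (l2_q (lQ _ (lcwz d j)).1) -EFinM mulrC.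
  have noo d : sqnorm d = 1 -> d \in fourth_roots ->
      (\esum_(j in [set: nat]) \esum_(i in D) (sqnorm (l2_inner (d *: w j + z j) (e i)) / 4)%R%:E
        < +oo)%E.
    move=> d1 din; apply: (@le_lt_trans _ _ (\esum_(j in [set: nat]) (l2_nsq (w j) + l2_nsq (z
      j)))%E); last first.
      by rewrite esumD ?lte_add_pinfty// => j _; exact: l2_nsq_ge0.
    apply: le_esum => j _; rewrite nE//.
    apply: (@le_trans _ _ ((q (d *: w j + z j)) / 4)%R%:E).
      rewrite lee_fin ler_pM2r ?invr_gt0// -lee_fin -!l2_q//; first exact: (lQ _ _).2.
      exact: (lQ _ _).1.
    have ld : l2 (d *: w j) by exact: (subspaceZ sH).
    rewrite !l2_q// -EFinD lee_fin; have := herm_qD_le sH hb ld (lz j).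
    rewrite (herm_qZ sH hb d (lw j)) d1 mul1r.
    have := herm_q_ge0 hb (lz j); have := herm_q_ge0 hb (lw j) => h1 h2 h3; lra.
  have s0 (d : R[i]) (j : nat) (i : I) : 0 <= sqnorm (l2_inner (d *: w j + z j) (e i)) / 4.
    by rewrite divr_ge0 ?sqnorm_ge0.
  have c1N : sqnorm (- c) = 1 by rewrite sqnormN.
  have ce i : D i -> \sum_(j < k) (sqnorm (l2_inner (c *: w j + z j) (e i)) / 4 -
      sqnorm (l2_inner (- c *: w j + z j) (e i)) / 4) @[k --> \oo] --> prt (F i).
    move=> Di; have lei := le i Di.
    have E k : \sum_(j < k) (sqnorm (l2_inner (c *: w j + z j) (e i)) / 4 -
      sqnorm (l2_inner (- c *: w j + z j) (e i)) / 4) =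
      prt (\sum_(j < k) l2_inner (z j) (e i) * (l2_inner (w j) (e i))^*).
      rewrite (psum (fun j => l2_inner (z j) (e i) * (l2_inner (w j) (e i))^*)).
      apply: eq_bigr => j _; have ldw d : l2 (d *: w j) by exact: (subspaceZ sH).
      rewrite (hermDl hb (ldw c) (lz j) lei) (hermDl hb (ldw (- c)) (lz j) lei).
      by rewrite (hermZl sH hb c (lw j) lei) (hermZl sH hb (- c) (lw j) lei) pE mulrBl.
    by under eq_fun do rewrite E; exact: cp.
  have [s ->] := rsum_double (s0 c) (s0 (- c)) (noo _ c1 cin) (noo _ c1N Ncin) ce.
  split => //; apply: eq_rsum => j _; rewrite (nE _ _ cin) (nE _ _ Ncin) /= pq; last 2 first.
  - exact: (lQ _ (lz j)).1.
  - exact: (lQ _ (lw j)).1.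
  rewrite [RHS]mulrBl (linQ c _ _ (lw j) (lz j)) (linQ (- c) _ _ (lw j) (lz j)).
  by [].

have [s1 e1] : summable D (EFin \o (fun i => Re (F i))) /\ rsum D (fun i => Re (F i)) =
    rsum [set: nat] (fun j => Re (l2_inner (Q (z j)) (Q (w j)))).
  apply: (key 1 Re); rewrite /fourth_roots ?inE ?eqxx ?orbT//.
  - by move=> x y; rewrite polar_Re mul1r mulN1r ![_ + x]addrC.
  - by move=> u v lu lv; rewrite scaleN1r scale1r ![_ + u]addrC (herm_polar_Re sH hb).
  - by move=> s k; elim: k => [|k ih]; rewrite ?big_ord0// !big_ord_recr -ih ReDE.
  - by rewrite (sqnorm_real 1) expr1n.
  - by move=> i /cF[].
have [s2 e2] : summable D (EFin \o (fun i => Im (F i))) /\ rsum D (fun i => Im (F i)) =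
    rsum [set: nat] (fun j => Im (l2_inner (Q (z j)) (Q (w j)))).
  apply: (key 'i Im); rewrite /fourth_roots ?inE ?eqxx ?orbT//.
  - by move=> x y; rewrite polar_Im mulNr ![_ + x]addrC.
  - by move=> u v lu lv; rewrite scaleNr ![_ + u]addrC (herm_polar_Im sH hb).
  - by move=> s k; elim: k => [|k ih]; rewrite ?big_ord0// !big_ord_recr -ih ImDE.
  - by rewrite /sqnorm /= expr0n expr1n add0r.
  - by move=> i /cF[].
by split; [split|rewrite /csum e1 e2].
Qed.

(** [csum_expansion] is used twice: for the family e with the projection P, and for the coordinate
    basis with the identity map and P g_j instead of g_j. The results are the sums of <P h_j | P
    g_j> and of <h_j | P g_j>, which agree term by term. *)
Lemma trace_class_frame A W (I : choiceType) (D : set I) (e : I -> E) (g h : nat -> E) :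
  closed_subspace l2 l2_nsq W -> (forall i, D i -> l2 (e i)) ->
  (forall j, l2 (g j) /\ l2 (h j)) ->
  (\esum_(j in [set: nat]) l2_nsq (g j) < +oo)%E ->
  (\esum_(j in [set: nat]) l2_nsq (h j) < +oo)%E ->
  (forall a c, l2 a -> l2 c ->
    Re (\sum_(j < k) l2_inner a (g j) * l2_inner (h j) c) @[k --> \oo] --> Re (l2_inner (A a) c) /\
    Im (\sum_(j < k) l2_inner a (g j) * l2_inner (h j) c) @[k --> \oo] --> Im (l2_inner (A a) c)) ->
  (forall j c, c \in fourth_roots ->
    l2_nsq (proj W (c *: g j + h j)%R) = \esum_(i in D) (sqnorm (l2_inner (c *: g j + h j)%R (e
      i)))%:E)%E ->
  has_csum D (fun i => l2_inner (A (e i)) (e i)) (trace (fun a => A (proj W a))).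
Proof.
move=> cW le lgh goo hoo ex fr; apply/has_csumE.
have lg j := (lgh j).1; have lh j := (lgh j).2.
have lP u : l2 u -> l2 (proj W u) /\ (l2_nsq (proj W u) <= l2_nsq u)%E.
  move=> lu; have lPu := proj_l2 cW lu; split => //.
  by rewrite !l2_q// lee_fin; exact: proj_q_le.
have linP c u v : l2 u -> l2 v -> proj W (c *: u + v) = c *: proj W u + proj W v.
  exact: projZD.
have [||s1 e1] := @csum_expansion I D e h g (proj W) (fun i => l2_inner (A (e i)) (e i)) le _ lP
  linP fr goo hoo.
- by move=> j; split.
- move=> i Di; have lei := le i Di; have [c1 c2] := ex _ _ lei lei.
  have E k : \sum_(j < k) l2_inner (h j) (e i) * (l2_inner (g j) (e i))^* =
    \sum_(j < k) l2_inner (e i) (g j) * l2_inner (h j) (e i).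
    by apply: eq_bigr => j _; rewrite mulrC (hermC hb (lg j) lei).
  by split; under eq_fun do rewrite E.
split => //; rewrite e1 /trace; apply/esym.
have lPg j : l2 (proj W (g j)) by exact: (lP _ (lg j)).1.
(* The trace has P on the right of A; self-adjointness of P moves it onto g_j. *)
have [||||||_ ->] := @csum_expansion _ idx (@delta R n) h (fun j => proj W (g j)) id
  (fun p => l2_inner (A (proj W (delta p))) (delta p)) (fun p _ => l2_delta p) _ _ _ _ _ hoo.
- by move=> j; split.
- by [].
- by [].
- by move=> j c _; exact: l2_nsq_delta.
- by apply: le_lt_trans goo; apply: le_esum => j _; exact: (lP _ (lg j)).2.
- move=> p _; have lp := l2_delta (R := R) p; have lPp := (lP _ lp).1.
  have [c1 c2] := ex _ _ lPp lp.
  have E k : \sum_(j < k) l2_inner (h j) (delta p) * (l2_inner (proj W (g j)) (delta p))^* =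
    \sum_(j < k) l2_inner (proj W (delta p)) (g j) * l2_inner (h j) (delta p).
    by apply: eq_bigr => j _; rewrite mulrC (proj_adj cW lp (lg j)) (hermC hb (lPg j) lp).
  by split; under eq_fun do rewrite E.
by congr Complex; apply: eq_rsum => j _; rewrite /= (projE cW (lh j) (proj_in cW (lg j))).
Qed.

End trace_class_frames.

(** * Periodization and fibers *)

Section countable_sums.
Context {R : realType} {T : choiceType}.
Implicit Types (D : set T) (u : T -> R).

(** One enumeration for all summands turns sums over D into series over [nat], to which
    measurability and termwise integration apply. Numbers that enumerate nothing contribute 0. *)
Lemma esum_enum D : countable D -> exists r : nat -> option T,
  (forall m t, r m = Some t -> D t) /\
  forall u : T -> \bar R, (forall t, D t -> 0 <= u t)%E ->
    (\esum_(t in D) u t = \sum_(m <oo) (if r m is Some t then u t else 0))%E.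
Proof.
move=> /countable_injP[h hinj].
pose r m := if pselect (exists t, D t /\ h t = m) is left e then Some (projT1 (cid e)) else None.
have rD m t : r m = Some t -> D t /\ h t = m.
  by rewrite /r; case: pselect => // e [<-]; exact: projT2 (cid e).
have rh t : D t -> r (h t) = Some t.
  move=> Dt; rewrite /r; case: pselect => [e|]; last by case; exists t.
  have [D' e'] := projT2 (cid e); congr Some; apply: hinj; rewrite ?inE//.
exists r; split=> [m t /rD[]//|u u0].
have v0 m : (0 <= (if r m is Some t then u t else 0))%E.
  by case E : (r m) => [t|//]; apply: u0; case: (rD _ _ E).
rewrite nneseries_esumT//.
rewrite (esumID (h @` D)); last by move=> m _; exact: v0.
rewrite [X in (_ = _ + X)%E]esum1 ?adde0; last first.
  move=> m [_ hm]; case E : (r m) => [t|//]; have [Dt e] := rD _ _ E.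
  by exfalso; apply: hm; exists t.
rewrite setTI esum_image; last by move=> x y xD yD /hinj ->.
by apply: eq_esum => t Dt; rewrite rh.
Qed.

(** For each m only finitely many terms exceed 1 / (m + 1), since N such terms sum to at least N /
    (m + 1). *)
Lemma countable_support D u : (forall t, D t -> 0 <= u t) ->
  (\esum_(t in D) (u t)%:E < +oo)%E -> countable (D `&` [set t | u t != 0]).
Proof.
move=> u0 uoo; have fin : (\esum_(t in D) (u t)%:E)%E \is a fin_num.
  by apply: esum_fin_num => // t Dt; rewrite lee_fin u0.
have -> : D `&` [set t | u t != 0] = \bigcup_(m in [set: nat]) (D `&` [set t | m.+1%:R^-1 < u t]).
  apply/seteqP; split=> [t [Dt /= ut]|t [m _ [Dt /= lt]]]; last first.
    by split => //=; rewrite gt_eqF// (lt_trans _ lt)// invr_gt0.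
  have up : 0 < u t by rewrite lt_neqAle eq_sym ut u0.
  have [m _ hm] := near_infty_natSinv_lt (PosNum up).
  by exists m => //; split => //=; apply: hm => /=.
apply: bigcup_countable => // m _; apply: finite_set_countable; apply: contrapT.
set S := fine (\esum_(t in D) (u t)%:E)%E in fin *.
move=> /(infinite_set_fset (Num.bound (m.+1%:R * S)).+1)[B BD cB].
have : \sum_(t <- finmap.enum_fset B) u t <= S.
  rewrite -lee_fin fineK//; apply: esum_ge_seq; first exact: finmap.fset_uniq.
  by move=> t tB; case: (BD t tB).
have : \sum_(t <- finmap.enum_fset B) m.+1%:R^-1 <= \sum_(t <- finmap.enum_fset B) u t.
  by rewrite big_seq [leRHS]big_seq; apply: ler_sum => t tB; apply: ltW; case: (BD t tB).
rewrite big_const_seq count_predT iter_addr_0 -[X in X <= _]mulr_natl => h1 h2.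
have := le_trans h1 h2; rewrite ler_pdivrMr// [S * _]mulrC leNgt => /negP; apply.
apply: lt_le_trans (_ : (Num.bound (m.+1%:R * S)).+1%:R <= _); last by rewrite ler_nat.
apply: lt_le_trans (archi_boundP _) _; last by rewrite ler_nat.
by rewrite mulr_ge0// fine_ge0// esum_ge0.
Qed.

End countable_sums.

(** * Measurability and integration of countable sums *)

Section countable_integrals.
Context {R : realType} {T : choiceType}.
Local Notation mu := (@lebesgue_measure R).
Local Notation TR := (measurableTypeR R).

Lemma measurable_esum (D : set T) (A : set TR) (f : T -> TR -> \bar R) : countable D ->
  (forall t x, D t -> 0 <= f t x)%E -> (forall t, D t -> measurable_fun A (f t)) ->
  measurable_fun A (fun x => \esum_(t in D) f t x)%E.
Proof.
move=> /(esum_enum (R := R))[r [rD e]] f0 mf.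
under eq_fun do rewrite (e (f ^~ _) (fun t Dt => f0 t _ Dt)).
apply: ge0_emeasurable_sum => [k x _ _|k _].
  by case E : (r k) => [t|//]; apply: f0; exact: rD E.
by case E : (r k) => [t|]; [exact: mf (rD _ _ E)|exact: measurable_cst].
Qed.

Lemma integral_esum (D : set T) (A : set TR) (f : T -> TR -> \bar R) : countable D ->
  measurable A ->
  (forall t x, D t -> 0 <= f t x)%E -> (forall t, D t -> measurable_fun A (f t)) ->
  (\int[mu]_(x in A) (\esum_(t in D) f t x) = \esum_(t in D) \int[mu]_(x in A) f t x)%E.
Proof.
move=> /(esum_enum (R := R))[r [rD e]] mA f0 mf.
rewrite e; last by move=> t Dt; apply: integral_ge0 => x _; exact: f0.
under eq_integral do rewrite (e (f ^~ _) (fun t Dt => f0 t _ Dt)).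
rewrite integral_nneseries//.
- apply: eq_eseriesr => m _; case: (r m) => //.
  by rewrite integral0.
- by move=> m; case E : (r m) => [t|]; [exact: mf (rD _ _ E)|exact: measurable_cst].
- by move=> m x _; case E : (r m) => [t|//]; apply: f0; exact: rD E.
Qed.

Lemma ae_countable (D : set T) (P : T -> R -> Prop) : countable D ->
  (forall t, D t -> {ae mu, forall x, P t x}) -> {ae mu, forall x, forall t, D t -> P t x}.
Proof.
move=> /countable_injP[h hinj] aP.
pose Q m x := forall t, D t -> h t = m -> P t x.
have aQ : {ae mu, forall x, forall m, Q m x}.
  apply/(@ae_foralln _ _ _ mu); move=> m.
  have [[t [Dt htm]]|nt] := pselect (exists t, D t /\ h t = m).
    apply: ae_imply (aP t Dt) => x Px t' Dt' e'.
    by have -> : t' = t by apply: hinj; rewrite ?inE// htm.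
  by apply: nearW => x t Dt htm; exfalso; apply: nt; exists t.
by apply: ae_imply aQ => x Qx t Dt; exact: (Qx (h t)).
Qed.

End countable_integrals.

(** * Borel versions of Lebesgue measurable functions *)

Section lebesgue_borel.
Context {R : realType}.
Local Notation mu := (@lebesgue_measure R).
Local Notation TR := (measurableTypeR R).

(** For each rational q the set where g exceeds q is Borel up to a negligible set. The countably
    many exceptions lie in one Borel null set Z, and setting g to 0 on Z makes it Borel. *)
Lemma borel_version (g : R -> R) : lebesgue_measurable_fun g ->
  exists2 h : TR -> R, measurable_fun setT h & {ae mu, forall x, g x = h x}.
Proof.
move=> mg.
have /choice[AN hAN] : forall q : rat, exists X : set R * set R,
    [/\ measurable (X.1 : set TR), mu.-negligible X.2 & [set x | ratr q < g x] = X.1 `|` X.2].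
  move=> q; have : [set x | ratr q < g x] \in [set: set R] by rewrite inE.
  have /(_ measurableT) := mg; move=> /(_ `]ratr q, +oo[%classic (measurable_itv _)).
  rewrite setTI => mq _.
  have : (completed_algebra_gen mu) [set x | ratr q < g x].
    rewrite -g_sigma_completed_algebra_genE completed_caratheodory_measurable.
    have -> : [set x | ratr q < g x] = g @^-1` `]ratr q, +oo[%classic.
      by apply/seteqP; split => x /=; rewrite in_itv/= andbT.
    exact: mq.
  by move=> [A mA [N nN] <-]; exists (A, N).
pose A q := (AN q).1; pose N q := (AN q).2.
have [Z [mZ Z0 NZ]] : mu.-negligible (\bigcup_q N q).
  pose N' m := if @unpickle rat m is Some q then N q else set0.
  have -> : \bigcup_q N q = \bigcup_m N' m.
    apply/seteqP; split=> x [q _ Nx]; first by exists (pickle q); rewrite /N' ?pickleK.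
    by move: Nx; rewrite /N'; case: unpickle => [q' Nx|//]; exists q'.
  apply: negligible_bigcup => m; rewrite /N'; case: unpickle => [q|]; last exact: negligible_set0.
  by case: (hAN q).
exists (fun x => if x \in Z then 0 else g x); last first.
  exists Z; split => // x /= gx; apply: contrapT => Zx; apply: gx.
  by rewrite memNset.
apply: (measurability _ (RGenOInfty.measurableE R)) => // _ [_ [r ->] <-].
rewrite setTI.
have -> : (fun x => if x \in Z then 0 else g x) @^-1` `]r, +oo[%classic =
    (\bigcup_q (if r < ratr q then A q `\` Z else set0)) `|` (if r < 0 then Z else set0).
  apply/seteqP; split=> x /=.
    rewrite in_itv/= andbT; case: ifPn => [|xZ rg].
      by rewrite inE => Zx r0; right; rewrite r0.
    have [q qI] := rat_in_itvoo rg; move: qI; rewrite in_itv/= => /andP[rq qg].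
    have nZ : ~ Z x by move: xZ; rewrite notin_setE.
    left; exists q => //; rewrite rq; split => //.
    have [_ _ e] := hAN q; have : [set x | ratr q < g x] x by [].
    by rewrite e => -[//|Nx]; exfalso; apply: nZ; apply: NZ; exists q.
  rewrite in_itv/= andbT => -[[q _]|]; case: ifP => //; last by move=> r0 Zx; rewrite mem_set.
  move=> rq [Ax nZ].
  rewrite memNset//; apply: lt_trans rq _.
  have [_ _ e] := hAN q; have : [set x | ratr q < g x] x by rewrite e; left.
  by [].
apply: measurableU; last by case: ifP.
apply: bigcupT_measurable_rat => q; case: ifP => // _; apply: measurableD => //.
by case: (hAN q).
Qed.

End lebesgue_borel.

(** * Periodization modulo 2 pi *)

Section periodization.
Context {R : realType}.
Local Notation mu := (@lebesgue_measure R).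
Local Notation TR := (measurableTypeR R).
Variable c : R.

Definition period : set TR := `[c, c + 2 * pi[%classic.

(** Each x equals [red x + 2 * (cell x)%:~R * pi], with [red x] in the period that starts at c. *)
Definition cell (x : R) : int := Num.floor ((x - c) / (2 * pi)).

Definition red (x : R) : R := x - 2 * (cell x)%:~R * pi.

Lemma twopi_gt0 : 0 < 2 * pi :> R.
Proof. by rewrite mulr_gt0// pi_gt0. Qed.

Lemma measurable_period : measurable period.
Proof. exact: measurable_itv. Qed.

Lemma periodE x : period x <-> c <= x < c + 2 * pi.
Proof. by rewrite /period /= in_itv. Qed.

Lemma cell_eq x (k : int) : period (x - 2 * k%:~R * pi) -> cell x = k.
Proof.
move=> /periodE/andP[h1 h2]; apply: floor_def; have p0 := twopi_gt0.
by rewrite ler_pdivlMr// ltr_pdivrMr// intrD; apply/andP; split; lra.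
Qed.

Lemma red_period x : period (red x).
Proof.
apply/periodE; have := floor_itv ((x - c) / (2 * pi)); rewrite -/(cell x).
have p0 := twopi_gt0; rewrite ler_pdivlMr// ltr_pdivrMr// intrD /red => /andP[h1 h2].
by apply/andP; split; lra.
Qed.

Lemma cell_shift x (k : int) : cell (x + 2 * k%:~R * pi) = cell x + k.
Proof. by apply: cell_eq; have := red_period x; rewrite /red intrD; congr period; ring. Qed.

Lemma red_shift x (k : int) : red (x + 2 * k%:~R * pi) = red x.
Proof. by rewrite /red cell_shift intrD; ring. Qed.

Lemma cell_period x : period x -> cell x = 0.
Proof. by move=> px; apply: cell_eq; rewrite mulr0 mul0r subr0. Qed.

Lemma red_id x : period x -> red x = x.
Proof. by move=> px; rewrite /red (cell_period px) mulr0 mul0r subr0. Qed.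

Lemma measurable_piecewise (f : int -> TR -> R) : (forall k, measurable_fun setT (f k)) ->
  measurable_fun setT (fun x : TR => f (cell x) x).
Proof.
move=> mf; pose S (k : int) : set TR := `[c + 2 * k%:~R * pi, c + 2 * k%:~R * pi + 2 * pi[%classic.
have mS k : measurable (S k) by exact: measurable_itv.
have cS k x : S k x <-> cell x = k.
  split=> [|<-]; rewrite /S /= in_itv/=.
    by move=> h; apply: cell_eq; apply/periodE; case/andP: h => h1 h2; apply/andP; split; lra.
  by have /periodE := red_period x; rewrite /red => /andP[h1 h2]; apply/andP; split; lra.
pose E m := if unpickle m is Some k then S k else set0.
have -> : [set: TR] = \bigcup_m E m.
  apply/seteqP; split=> // x _; exists (pickle (cell x)); first by [].
  by rewrite /E pickleK; exact: (cS _ _).2.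
apply/measurable_fun_bigcup => m.
  by rewrite /E; case: unpickle.
rewrite /E; case: unpickle => [k|]; last exact: measurable_fun_set0.
apply: (eq_measurable_fun (f k)); last exact: measurable_funTS.
by move=> x; rewrite inE => /cS ->.
Qed.

Lemma measurable_red : measurable_fun setT (red : TR -> TR).
Proof.
apply: (@measurable_piecewise (fun k x => x - 2 * k%:~R * pi)) => k.
by apply: measurable_funB => //; exact: measurable_id.
Qed.

(** The piece [f k] is g on the k-th translate of the period; every x lies in exactly one translate,
    the one numbered [cell x]. *)
Lemma tiling (g : TR -> \bar R) : measurable_fun setT g -> (forall x, 0 <= g x)%E ->
  (\int[mu]_x g x = \esum_(k in [set: int]) \int[mu]_(x in period) g (x + 2 * k%:~R * pi)%R)%E.
Proof.
move=> mg g0.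
pose f (k : int) (x : TR) : \bar R := if x - 2 * k%:~R * pi \in period then g x else 0%E.
have f0 k x : (0 <= f k x)%E by rewrite /f; case: ifP.
have mf k : measurable_fun setT (f k).
  have -> : f k = g \_ [set x | period (x - 2 * k%:~R * pi)].
    by apply/funext => x; rewrite /f /patch; congr (if _ then _ else _); apply/idP/idP;
      rewrite !inE.
  apply: (measurable_restrictT _ _).1; last exact: measurable_funTS.
  rewrite -[X in measurable X]setTI.
  apply: (@measurable_funB _ _ _ setT (@id TR) (cst (2 * k%:~R * pi))) => //.
  exact: measurable_period.
transitivity (\int[mu]_x (\esum_(k in [set: int]) f k x))%E.
  apply: eq_integral => x _; rewrite (esumID [set cell x])//.
  rewrite setTI esum_set1// esum1 ?adde0 => [|k [_ /= kx]]; first by rewrite /f mem_set//;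
    exact: red_period.
  by rewrite /f; case: ifPn => //; rewrite inE => /cell_eq/esym/kx.
rewrite (integral_esum (countableP _) measurableT)//; apply: eq_esum => k _.
rewrite -(ge0_integral_translate (2 * k%:~R * pi) (mf k) (f0 k)) [RHS]integral_mkcond.
by apply: eq_integral => x _; rewrite /f addrK.
Qed.

Lemma ae_translate (b : R) (Q : R -> Prop) : {ae mu, forall x, Q x} -> {ae mu, forall x, Q (x + b)}.
Proof.
move=> [N [mN N0 QN]]; exists [set x | N (x + b)]; split.
- by rewrite -[X in measurable X]setTI; apply: (@measurable_funD _ _ _ setT (@id TR) (cst b)).
- have mN1 : measurable [set x : TR | N (x + b)].
    by rewrite -[X in measurable X]setTI; apply: (@measurable_funD _ _ _ setT (@id TR) (cst b)).
  have mI : measurable_fun setT (fun x : R => (\1_N x : R)%:E).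
    by apply/measurable_EFinP; exact: measurable_indic.
  have I0 x : (0 <= (\1_N x : R)%:E)%E by rewrite lee_fin.
  have E : (\int[mu]_x (\1_N x : R)%:E = 0)%E by rewrite (integral_indic mu measurableT mN) setIT.
  have := ge0_integral_translate b mI I0; rewrite E => <-.
  by rewrite -[X in mu X]setIT -integral_indic.
- by move=> x /= nQ; exact: QN.
Qed.

Lemma ae_periodic (P : R -> Prop) :
  (forall x (k : int), P x -> P (x + 2 * k%:~R * pi)) ->
  {ae mu, forall x, period x -> P x} -> {ae mu, forall x, P x}.
Proof.
move=> shP aP.
have /ae_imply : {ae mu, forall x, forall k, [set: int] k -> period (x - 2 * k%:~R * pi) ->
  P (x - 2 * k%:~R * pi)}.
  by apply: ae_countable => [|k _]; [exact: countableP|exact: ae_translate aP].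
apply=> x h; have := h (cell x) Logic.I (red_period x).
by move=> /(shP _ (cell x)); rewrite subrK.
Qed.

End periodization.

(** * Fibers of square-integrable functions *)

Section fibers.
Context {R : realType} {n : nat}.
Local Notation mu := (@lebesgue_measure R).
Local Notation TR := (measurableTypeR R).
Local Notation C := (Cplx R).
Local Notation E := (int * 'I_n -> C).
Local Notation Re := (@complex.Re R).
Local Notation Im := (@complex.Im R).
Local Notation idx := [set: int * 'I_n].
Implicit Types (a b : R -> E) (H K : 'I_n -> R -> C).

Lemma esum_ord (u : 'I_n -> \bar R) : (forall i, 0 <= u i)%E ->
  (\esum_(i in [set: 'I_n]) u i = \sum_(i < n) u i)%E.
Proof.
move=> u0; have -> : [set: 'I_n] = [set` enum 'I_n].
  by apply/seteqP; split => i //= _; rewrite mem_enum.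
by rewrite esum_fset// -fsbig_seq ?enum_uniq// big_enum.
Qed.

Lemma esum_index (u : int * 'I_n -> \bar R) : (forall p, 0 <= u p)%E ->
  (\esum_(p in idx) u p = \sum_(i < n) \esum_(k in [set: int]) u (k, i))%E.
Proof.
move=> u0; transitivity (\esum_(k in [set: int]) \esum_(i in [set: 'I_n]) u (k, i))%E.
  rewrite (@esum_esum R _ _ setT (fun=> setT) (fun k i => u (k, i)))//.
  rewrite (_ : [set: int] `*`` (fun=> [set: 'I_n]) = idx); first by apply: eq_esum => -[].
  by apply/seteqP; split.
rewrite esum_swap; last by move=> k i _ _; exact: u0.
by rewrite esum_ord// => i; apply: esum_ge0.
Qed.

Lemma measurable_l2_nsq a : (forall p, cmeas (fun x => a x p)) ->
  measurable_fun setT (fun x : TR => l2_nsq (a x)).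
Proof.
move=> ma; apply: (measurable_esum (countableP _)) => [p x _|p _];
  first by rewrite lee_fin sqnorm_ge0.
by apply/measurable_EFinP; exact: (cmeas_sqnorm (ma p)).
Qed.

Lemma measurable_rsum (f : int * 'I_n -> TR -> R) : (forall p, measurable_fun setT (f p)) ->
  measurable_fun setT (fun x : TR => rsum idx (fun p => f p x)).
Proof.
move=> mf; apply: measurable_funB.
  apply: (measurableT_comp (fine_measurable measurableT)).
  apply: (measurable_esum (countableP _)) => [p x _|p _]; first exact: funepos_ge0.
  have -> : (fun x => ((EFin \o (fun p => f p x))^\+ p)%E) = (EFin \o f p)^\+%E.
    by apply/funext => x; rewrite !funeposE.
  by apply: measurable_funepos; apply/measurable_EFinP.
apply: (measurableT_comp (fine_measurable measurableT)).
apply: (measurable_esum (countableP _)) => [p x _|p _]; first exact: funeneg_ge0.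
have -> : (fun x => ((EFin \o (fun p => f p x))^\- p)%E) = (EFin \o f p)^\-%E.
  by apply/funext => x; rewrite !funenegE.
by apply: measurable_funeneg; apply/measurable_EFinP.
Qed.

Lemma cmeas_l2_inner a b : (forall p, cmeas (fun x => a x p)) ->
  (forall p, cmeas (fun x => b x p)) ->
  cmeas (fun x => l2_inner (a x) (b x)).
Proof.
move=> ma mb; have m p := cmeasM (ma p) (cmeasC (mb p)).
by split; [exact: (measurable_rsum (fun p => (m p).1))|exact: (measurable_rsum (fun p => (m p).2))].
Qed.

Variable theta : 'I_n -> R.

(** This is [Tper] with an arbitrary H in place of the Fourier transform, so that a fiber can be
    prescribed before a function that has it is constructed. *)
Definition fib H (xi : R) : E := fun p => H p.2 (xi - theta p.2 + 2 * p.1%:~R * pi).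

Lemma fibZD (z : R[i]) H K xi : fib (z *: H + K) xi = z *: fib H xi + fib K xi.
Proof. by []. Qed.

Lemma fib_shift H xi (k : int) : fib H (xi + 2 * k%:~R * pi) = lambda (- k) (fib H xi).
Proof.
apply/funext => -[m i]; rewrite /fib /lambda /= opprK; congr (H i _).
by rewrite intrD; ring.
Qed.

Lemma cmeas_fib H p : (forall i, cmeas (H i)) -> cmeas (fun xi => fib H xi p).
Proof.
move=> mH; have -> : (fun xi => fib H xi p) = (fun xi => H p.2 (xi + (- theta p.2 + 2 * p.1%:~R *
  pi))).
  by apply/funext => x; rewrite addrA.
exact: cmeas_translate.
Qed.

Variable c : R.
Local Notation per := (period c).

(** After a translation by theta_i, the coordinates (k, i) of the fiber are the values of H_i on the
    translates of one period, and these tile the line. *)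
Lemma fib_nsq H : (forall i, cmeas (H i)) ->
  (\int[mu]_(xi in per) l2_nsq (fib H xi) = \sum_(i < n) L2nsq (H i))%E.
Proof.
move=> mH; rewrite /l2_nsq integral_esum; last 4 first.
- exact: countableP.
- exact: measurable_period.
- by move=> p x _; rewrite lee_fin sqnorm_ge0.
- by move=> p _; apply/measurable_EFinP; apply: measurable_funTS;
  exact: (cmeas_sqnorm (cmeas_fib p mH)).
rewrite esum_index; last by move=> p; apply: integral_ge0 => x _; rewrite lee_fin sqnorm_ge0.
apply: eq_bigr => i _; have mi := cmeas_translate (- theta i) (mH i).
rewrite -(L2nsq_translate (- theta i) (mH i)) L2nsq_def (tiling c)//; last 2 first.
- by apply/measurable_EFinP; exact: (cmeas_sqnorm mi).
- by move=> x; rewrite lee_fin sqnorm_ge0.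
apply: eq_esum => k _; apply: eq_integral => x _; rewrite /fib /=.
by congr (sqnorm (H i _))%:E; ring.
Qed.

Local Notation q f := (Re (L2ip f f)).

Definition CL2n H := forall i, CLfun 2%:E (H i).

Lemma CL2n_cmeas H : CL2n H -> forall i, cmeas (H i).
Proof. by move=> h i; case: ((CL2P (H i)).1 (h i)). Qed.

Lemma CL2nZD (z : R[i]) H K : CL2n H -> CL2n K -> CL2n (z *: H + K).
Proof. by move=> hH hK i; exact: CL2_subspace.2. Qed.

Lemma sum_L2nsq H : CL2n H -> (\sum_(i < n) L2nsq (H i))%E = (\sum_(i < n) q (H i))%:E.
Proof. by move=> hH; rewrite -sumEFin; apply: eq_bigr => i _; rewrite L2nsq_q. Qed.

Lemma fib_l2 H : CL2n H -> {ae mu, forall xi, per xi -> l2 (fib H xi)}.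
Proof.
move=> hH; have mH := CL2n_cmeas hH.
have mN := measurable_l2_nsq (fun p => cmeas_fib p mH).
have i : mu.-integrable per (fun xi => l2_nsq (fib H xi)).
  apply/integrableP; split; first exact: measurable_funTS.
  under eq_integral do rewrite gee0_abs ?l2_nsq_ge0//.
  by rewrite fib_nsq// sum_L2nsq// ltry.
apply: ae_imply (integrable_ae (measurable_period c) i) => xi h /h.
by rewrite ge0_fin_numE ?l2_nsq_ge0.
Qed.

(** The extension by 0 turns an integral over a period into one over the line. Where the norm is
    infinite, on a null set, [fine] returns 0. *)
Definition pnsq H (xi : R) : R := if xi \in per then fine (l2_nsq (fib H xi)) else 0.

Lemma pnsq_int H : CL2n H -> mu.-integrable setT (EFin \o pnsq H) /\
  \int[mu]_xi pnsq H xi = \sum_(i < n) q (H i).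
Proof.
move=> hH; have mH := CL2n_cmeas hH.
have mN := measurable_l2_nsq (fun p => cmeas_fib p mH).
have mp : measurable_fun setT (pnsq H).
  apply: (measurable_if_mem (measurable_period c)).
  exact: (measurableT_comp (fine_measurable measurableT)).
have p0 xi : 0 <= pnsq H xi by rewrite /pnsq; case: ifP => // _; exact/fine_ge0/l2_nsq_ge0.
have I : (\int[mu]_xi (pnsq H xi)%:E = (\sum_(i < n) q (H i))%:E)%E.
  rewrite -sum_L2nsq// -fib_nsq// [RHS]integral_mkcond; apply: ae_eq_integral => //.
  - exact/measurable_EFinP.
  - by apply: (measurable_restrictT _ _).1; [exact: measurable_period|exact: measurable_funTS].
  apply: ae_imply (fib_l2 hH) => xi h _; rewrite /pnsq /patch; case: ifPn => // /set_mem px.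
  by rewrite fineK// l2_fin//; exact: h.
split; last by rewrite /Rintegral I.
apply/integrableP; split; first exact/measurable_EFinP.
by under eq_integral do rewrite gee0_abs ?lee_fin ?p0//; rewrite I ltry.
Qed.

Definition pinner H K (xi : R) : C := if xi \in per then l2_inner (fib H xi) (fib K xi) else 0.

(** Polarization reduces products to the squared norms of [pnsq_int]. The fibers are in l^2 only
    almost everywhere, so the polarized integrands agree almost everywhere. *)
Lemma pinner_int H K : CL2n H -> CL2n K ->
  cintegrable (pinner H K) /\ cint (pinner H K) = \sum_(i < n) L2ip (H i) (K i).
Proof.
move=> hH hK; have [mH mK] := (CL2n_cmeas hH, CL2n_cmeas hK).
have [m1 m2] := cmeas_l2_inner (fun p => cmeas_fib p mH) (fun p => cmeas_fib p mK).
have hb := @l2_hermitian R n; have sH := @l2_subspace R n.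
have hL := @L2_hermitian R; have sL := @CL2_subspace R.
have key (z : R[i]) (prt : R[i] -> R) : prt 0 = 0 ->
    (forall u v : E, l2 u -> l2 v -> prt (l2_inner u v) =
       (Re (l2_inner (z *: v + u) (z *: v + u)) - Re (l2_inner (- z *: v + u) (- z *: v + u))) /
         4) ->
    (forall u v : R -> C, CLfun 2%:E u -> CLfun 2%:E v -> prt (L2ip u v) =
       (q (z *: v + u) - q (- z *: v + u)) / 4) ->
    measurable_fun setT (fun xi => prt (l2_inner (fib H xi) (fib K xi))) ->
    mu.-integrable setT (EFin \o (fun xi => prt (pinner H K xi))) /\
    \int[mu]_xi prt (pinner H K xi) = \sum_(i < n) prt (L2ip (H i) (K i)).
  move=> p0 pl pL mp.
  have [i1 e1] := pnsq_int (CL2nZD z hK hH); have [i2 e2] := pnsq_int (CL2nZD (- z) hK hH).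
  have mP : measurable_fun setT (fun xi => prt (pinner H K xi)).
    have -> : (fun xi => prt (pinner H K xi)) =
       (fun xi => if xi \in per then prt (l2_inner (fib H xi) (fib K xi)) else 0).
      by apply/funext => xi; rewrite /pinner; case: ifP.
    exact: (measurable_if_mem (measurable_period c)).
  have iB := integrableZl measurableT 4^-1 (integrableB measurableT i1 i2).
  have aeE : {ae mu, forall xi, setT xi -> (prt (pinner H K xi))%:E =
      (4^-1 * (pnsq (z *: K + H) xi - pnsq (- z *: K + H) xi))%:E}.
    apply: ae_imply2 (fib_l2 hH) (fib_l2 hK) => xi h1 h2 _; congr EFin.
    rewrite /pinner /pnsq; case: ifPn => [/set_mem px|_]; last by rewrite p0 subr0 mulr0.
    have [l1 l2'] := (h1 px, h2 px).
    by rewrite (pl _ _ l1 l2') !fibZD (l2_q (sH.2 z _ _ l2' l1)) (l2_q (sH.2 (- z) _ _ l2' l1))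
      mulrC.
  pose B xi := 4^-1 * (pnsq (z *: K + H) xi - pnsq (- z *: K + H) xi).
  have iB' : mu.-integrable setT (EFin \o B) by exact: iB.
  have mB : measurable_fun setT (EFin \o B) by exact: measurable_int iB'.
  have mE : measurable_fun setT (EFin \o (fun xi => prt (pinner H K xi))) by exact/measurable_EFinP.
  split.
    apply/integrableP; split => //; have /integrableP[_] := iB'; apply: le_lt_trans.
    rewrite le_eqVlt; apply/orP; left; apply/eqP; apply: ae_eq_integral => //.
    - exact: measurableT_comp.
    - exact: measurableT_comp.
    - by apply: ae_imply aeE => xi h _; rewrite /= (EFin_inj (h Logic.I)).
  have IB : \int[mu]_xi B xi = \sum_(i < n) prt (L2ip (H i) (K i)).
    rewrite (RintegralZl 4^-1 measurableT (integrableB measurableT i1 i2)) (RintegralB measurableT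
      i1 i2) e1 e2 -sumrB mulr_sumr.
    by apply: eq_bigr => i _; rewrite (pL _ _ (hH i) (hK i)) mulrC.
  by rewrite -IB /Rintegral; congr fine; apply: ae_eq_integral.
have [i1 e1] : mu.-integrable setT (EFin \o (fun xi => Re (pinner H K xi))) /\
    \int[mu]_xi Re (pinner H K xi) = \sum_(i < n) Re (L2ip (H i) (K i)).
  apply: (key 1 Re) => //.
  - by move=> u v lu lv; rewrite scaleN1r scale1r ![_ + u]addrC (herm_polar_Re sH hb).
  - by move=> u v lu lv; rewrite scaleN1r scale1r ![_ + u]addrC (herm_polar_Re sL hL).
have [i2 e2] : mu.-integrable setT (EFin \o (fun xi => Im (pinner H K xi))) /\
    \int[mu]_xi Im (pinner H K xi) = \sum_(i < n) Im (L2ip (H i) (K i)).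
  apply: (key 'i Im) => //.
  - by move=> u v lu lv; rewrite scaleNr ![_ + u]addrC (herm_polar_Im sH hb).
  - by move=> u v lu lv; rewrite scaleNr ![_ + u]addrC (herm_polar_Im sL hL).
split; first by split.
apply: complexP; rewrite ?Re_cint ?Im_cint ?e1 ?e2.
  by apply/esym/(big_morph Re) => // x y; exact: ReDE.
by apply/esym/(big_morph Im) => // x y; exact: ImDE.
Qed.

End fibers.

(** * Functions with prescribed fibers *)

Section projected_fibers.
Context {R : realType} {n : nat}.
Local Notation mu := (@lebesgue_measure R).
Local Notation TR := (measurableTypeR R).
Local Notation C := (Cplx R).
Local Notation E := (int * 'I_n -> C).
Local Notation proj := Defs.proj.
Local Notation Re := (@complex.Re R).
Local Notation Im := (@complex.Im R).
Variables (theta : 'I_n -> R) (c : R).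
Local Notation per := (period c).
Local Notation fib := (fib theta).

Lemma period_measure : mu per = (2 * pi)%:E.
Proof.
rewrite /period lebesgue_measure_itv /= lte_fin ltrDl twopi_gt0 -EFinB.
by congr EFin; ring.
Qed.

Lemma expi_int (k : int) : expi (2 * k%:~R * pi) = 1 :> R[i].
Proof.
have e1 : expi (2 * pi) = 1 :> R[i].
  by rewrite mulr_natl /expi cos2pi sin2pi.
have en (m : nat) : expi (2 * m%:R * pi) = 1 :> R[i].
  elim: m => [|m ih]; first by rewrite mulr0 mul0r expi0.
  have -> : 2 * m.+1%:R * pi = 2 * m%:R * pi + 2 * pi :> R by rewrite -natr1; ring.
  by rewrite expiD ih e1 mulr1.
case: k => m; first exact: en.
by rewrite NegzE mulrNz mulrN mulNr -expiNV en invr1.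
Qed.

Lemma expi_periodic (t : R) (k l : int) : expi (k%:~R * (t + 2 * l%:~R * pi)) = expi (k%:~R * t)
  :> R[i].
Proof.
rewrite mulrDr expiD (_ : k%:~R * (2 * l%:~R * pi) = 2 * (k * l)%:~R * pi) ?expi_int ?mulr1//.
by rewrite intrM; ring.
Qed.

Lemma l2_nsqZ (z : R[i]) (a : E) : l2_nsq (z *: a) = ((sqnorm z)%:E * l2_nsq a)%E.
Proof.
rewrite /l2_nsq -esumZ ?sqnorm_ge0//; last by move=> p _; exact: sqnorm_ge0.
by apply: eq_esum => p _; rewrite -sqnormM.
Qed.

Lemma CL2nP (H : 'I_n -> R -> C) : (forall i, cmeas (H i)) ->
  (\sum_(i < n) L2nsq (H i) < +oo)%E -> CL2n H.
Proof.
move=> mH foo i; apply/CL2P; split => //; apply: le_lt_trans foo.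
by rewrite (bigD1 i)//= leeDl//; apply: sume_ge0 => j _; exact: L2nsq_ge0.
Qed.

(** Borel versions of the coordinates of the projected vector are laid out along the line.
    Projections do not increase the norm, so the total squared norm is at most 2 pi times that of
    f. *)
Lemma proj_fiber (J : R -> set E) (f : E) : (forall xi, closed_subspace l2 l2_nsq (J xi)) ->
  weakly_measurable J -> l2 f ->
  exists2 H, CL2n H & {ae mu, forall xi, per xi -> fib H xi = proj (J xi) f}.
Proof.
move=> cJ wJ lf.
have /choice[G hG] : forall p : int * 'I_n, exists G : R -> C, cmeas G /\
    {ae mu, forall xi, proj (J xi) f p = G xi}.
  move=> p; have [m1 m2] := wJ f (delta p) lf (l2_delta p).
  have [g1 mg1 e1] := borel_version m1; have [g2 mg2 e2] := borel_version m2.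
  exists (fun xi => g1 xi +i* g2 xi); split; first by split.
  apply: ae_imply2 e1 e2 => xi; rewrite l2_inner_deltar => <- <-.
  by case: (proj _ _ _).
have aeG : {ae mu, forall xi, forall p, [set: int * 'I_n] p -> proj (J xi) f p = G p xi}.
  by apply: ae_countable => [|p _]; [exact: countableP|exact: (hG p).2].
(* Inverse of the formation of fibers: on the k-th translate of the period, shifted by theta_i, H_i
   takes the values of coordinate (k, i). *)
pose H (i : 'I_n) (eta : R) : C := G (cell c (eta + theta i), i) (red c (eta + theta i)).
have mH i : cmeas (H i).
  have m k : cmeas (fun x => G (k, i) (red c x)).
    case: (hG (k, i)) => -[m1 m2] _.
    by split; [exact: (measurableT_comp m1 (measurable_red c))|exact: (measurableT_comp m2
      (measurable_red c))].
  apply: (@cmeas_translate _ (theta i) (fun x => G (cell c x, i) (red c x))); split.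
    exact: (@measurable_piecewise _ c (fun k x => Re (G (k, i) (red c x))) (fun k => (m k).1)).
  exact: (@measurable_piecewise _ c (fun k x => Im (G (k, i) (red c x))) (fun k => (m k).2)).
have fH xi : per xi -> fib H xi = G ^~ xi.
  move=> px; apply/funext => -[k i]; rewrite /fib /H /=.
  have -> : xi - theta i + 2 * k%:~R * pi + theta i = xi + 2 * k%:~R * pi by ring.
  by rewrite cell_shift red_shift (cell_period px) (red_id px) add0r.
have aeH : {ae mu, forall xi, per xi -> fib H xi = proj (J xi) f}.
  by apply: ae_imply aeG => xi h px; rewrite fH//; apply/funext => p; rewrite h.
exists H => //; apply: CL2nP => //; rewrite -(fib_nsq theta c)//.
apply: (@le_lt_trans _ _ (\int[mu]_(xi in per) l2_nsq f)%E).
  apply: ae_ge0_le_integral => //.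
  - exact: measurable_period.
  - by move=> *; exact: l2_nsq_ge0.
  - by apply: measurable_funTS; exact: (measurable_l2_nsq (fun p => cmeas_fib theta p mH)).
  - by move=> *; exact: l2_nsq_ge0.
  apply: ae_imply aeH => xi h px; rewrite h// !l2_q//; last exact: (proj_l2 (cJ xi)).
  by rewrite lee_fin; exact: (proj_q_le (cJ xi)).
rewrite -(fineK (l2_fin lf)) integral_cst; last exact: measurable_period.
by rewrite -[X in (_ * X)%E]/(mu per) period_measure -EFinM ltry.
Qed.

(** A periodic multiplier acts on whole fibers by a scalar. The new fibers lie in J on one period,
    hence almost everywhere because J and fibers shift alike, and surjectivity of the Fourier
    transform yields F. *)
Lemma range_test (V : set ('I_n -> R -> C)) (J : R -> set E) (H : 'I_n -> R -> C) (m : R ->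
  C) (f : E) :
  range_function theta V J -> l2 f -> CL2n H -> {ae mu, forall xi, per xi ->
    fib H xi = proj (J xi) f} ->
  cmeas m -> (forall x, sqnorm (m x) <= 1) -> (forall x (k : int), m (x + 2 * k%:~R * pi) = m x) ->
  exists F H', [/\ V F, CL2n H', forall i, CLfun 2%:E (F i) /\ is_fourier (F i) (H' i) &
    forall xi, fib H' xi = m xi *: fib H xi].
Proof.
move=> [cJ wJ shJ VE] lf hH aeH mm m1 mper.
pose H' i eta : C := m (eta + theta i) * H i eta.
have mH := CL2n_cmeas hH.
have fH' xi : fib H' xi = m xi *: fib H xi.
  apply/funext => -[k i]; rewrite /fib /H' /= -[RHS]/(m xi * H i (xi - theta i + 2 * k%:~R * pi)).
  have -> : xi - theta i + 2 * k%:~R * pi + theta i = xi + 2 * k%:~R * pi by ring.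
  by rewrite mper.
have mH' i : cmeas (H' i) by apply: cmeasM => //; exact: cmeas_translate.
have hH' : CL2n H'.
  apply: CL2nP => //; rewrite -(fib_nsq theta c)//.
  apply: (@le_lt_trans _ _ (\int[mu]_(xi in per) l2_nsq (fib H xi))%E); last first.
    by rewrite fib_nsq// sum_L2nsq// ltry.
  apply: ge0_le_integral => //.
  - exact: measurable_period.
  - by move=> *; exact: l2_nsq_ge0.
  - by apply: measurable_funTS; exact: (measurable_l2_nsq (fun p => cmeas_fib theta p mH')).
  - by apply: measurable_funTS; exact: (measurable_l2_nsq (fun p => cmeas_fib theta p mH)).
  - by move=> xi _; rewrite fH' l2_nsqZ -[leRHS]mul1e lee_wpmul2r ?l2_nsq_ge0// lee_fin.
have /choice[F hF] : forall i, exists f, CLfun 2%:E f /\ is_fourier f (H' i).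
  by move=> i; have [g gL gF] := fourier_surj (hH' i); exists g.
exists F, H'; split => //; rewrite VE; split; first by move=> i; exact: (hF i).1.
have aeF : {ae mu, forall xi, forall p, [set: int * 'I_n] p -> Tper theta F xi p = fib H' xi p}.
  apply: ae_countable => [|p _]; first exact: countableP.
  have := ae_translate (- theta p.2 + 2 * p.1%:~R * pi) (fourier_ae_eq (hF p.2).1 (hF p.2).2).
  by apply: ae_imply => xi; rewrite /Tper /fib addrA.
have aeJ : {ae mu, forall xi, J xi (fib H' xi)}.
  apply: (@ae_periodic R c) => [xi k Jxi|].
    by rewrite shJ fib_shift; exists (fib H' xi).
  apply: ae_imply aeH => xi h px; rewrite fH' h//.
  by apply: (subspaceZ (closed_subspaceP (cJ xi))); exact: (proj_in (cJ xi)).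
apply: ae_imply2 aeF aeJ => xi h; suff -> : Tper theta F xi = fib H' xi by [].
by apply/funext => p; exact: h.
Qed.

End projected_fibers.

(** * The frame identity on fibers *)

Section frame_coefficients.
Context {R : realType} {n : nat}.
Local Notation mu := (@lebesgue_measure R).
Local Notation TR := (measurableTypeR R).
Local Notation C := (Cplx R).
Local Notation E := (int * 'I_n -> C).
Local Notation proj := Defs.proj.
Local Notation Re := (@complex.Re R).
Local Notation Im := (@complex.Im R).
Variables (theta : 'I_n -> R) (c : R).
Local Notation per := (period c).
Local Notation fib := (fib theta).
Local Notation Tper := (Tper theta).
Implicit Types (f : E) (phi : 'I_n -> R -> C) (A : set TR).

Lemma cint_ae_eq (u v : R -> C) : cmeas u -> cmeas v -> {ae mu, forall x, u x = v x} ->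
  cint u = cint v.
Proof.
move=> [u1 u2] [v1 v2] uv; rewrite /cint; congr Complex; rewrite /Rintegral; congr fine;
  apply: ae_eq_integral => //; try exact/measurable_EFinP.
- by apply: ae_imply uv => x -> _.
- by apply: ae_imply uv => x -> _.
Qed.

Lemma cmeas_if A (u : R -> C) : measurable A -> cmeas u ->
  cmeas (fun x => if x \in A then u x else 0).
Proof.
move=> mA [u1 u2]; split.
  have -> : Re \o (fun x => if x \in A then u x else 0) = (fun x => if x \in A then Re (u x) else
    0).
    by apply/funext => x /=; case: ifP.
  exact: measurable_if_mem.
have -> : Im \o (fun x => if x \in A then u x else 0) = (fun x => if x \in A then Im (u x) else 0).
  by apply/funext => x /=; case: ifP.
exact: measurable_if_mem.
Qed.

(** The scalar z_i = e^{-i theta_i} and the factor e^{-i eta} of the unit shift combine to e^{-i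
    (eta + theta_i)}. On fibers, taken at xi - theta_i, this becomes e^{-i xi} for every coordinate,
    which is the point of the shift by theta_i. *)
Lemma translz_fourier phi (k : int) : CL2n phi -> forall i, CLfun 2%:E (translz theta k phi i) /\
  is_fourier (translz theta k phi i) (fun eta => expi (- (k%:~R * (eta + theta i))) * fourier (phi
    i) eta).
Proof.
move=> hphi i.
have step (g G : R -> C) (z : R[i]) b : CLfun 2%:E g -> is_fourier g G ->
    CLfun 2%:E (fun x => z * g (x + b) : C) /\
    is_fourier (fun x => z * g (x + b) : C) (fun eta => z * (expi (b * eta) * G eta)).
  move=> gL gF; have tL := CL2_translate b gL; have tF := is_fourier_translate b gL gF.
  split; first exact: (subspaceZ CL2_subspace z tL).
  (* Writing z g as (z - 1) g + g brings the scaling into the form of [is_fourierZD]. *)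
  have := is_fourierZD (z - 1) tL tL tF tF.
  have -> : (z - 1) *: (fun x => g (x + b)) + (fun x => g (x + b)) = (fun x => z * g (x + b) : C).
    by apply/funext => x; rewrite -[LHS]/((z - 1) * g (x + b) + g (x + b)); ring.
  have -> // : (z - 1) *: (fun xi => expi (b * xi) * G xi : C) + (fun xi => expi (b * xi) * G xi) =
      (fun xi => z * (expi (b * xi) * G xi) : C).
  by apply/funext => x; rewrite -[LHS]/((z - 1) * (expi (b * x) * G x) + expi (b * x) * G x); ring.
have base : CLfun 2%:E (phi i) /\ is_fourier (phi i) (fourier (phi i)).
  by split; [exact: hphi|exact: fourierP].
case: k => m /=.
  elim: m => [|m [ihL ihF]].
    by split; [exact: hphi|under eq_fun do rewrite mul0r oppr0 expi0 mul1r; exact: base.2].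
  have [sL sF] := step _ _ (zpt theta i) (-1) ihL ihF; split; first exact: sL.
  have -> // : (fun eta => expi (- (m.+1%:~R * (eta + theta i))) * fourier (phi i) eta : C) =
    (fun eta => zpt theta i * (expi (- 1 * eta) * (expi (- (m%:~R * (eta + theta i))) * fourier
      (phi i) eta))).
  apply/funext => eta; rewrite /zpt !mulrA -!expiD; congr (expi _ * _).
  by rewrite -!pmulrn -natr1; ring.
have -> : (fun eta => expi (- ((Negz m)%:~R * (eta + theta i))) * fourier (phi i) eta : C) =
    (fun eta => expi (m.+1%:R * (eta + theta i)) * fourier (phi i) eta).
  by apply/funext => eta; rewrite NegzE mulrNz mulNr opprK.
rewrite -[transl_inv theta _]/(iter m.+1 (transl_inv theta) phi).
elim: m.+1 => [|k [ihL ihF]].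
  by split; [exact: hphi|under eq_fun do rewrite mul0r expi0 mul1r; exact: base.2].
have [sL sF] := step _ _ (zpt theta i)^-1 1 ihL ihF; split; first exact: sL.
have -> // : (fun eta => expi (k.+1%:R * (eta + theta i)) * fourier (phi i) eta : C) =
  (fun eta => (zpt theta i)^-1 * (expi (1 * eta) * (expi (k%:R * (eta + theta i)) * fourier (phi
    i) eta))).
apply/funext => eta; rewrite /zpt expiNV opprK !mulrA -!expiD; congr (expi _ * _).
by rewrite -natr1; ring.
Qed.

Lemma fib_translz phi (k : int) xi :
  fib (fun i eta => expi (- (k%:~R * (eta + theta i))) * fourier (phi i) eta) xi =
  expi (- (k%:~R * xi)) *: Tper phi xi.
Proof.
apply/funext => -[l i]; rewrite /fib /=.
rewrite -[RHS]/(expi (- (k%:~R * xi)) * fourier (phi i) (xi - theta i + 2 * l%:~R * pi)).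
congr (_ * _); have -> : xi - theta i + 2 * l%:~R * pi + theta i = xi + 2 * l%:~R * pi by ring.
by rewrite !expiN expi_periodic.
Qed.

Definition coef f phi A (xi : R) : C := if xi \in A then l2_inner f (Tper phi xi) else 0.

Lemma CL2n_fourier phi : CL2n phi -> CL2n (fun i => fourier (phi i)).
Proof. by move=> h i; exact: (fourierP (h i)).1. Qed.

Lemma cmeas_coef_base f phi : CL2n phi -> cmeas (fun xi => l2_inner f (Tper phi xi)).
Proof.
move=> /CL2n_fourier/CL2n_cmeas mphi.
by apply: cmeas_l2_inner => p; [exact: cmeas_cst|exact: (cmeas_fib theta p mphi)].
Qed.

(** Cauchy-Schwarz bounds the square by the squared norm of f times that of the fiber of phi, which
    is integrable over a period. Integrability follows, the support having finite measure. *)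
Lemma coef_L2 f phi A : l2 f -> CL2n phi -> measurable A -> A `<=` per ->
  CLfun 1%:E (coef f phi A) /\ CLfun 2%:E (coef f phi A).
Proof.
move=> lf hphi mA Aper; have hF := CL2n_fourier hphi; have mF := CL2n_cmeas hF.
have mc := cmeas_if mA (cmeas_coef_base f hphi).
have mN := measurable_l2_nsq (fun p => cmeas_fib theta p mF).
have c2 : CLfun 2%:E (coef f phi A).
  apply/CL2P; split => //.
  apply: (@le_lt_trans _ _ (\int[mu]_(xi in per) (l2_nsq f * l2_nsq (Tper phi xi)))%E); last first.
    rewrite -(fineK (l2_fin lf)) ge0_integralZl//.
    - rewrite -[X in (_ * X)%E]/(\int[mu]_(x in per) l2_nsq (fib (fun i => fourier (phi i)) x))%E.
      by rewrite (fib_nsq theta c mF) sum_L2nsq// -EFinM ltry.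
    - exact: measurable_period.
    - exact: measurable_funTS.
    - by move=> *; exact: l2_nsq_ge0.
    - by rewrite lee_fin fine_ge0// l2_nsq_ge0.
  rewrite L2nsq_def [leRHS]integral_mkcond; apply: ae_ge0_le_integral => //.
  - by move=> x _; rewrite lee_fin sqnorm_ge0.
  - by apply/measurable_EFinP; exact: cmeas_sqnorm.
  - by move=> x _; rewrite /patch; case: ifP => // _; rewrite mule_ge0 ?l2_nsq_ge0.
  - apply: (measurable_restrictT _ _).1; first exact: measurable_period.
    rewrite -(fineK (l2_fin lf)); apply: emeasurable_funM; first exact: measurable_cst.
    exact: measurable_funTS.
  apply: ae_imply (fib_l2 theta c hF) => xi h _; rewrite /patch /coef.
  case: ifPn => [/set_mem Ax|_]; last first.
    by rewrite sqnorm0; case: ifP => // _; rewrite mule_ge0 ?l2_nsq_ge0.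
  have px := Aper _ Ax; rewrite mem_set// !l2_q//; last exact: h.
  by rewrite -EFinM lee_fin; apply: (herm_CS l2_subspace l2_hermitian) => //; exact: h.
split => //; apply/CL1P.
have bd (prt : R[i] -> R) : prt 0 = 0 -> (prt \o coef f phi A) \in Lfun mu 2%:E ->
    mu.-integrable setT (EFin \o (prt \o coef f phi A)).
  move=> p0 /Lfun2P[m1 m2].
  have -> : prt \o coef f phi A = (fun x => if x \in per then (prt \o coef f phi A) x else 0).
    apply/funext => x; case: ifPn => // xper; rewrite /= /coef memNset// => Ax.
    by move: xper; rewrite mem_set//; exact: Aper.
  apply: L2_bounded_support_integrable => //; first exact: measurable_period.
  by rewrite -[X in (X < _)%E]/(mu per) period_measure ltry.
by split; apply: bd => //; case: c2.
Qed.

Lemma test_function (V : set ('I_n -> R -> C)) (J : R -> set E) H f A (s : R) :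
  range_function theta V J -> l2 f -> CL2n H -> {ae mu, forall xi, per xi ->
    fib H xi = proj (J xi) f} ->
  measurable A -> A `<=` per ->
  exists F, [/\ V F, ((2 * pi)%:E * L2n_nsq F = \int[mu]_(xi in A) l2_nsq (fib H xi))%E &
    forall phi (k : int), V phi ->
      (2 * pi)%:C * L2n_inner F (translz theta k phi) = fourier1 (coef f phi A) (s - k%:~R)].
Proof.
move=> rf lf hH aeH mA Aper; have [cJ _ _ VE] := rf.
(* A multiplier must be periodic, and e^{-i s xi} is not for general s; [red] takes its values on
   one period and repeats them. *)
pose m xi : C := if red c xi \in A then expi (- s * red c xi) else 0.
have mm : cmeas m.
  have [m1 m2] := cmeas_if mA (cmeas_expi (- s)).
  by split; [exact: (measurableT_comp m1 (measurable_red c))|exact: (measurableT_comp m2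
    (measurable_red c))].
have m1 x : sqnorm (m x) <= 1 by rewrite /m; case: ifP => _; rewrite ?sqnorm_expi ?sqnorm0.
have mper x (k : int) : m (x + 2 * k%:~R * pi) = m x by rewrite /m red_shift.
have [F [H' [VF hH' hF fH']]] := range_test rf lf hH aeH mm m1 mper.
exists F; split => //.
  have hFL : CL2n F by move=> i; exact: (hF i).1.
  rewrite /L2n_nsq sum_L2nsq// -EFinM mulr_sumr.
  under eq_bigr => i _ do rewrite -(is_fourier_q (hF i).1 (hF i).2).
  rewrite -sum_L2nsq// -(fib_nsq theta c (CL2n_cmeas hH')).
  rewrite [LHS]integral_mkcond [RHS]integral_mkcond; apply: eq_integral => xi _; rewrite /patch.
  case: ifPn => [/set_mem px|px]; last first.
    by rewrite memNset// => /Aper/mem_set; apply/negP.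
  rewrite fH' l2_nsqZ /m (red_id px); case: ifP => _; first by rewrite sqnorm_expi mul1e.
  by rewrite sqnorm0 mul0e.
move=> phi k Vphi; have [Lphi Jphi] : L2n phi /\ {ae mu, forall xi,
  J xi (Tper phi xi)} by move: Vphi; rewrite VE.
have hphi : CL2n phi by [].
have tr := translz_fourier k hphi.
pose K i eta : C := expi (- (k%:~R * (eta + theta i))) * fourier (phi i) eta.
have hK : CL2n K by move=> i; case: (tr i).2.
have -> : (2 * pi)%:C * L2n_inner F (translz theta k phi) = \sum_(i < n) L2ip (H' i) (K i).
  rewrite /L2n_inner mulr_sumr; apply: eq_bigr => i _; rewrite -L2ipE.
  by rewrite (is_fourier_ip (hF i).1 (tr i).1 (hF i).2 (tr i).2).
have [iP <-] := pinner_int theta c hH' hK; rewrite fourier1E.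
apply: cint_ae_eq.
- exact: cintegrable_cmeas.
- apply: cmeasM; first exact: (cmeas_if mA (cmeas_coef_base f hphi)).
  by under eq_fun do rewrite -mulNr; exact: cmeas_expi.
have fK xi : fib K xi = expi (- (k%:~R * xi)) *: Tper phi xi by exact: fib_translz.
have aeJ := ae_imply2 (fun x (h1 : per x -> fib H x = proj (J x) f) h2 => conj h1 h2) aeH Jphi.
apply: ae_imply aeJ => xi [h1 h2].
rewrite /pinner /coef; case: ifPn => [/set_mem px|px]; last first.
  by rewrite memNset ?mul0r// => /Aper/mem_set; apply/negP.
have lT := closed_subspace_l2 (cJ xi) h2; have lP := proj_l2 (cJ xi) lf.
have sH := @l2_subspace R n; have hb := @l2_hermitian R n.
rewrite fH' fK h1// (hermZl sH hb _ lP (subspaceZ sH _ lT)) (hermZr sH hb _ lT lP) (projE (cJ xi)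
  lf h2).
rewrite /m (red_id px); case: ifP => _; last by rewrite !mul0r.
rewrite [X in _ * (X * _)](_ : _ = expi (k%:~R * xi)); last first.
  by apply: complexP; rewrite !ReImE /= ?cosN ?sinN ?opprK.
rewrite mulrA -expiD mulrC; congr (_ * expi _); ring.
Qed.

Lemma frame_sum (V Phi : set ('I_n -> R -> C)) (J : R -> set E) H f A (s : R) :
  range_function theta V J -> NTF_generator theta V Phi ->
  l2 f -> CL2n H -> {ae mu, forall xi, per xi -> fib H xi = proj (J xi) f} ->
  measurable A -> A `<=` per ->
  (\esum_(p in [set p : int * ('I_n -> R -> C) | Phi p.2])
     (sqnorm (fourier1 (coef f p.2 A) (s - p.1%:~R)))%:E =
   (2 * pi)%:E * \int[mu]_(xi in A) l2_nsq (fib H xi))%E.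
Proof.
move=> rf [PV frame] lf hH aeH mA Aper.
have [F [VF <- cF]] := test_function s rf lf hH aeH mA Aper.
rewrite -(frame F VF) muleA -EFinM -esumZ; last 2 first.
- by rewrite mulr_ge0// ltW// twopi_gt0.
- by move=> p _; exact: sqnorm_ge0.
apply: eq_esum => -[k phi] /= Pphi; rewrite -(cF phi k (PV _ Pphi)) sqnormM sqnorm_real expr2.
by rewrite EFinM.
Qed.

End frame_coefficients.

(** * The frame identity at almost every point *)

Section frame_identity.
Context {R : realType} {n : nat}.
Local Notation mu := (@lebesgue_measure R).
Local Notation TR := (measurableTypeR R).
Local Notation C := (Cplx R).
Local Notation E := (int * 'I_n -> C).
Local Notation proj := Defs.proj.
Local Notation Re := (@complex.Re R).
Local Notation Im := (@complex.Im R).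
Local Notation q f := (Re (L2ip f f)).
Local Notation L2fun := ('I_n -> R -> C).
Variable theta : 'I_n -> R.
Local Notation fib := (fib theta).
Local Notation Tper := (Tper theta).
Local Notation coef := (coef theta).
Local Opaque L2ip fourier1 L2nsq cint.

Lemma fourier1_seq_continuous (u : R -> C) (t_ : nat -> R) (t : R) : cintegrable u ->
  t_ m @[m --> \oo] --> t ->
  Re (fourier1 u (t_ m)) @[m --> \oo] --> Re (fourier1 u t) /\
  Im (fourier1 u (t_ m)) @[m --> \oo] --> Im (fourier1 u t).
Proof.
move=> iu ct; have [i1 i2] := iu.
have [m1 m2] := cintegrable_cmeas iu.
have key (w g : R -> R) : measurable_fun setT w -> mu.-integrable setT (EFin \o w) ->
    (forall s : R, measurable_fun setT (fun x : TR => g (s * x))) -> (forall y, `|g y| <= 1) ->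
      continuous g ->
    \int[mu]_x (w x * g (t_ m * x)) @[m --> \oo] --> \int[mu]_x (w x * g (t * x)).
  move=> mw iw mg g1 cg; apply: (@Rintegral_dct _ setT _ _ (fun x => `|w x|)) => //.
  - move=> m; exact: (measurable_funM mw (mg (t_ m))).
  - exact: (measurable_funM mw (mg t)).
  - move=> x _; apply: cvgMl_tmp; apply: (continuous_cvg _ (cg _)).
    exact: cvgMr_tmp.
  - exact: (integrable_abse iw).
  - by move=> m x _; rewrite normrM ler_piMr.
have kc (w : R -> R) (h1 : measurable_fun setT w) (h2 : mu.-integrable setT (EFin \o w)) :
    cosT w (t_ m) @[m --> \oo] --> cosT w t.
  apply: key => //; [by move=> s; exact: measurable_cosM|exact: cos_abs_le1|exact: continuous_cos].
have ks (w : R -> R) (h1 : measurable_fun setT w) (h2 : mu.-integrable setT (EFin \o w)) :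
    sinT w (t_ m) @[m --> \oo] --> sinT w t.
  apply: key => //; [by move=> s; exact: measurable_sinM|exact: sin_abs_le1|exact: continuous_sin].
split.
  under eq_fun do rewrite fourier1_Re//; rewrite fourier1_Re//.
  by apply: cvgD; [exact: kc|exact: ks].
under eq_fun do rewrite fourier1_Im//; rewrite fourier1_Im//.
by apply: cvgB; [exact: kc|exact: ks].
Qed.

(** By continuity it is enough to test rational points, which keeps the index set of
    [countable_nonnull] countable. *)
Lemma fourier1_rat_eq0 (u : R -> C) : cintegrable u ->
  (forall r : rat, fourier1 u (ratr r) = 0) -> forall t, fourier1 u t = 0.
Proof.
move=> iu u0 t.
have /choice[r hr] : forall m : nat, exists r : rat, t < ratr r < t + m.+1%:R^-1.
  by move=> m; have [|r] := @rat_in_itvoo R t (t + m.+1%:R^-1);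
    [rewrite ltrDl invr_gt0|rewrite in_itv; exists r].
have ct : (ratr (r m) : R) @[m --> \oo] --> t.
  apply: (@squeeze_cvgr _ _ _ _ (cst t) (fun m => t + m.+1%:R^-1)).
  - by apply: nearW => m; have /andP[h1 h2] := hr m; rewrite /= !ltW.
  - exact: cvg_cst.
  - by rewrite -[X in _ --> X]addr0; apply: cvgD; [exact: cvg_cst|exact: cvg_harmonic].
have [c1 c2] := fourier1_seq_continuous iu ct.
have z (prt : R[i] -> R) : prt 0 = 0 -> prt (fourier1 u (ratr (r m))) @[m --> \oo] --> prt
  (fourier1 u t) ->
    prt (fourier1 u t) = 0.
  move=> p0 h; have e : (fun m => prt (fourier1 u (ratr (r m)))) = fun=> 0.
    by apply/funext => m; rewrite u0 p0.
  rewrite e in h; apply: (cvg_unique (@Rhausdorff R) h); exact: cvg_cst.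
by apply: complexP; apply: z.
Qed.

(* [Phi] may be uncountable, because almost everywhere equal functions count separately; but its
   null members all have the same [fourier], by [fourier_congr]. *)
Definition null_family (phi : L2fun) := forall i, q (phi i) = 0.

Lemma L2nsq_coef c (f : E) (phi : L2fun) A : A `<=` period c ->
  (L2nsq (coef f phi A) = \int[mu]_(xi in A) (sqnorm (l2_inner f (Tper phi xi)))%:E)%E.
Proof.
move=> Aper; rewrite L2nsq_def [RHS]integral_mkcond; apply: eq_integral => x _.
by rewrite /coef /patch; case: ifP => // _; rewrite sqnorm0.
Qed.

(** For f a coordinate vector and s rational, the frame coefficients are square-summable, so only
    countably many phi have a nonzero one. If all of them vanish for phi, then so do the transforms
    of the coordinates of its fiber, and by Plancherel phi is null. *)
Lemma countable_nonnull (V Phi : set L2fun) (J : R -> set E) :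
  range_function theta V J -> NTF_generator theta V Phi ->
  countable (Phi `&` [set phi | ~ null_family phi]).
Proof.
move=> rf fr; have [cJ wJ _ VE] := rf; have [PV _] := fr; pose c : R := 0.
pose S (ps : (int * 'I_n) * rat) : set L2fun := snd @` ([set p : int * L2fun | Phi p.2] `&`
   [set p | sqnorm (fourier1 (coef (delta ps.1) p.2 (period c)) (ratr ps.2 - p.1%:~R)) != 0]).
have cS : countable (\bigcup_ps S ps).
  apply: bigcup_countable; first exact: countableP.
  move=> [p s] _; apply: (sub_countable (card_image_le _ _)); apply: countable_support => [k _|];
    first exact: sqnorm_ge0.
  have [H hH aeH] := proj_fiber theta c cJ wJ (l2_delta p).
  rewrite (frame_sum (ratr s) rf fr (l2_delta p) hH aeH (measurable_period c) (@subset_refl _ _)).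
  by rewrite fib_nsq ?sum_L2nsq//; [rewrite -EFinM ltry|exact: CL2n_cmeas].
apply: sub_countable cS; apply: subset_card_le => phi [Pphi nphi].
apply: contrapT => nS; apply: nphi.
have hphi : CL2n phi by have := PV _ Pphi; rewrite VE => -[].
have hF := CL2n_fourier hphi.
have z p : (\int[mu]_(xi in period c) (sqnorm (fib (fun i => fourier (phi i)) xi p))%:E = 0)%E.
  have [c1 c2] := coef_L2 theta (l2_delta p) hphi (measurable_period c) (@subset_refl _ _).
  have f0 : forall t, fourier1 (coef (delta p) phi (period c)) t = 0.
    apply: fourier1_rat_eq0; first exact/CL1P.
    move=> r; apply: sqnorm_eq0; apply: contrapT => /eqP h; apply: nS.
    (* The translate k = 0 alone reaches every rational point. *)
    by exists (p, r) => //; exists (0, phi) => //; split => //=; rewrite subr0.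
  have [_] := plancherel_complex c1 c2.
  have -> : fourier1 (coef (delta p) phi (period c)) = 0 by apply/funext.
  have -> : L2nsq (0 : R -> C) = 0%E by rewrite L2nsq_def integral0_eq// => x _; rewrite sqnorm0.
  move/esym/eqP; rewrite mule_eq0 eqe gt_eqF ?twopi_gt0//= (L2nsq_coef _ _ (@subset_refl _ (period
    c))) => /eqP e.
  rewrite -[RHS]e; apply: eq_integral => x _; congr EFin; rewrite /l2_inner (csum_delta (p := p))//.
    by rewrite /delta eqxx mul1r sqnormC.
  by move=> i ip; rewrite /delta (negbTE ip) mul0r.
have := fib_nsq theta c (CL2n_cmeas hF); rewrite /l2_nsq integral_esum; last 4 first.
- exact: countableP.
- exact: measurable_period.
- by move=> p x _; rewrite lee_fin sqnorm_ge0.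
- move=> p _; apply/measurable_EFinP; apply: measurable_funTS.
  exact: (cmeas_sqnorm (cmeas_fib theta p (CL2n_cmeas hF))).
have q0 i : 0 <= q (fourier (phi i)) by rewrite (herm_q_ge0 L2_hermitian).
rewrite esum1// sum_L2nsq// => e; have /esym/eqP := EFin_inj e; rewrite psumr_eq0// => /allP h i.
have := h i (mem_index_enum i); rewrite implyTb => /eqP.
rewrite (is_fourier_q (hphi i) (fourierP (hphi i))) => /eqP.
by rewrite mulf_eq0 gt_eqF ?twopi_gt0//= => /eqP.
Qed.

(** The equality holds at every xi, because [fourier] depends only on the almost everywhere class.
    Hence the null set attached to the zero function serves all null members of Phi at once. *)
Lemma Tper_null (phi : L2fun) : CL2n phi -> null_family phi -> Tper phi = Tper (0 : L2fun).
Proof.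
move=> hphi nphi; apply/funext => xi; apply/funext => p; rewrite /Defs.Tper; congr (_ _).
have z : CLfun 2%:E (0 : R -> C) := CL2_subspace.1.
by apply: (fourier_congr (hphi p.2) z); rewrite subr0.
Qed.

Lemma Tper0_ae : {ae mu, forall xi, Tper (0 : L2fun) xi = 0}.
Proof.
have z : CLfun 2%:E (0 : R -> C) := CL2_subspace.1.
have a0 : {ae mu, forall x, fourier (0 : R -> C) x = 0}.
  apply: L2_q_eq0_ae; first exact: (fourierP z).1.
  by rewrite (is_fourier_q z (fourierP z)) (herm0l CL2_subspace L2_hermitian z) /= mulr0.
have : {ae mu, forall xi, forall p, [set: int * 'I_n] p -> Tper (0 : L2fun) xi p = 0}.
  apply: ae_countable => [|p _]; first exact: countableP.
  have := ae_translate (- theta p.2 + 2 * p.1%:~R * pi) a0.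
  by apply: ae_imply => xi; rewrite /Tper addrA.
by apply: ae_imply => xi h; apply/funext => p; exact: h.
Qed.

Lemma frame_fibers (V Phi : set L2fun) (J : R -> set E) :
  range_function theta V J -> NTF_generator theta V Phi ->
  {ae mu, forall xi, forall phi, Phi phi -> J xi (Tper phi xi)}.
Proof.
move=> rf fr; have [cJ _ _ VE] := rf; have [PV _] := fr.
have c1 := countable_nonnull rf fr.
have a1 : {ae mu, forall xi, forall phi, (Phi `&` [set phi | ~ null_family phi]) phi ->
  J xi (Tper phi xi)}.
  by apply: ae_countable => // phi [/PV]; rewrite VE => -[].
apply: ae_imply2 a1 Tper0_ae => xi h h0 phi Pphi.
have [nphi|nphi] := pselect (null_family phi); last exact: h.
have hphi : CL2n phi by have := PV _ Pphi; rewrite VE => -[].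
by rewrite (Tper_null hphi nphi) h0; exact: (closed_subspaceP (cJ xi)).1.
Qed.

Lemma frame_identity_integral c (V Phi : set L2fun) (J : R -> set E) H f (A : set TR) :
  range_function theta V J -> NTF_generator theta V Phi -> l2 f -> CL2n H ->
  {ae mu, forall xi, period c xi -> fib H xi = proj (J xi) f} ->
  measurable A -> A `<=` period c ->
  (\int[mu]_(xi in A) l2_nsq (fib H xi) =
   \int[mu]_(xi in A) \esum_(phi in Phi `&` [set phi | ~ null_family phi])
     (sqnorm (l2_inner f (Tper phi xi)))%:E)%E.
Proof.
move=> rf fr lf hH aeH mA Aper; have [cJ _ _ VE] := rf; have [PV _] := fr.
have cP := countable_nonnull rf fr; set Phi1 := Phi `&` _ in cP *.
have hphi phi : Phi phi -> CL2n phi by move=> /PV; rewrite VE => -[].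
have p0 := @twopi_gt0 R; have piN0 : pi != 0 :> R by rewrite gt_eqF// pi_gt0.
have alg (x k : R) : - (2 * pi)^-1 * (x + 2 * k * pi) = - (2 * pi)^-1 * x - k.
  by move: piN0; generalize (pi : R) => p h; field.
have alg2 (x : R) : (2 * pi) ^- 2 * (2 * pi * x * (2 * pi)) = x.
  by move: piN0; generalize (pi : R) => p h; field.
have cL phi : Phi phi -> CLfun 1%:E (coef f phi A) /\ CLfun 2%:E (coef f phi A).
  by move=> /hphi h; exact: (coef_L2 theta lf h mA Aper).
(* With [s = - x / (2 * pi)], summing over [k] in [s - k] tiles the line by periods of [x]. *)
pose g phi (x : R) := sqnorm (fourier1 (coef f phi A) ((- (2 * pi)^-1) * x)).
have mF phi : Phi phi -> cmeas (fourier1 (coef f phi A)).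
  by move=> Pphi; apply: cmeas_fourier1; apply/CL1P; exact: (cL phi Pphi).1.
have mg phi : Phi phi -> measurable_fun setT (g phi : TR -> R).
  move=> Pphi; apply: (measurableT_comp (cmeas_sqnorm (mF _ Pphi))).
  by apply: measurable_funM => //; exact: measurable_cst.
have sumE x : (\esum_(phi in Phi1) \esum_(k in [set: int]) (g phi (x + 2 * k%:~R * pi))%:E =
   (2 * pi)%:E * \int[mu]_(xi in A) l2_nsq (fib H xi))%E.
  rewrite -(frame_sum (- (2 * pi)^-1 * x) rf fr lf hH aeH mA Aper).
  have gE k phi : g phi (x + 2 * k%:~R * pi) =
      sqnorm (fourier1 (coef f phi A) (- (2 * pi)^-1 * x - k%:~R)).
    by rewrite /g; rewrite alg.
  (* Null members contribute 0, their fibers being 0 almost everywhere; the sum that remains is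
     countable and can be integrated term by term. *)
  transitivity (\esum_(phi in Phi) \esum_(k in [set: int]) (g phi (x + 2 * k%:~R * pi))%:E)%E.
    rewrite [RHS](esumID [set phi | ~ null_family phi]); last first.
      by move=> phi _; apply: esum_ge0 => k _; rewrite lee_fin sqnorm_ge0.
    rewrite [X in (_ = _ + X)%E]esum1 ?adde0// => phi [Pphi /contrapT nphi].
    rewrite esum1// => k _; rewrite gE.
    suff -> : fourier1 (coef f phi A) (- (2 * pi)^-1 * x - k%:~R) = 0 by rewrite sqnorm0.
    rewrite fourier1E -[RHS]cint0; apply: cint_ae_eq.
    - apply: cmeasM; first by have /CL1P/cintegrable_cmeas := (cL phi Pphi).1.
      by under eq_fun do rewrite -mulNr; exact: cmeas_expi.
    - exact: cmeas_cst.
    - apply: ae_imply Tper0_ae => xi h; rewrite /coef (Tper_null (hphi _ Pphi) nphi) h.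
      case: ifP => _; rewrite ?mul0r//.
      have := hermC l2_hermitian l2_zero lf; rewrite (herm0l l2_subspace l2_hermitian lf) rmorph0
        => ->.
      by rewrite mul0r.
  rewrite (@esum_esum R _ _ Phi (fun=> setT) (fun phi k => (g phi (x + 2 * k%:~R * pi))%:E));
    last first.
    by move=> *; rewrite lee_fin sqnorm_ge0.
  rewrite (reindex_esum [set p : int * L2fun | Phi p.2] _ (fun p => (p.2, p.1))); last first.
    split=> [[k phi] //= Pphi|[k phi] [k' phi'] _ _ [-> ->] //|[phi k] [/= Pphi _]].
    by exists (k, phi).
  by apply: eq_esum => -[k phi] _; rewrite gE.
(* On the right, tiling joins the sum over k and the period into the line; rescaling x contributes
   one factor 2 pi and Plancherel another. *)
have L : (\int[mu]_(x in period 0) ((2 * pi)%:E * \int[mu]_(xi in A) l2_nsq (fib H xi)) =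
    \esum_(phi in Phi1) ((2 * pi) ^+ 2)%:E * L2nsq (coef f phi A))%E.
  transitivity (\int[mu]_(x in period 0) \esum_(phi in Phi1) \esum_(k in [set: int])
      (g phi (x + 2 * k%:~R * pi)%R)%:E)%E; first by apply: eq_integral => x _; rewrite sumE.
  have mgk phi k : Phi phi -> measurable_fun setT (fun x : TR => (g phi (x + 2 * k%:~R * pi))%:E).
    move=> Pphi; apply/measurable_EFinP; apply: (measurableT_comp (mg _ Pphi)).
    by apply: measurable_funD => //; exact: measurable_cst.
  rewrite integral_esum//; last 3 first.
  - exact: measurable_period.
  - by move=> phi x _; apply: esum_ge0 => k _; rewrite lee_fin sqnorm_ge0.
  - move=> phi [Pphi _]; apply: measurable_esum => [|k x _|k _]; first exact: countableP.
      by rewrite lee_fin sqnorm_ge0.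
    by apply: measurable_funTS; exact: mgk.
  apply: eq_esum => phi [Pphi _].
  rewrite integral_esum//; last 4 first.
  - exact: countableP.
  - exact: measurable_period.
  - by move=> k x _; rewrite lee_fin sqnorm_ge0.
  - by move=> k _; apply: measurable_funTS; exact: mgk.
  rewrite -(@tiling _ 0 (fun x => (g phi x)%:E)); last 2 first.
  - by apply/measurable_EFinP; exact: mg.
  - by move=> x; rewrite lee_fin sqnorm_ge0.
  have mF2 := cmeas_sqnorm (mF _ Pphi).
  have mFR : measurable_fun setT (fun x : R => (sqnorm (fourier1 (coef f phi A) (- x)))%:E).
    by apply/measurable_EFinP; exact: (measurableT_comp mF2).
  have F0 (x : R) : (0 <= (sqnorm (fourier1 (coef f phi A) (- x)))%:E)%E by rewrite lee_fin
    sqnorm_ge0.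
  have p1 : 0 < (2 * pi)^-1 :> R by rewrite invr_gt0.
  have := @ge0_integral_affine _ (2 * pi)^-1 0 _ p1 mFR F0.
  rewrite (@ge0_integral_reflect _ (fun x => (sqnorm (fourier1 (coef f phi A) x))%:E));
    last 2 first.
  - exact/measurable_EFinP.
  - by move=> x; rewrite lee_fin sqnorm_ge0.
  rewrite invrK -(L2nsq_def (fourier1 (coef f phi A))) (plancherel_complex (cL _ Pphi).1 (cL _
    Pphi).2).2 muleA -EFinM -expr2 => <-.
  by apply: eq_integral => x _; rewrite /g addr0 mulNr.
have HL : CL2n H -> (\int[mu]_(xi in A) l2_nsq (fib H xi))%E \is a fin_num.
  move=> _; rewrite ge0_fin_numE; last by apply: integral_ge0 => x _; exact: l2_nsq_ge0.
  apply: (@le_lt_trans _ _ (\int[mu]_(xi in period c) l2_nsq (fib H xi))%E).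
    apply: ge0_subset_integral => //; first exact: measurable_period.
      by apply: measurable_funTS; exact: (measurable_l2_nsq (fun p => cmeas_fib theta p
        (CL2n_cmeas hH))).
    by move=> x _; exact: l2_nsq_ge0.
  by rewrite fib_nsq ?sum_L2nsq//; [rewrite ltry|exact: CL2n_cmeas].
have Kf := HL hH; set K := (\int[mu]_(xi in A) l2_nsq (fib H xi))%E in Kf L sumE *.
move: L; rewrite -(fineK Kf) -EFinM integral_cst; last exact: measurable_period.
rewrite -[X in (_ * X)%E]/(mu (period 0)) period_measure -EFinM.
have qL phi : Phi1 phi -> L2nsq (coef f phi A) = (q (coef f phi A))%:E.
  by move=> [Pphi _]; rewrite L2nsq_q//; exact: (cL _ Pphi).2.
rewrite (eq_esum (b := fun phi => ((2 * pi) ^+ 2 * q (coef f phi A))%:E)); last first.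
  by move=> phi h; rewrite qL.
rewrite esumZ ?sqr_ge0//; last by move=> phi [Pphi _]; apply: (herm_q_ge0 L2_hermitian);
  exact: (cL _ Pphi).2.
move=> L; have := congr1 (fun x => ((2 * pi) ^- 2)%:E * x)%E L.
rewrite muleA -!EFinM mulVf ?mul1e; last by rewrite expf_neq0// gt_eqF.
have -> : (2 * pi) ^- 2 * (2 * pi * fine K * (2 * pi)) = fine K :> R by rewrite alg2.
move=> ->; rewrite integral_esum//.
- by apply: eq_esum => phi h; rewrite -qL// (L2nsq_coef _ _ Aper).
- by move=> phi x _; rewrite lee_fin sqnorm_ge0.
- move=> phi [Pphi _]; apply/measurable_EFinP; apply: measurable_funTS.
  exact: cmeas_sqnorm (cmeas_coef_base theta f (hphi _ Pphi)).
Qed.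

Lemma frame_identity (V Phi : set L2fun) (J : R -> set E) f :
  range_function theta V J -> NTF_generator theta V Phi -> l2 f ->
  {ae mu, forall xi, l2_nsq (proj (J xi) f) =
    (\esum_(phi in Phi) (sqnorm (l2_inner f (Tper phi xi)))%:E)%E}.
Proof.
move=> rf fr lf; have [cJ wJ _ VE] := rf; have [PV _] := fr.
have hphi phi : Phi phi -> CL2n phi by move=> /PV; rewrite VE => -[].
have cP := countable_nonnull rf fr.
(* Fibers of the projection are prescribed on one period at a time; the periods starting at 2 pi l
   cover the line. *)
have step (l : int) : {ae mu, forall xi, period (2 * l%:~R * pi) xi -> l2_nsq (proj (J xi) f) =
    (\esum_(phi in Phi) (sqnorm (l2_inner f (Tper phi xi)))%:E)%E}.
  set c := 2 * l%:~R * pi; have [H hH aeH] := proj_fiber theta c cJ wJ lf.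
  have mN := measurable_l2_nsq (fun p => cmeas_fib theta p (CL2n_cmeas hH)).
  have iN : mu.-integrable (period c) (fun xi => l2_nsq (fib H xi)).
    apply/integrableP; split; first exact: measurable_funTS.
    under eq_integral do rewrite gee0_abs ?l2_nsq_ge0//.
    by rewrite fib_nsq ?sum_L2nsq ?ltry//; exact: CL2n_cmeas.
  have mS : measurable_fun (period c) (fun xi => \esum_(phi in Phi `&` [set phi | ~ null_family
    phi])
     (sqnorm (l2_inner f (Tper phi xi)))%:E)%E.
    apply: measurable_esum => // [phi x _|phi [Pphi _]]; first by rewrite lee_fin sqnorm_ge0.
    apply/measurable_EFinP; apply: measurable_funTS.
    exact: cmeas_sqnorm (cmeas_coef_base theta f (hphi _ Pphi)).
  have := integral_ae_eq (measurable_period c) iN mS (fun A Ac mA =>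
     frame_identity_integral rf fr lf hH aeH mA Ac).
  move=> ae1; have ae2 := ae_imply2 (fun x h1 h2 => conj h1 h2) ae1 aeH.
  apply: ae_imply2 ae2 Tper0_ae => xi [h1 h2] h0 px; rewrite -h2// h1//.
  rewrite [RHS](esumID [set phi | ~ null_family phi]); last by move=> *; rewrite lee_fin sqnorm_ge0.
  rewrite [X in (_ = _ + X)%E]esum1 ?adde0// => phi [Pphi /contrapT nphi].
  rewrite (Tper_null (hphi _ Pphi) nphi) h0.
  have := hermC l2_hermitian l2_zero lf; rewrite (herm0l l2_subspace l2_hermitian lf) rmorph0 => ->.
  by rewrite sqnorm0.
have := ae_countable (countableP [set: int]) (fun l _ => step l).
apply: ae_imply => xi h; apply: (h (cell 0 xi)) => //.
have := red_period 0 xi; rewrite /red => /periodE/andP[h1 h2].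
by apply/periodE/andP; split; lra.
Qed.

End frame_identity.

(** * Rank-one operators *)

Section rank_one.
Context {R : realType} {n : nat}.
Local Notation C := (Cplx R).
Local Notation E := (int * 'I_n -> C).
Local Notation Re := (@complex.Re R).
Let sH := @l2_subspace R n.
Let hb := @l2_hermitian R n.

Lemma rank1_inner (f a : E) : l2 f -> l2 a -> l2_inner (rank1 f a) a = (sqnorm (l2_inner f a))%:C.
Proof.
by move=> lf la; rewrite /rank1 (hermZl sH hb _ lf la) (hermC hb lf la) mulrC sqnormE.
Qed.

Lemma rank1_positive (f : E) : l2 f -> positive_op (rank1 f).
Proof.
move=> lf; split=> [|a la]; last first.
  by rewrite rank1_inner// lecE /= eqxx sqnorm_ge0.
split=> [a la|z a b la lb|]; first exact: (subspaceZ sH).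
  by rewrite /rank1 (hermDl hb (subspaceZ sH z la) lb lf) (hermZl sH hb z la lf) scalerDl scalerA.
exists (Re (l2_inner f f) ^+ 2) => a la.
have lr : l2 (rank1 f a) by exact: (subspaceZ sH).
rewrite (l2_q lr) (l2_q la) -EFinM lee_fin /rank1 (herm_qZ sH hb _ lf).
have := herm_CS sH hb la lf; have := herm_q_ge0 hb lf => h1 h2.
by rewrite expr2 -mulrA mulrC; apply: ler_wpM2l => //; rewrite mulrC.
Qed.

End rank_one.

Theorem theorem4p4 (R : realType) (N n : nat) (hN : (2 <= N)%N) (hn : (1 <= n)%N)
  (sigma : 'S_n) (theta : 'I_n -> R)
  (htheta : forall k, - pi <= theta k < pi)
  (hz : forall k, zpt theta k ^+ N = zpt theta (sigma k))
  (V : set ('I_n -> R -> Cplx R)) (J : R -> set (int * 'I_n -> Cplx R))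
  (Phi : set ('I_n -> R -> Cplx R))
  (hV : shift_invariant theta V) (hJ : range_function theta V J)
  (hPhi : NTF_generator theta V Phi) :
  [/\ forall A : (int * 'I_n -> Cplx R) -> int * 'I_n -> Cplx R,
        positive_op A ->
        {ae (@lebesgue_measure R), forall xi,
          tau_pos J A xi =
          (\esum_(phi in Phi)
            (complex.Re (l2_inner (A (Tper theta phi xi)) (Tper theta phi xi)))%:E)%E},
      forall A : (int * 'I_n -> Cplx R) -> int * 'I_n -> Cplx R,
        trace_class A ->
        {ae (@lebesgue_measure R), forall xi,
          has_csum Phi
            (fun phi => l2_inner (A (Tper theta phi xi)) (Tper theta phi xi))
            (tau J A xi)} &
      forall f : int * 'I_n -> Cplx R, l2 f ->
        {ae (@lebesgue_measure R), forall xi,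
          tau_vec J f xi =
          (\esum_(phi in Phi)
            (sqnorm (l2_inner f (Tper theta phi xi)))%:E)%E}].
Proof.
have [cJ _ _ _] := hJ.
have fibers := frame_fibers hJ hPhi.
have inl2 xi : (forall phi, Phi phi -> J xi (Tper theta phi xi)) ->
    forall phi, Phi phi -> l2 (Tper theta phi xi).
  by move=> h phi Pphi; exact: (closed_subspace_l2 (cJ xi) (h _ Pphi)).
have positive_case A : positive_op A -> {ae (@lebesgue_measure R), forall xi,
    tau_pos J A xi = (\esum_(phi in Phi)
      (complex.Re (l2_inner (A (Tper theta phi xi)) (Tper theta phi xi)))%:E)%E}.
  move=> pA; have [y [ly hy]] := positive_esum pA.
  have lA a : l2 a -> l2 (A a) by case: pA => -[h _ _] _; exact: h.
  (* The y_j do not depend on xi, so one null set serves them all. *)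
  have := ae_countable (countableP [set: nat]) (fun j _ => frame_identity hJ hPhi (ly j)).
  move=> id; apply: ae_imply2 id fibers => xi idx /inl2 lT.
  exact: (trace_pos_frame (cJ xi) lA ly lT hy (fun j => idx j Logic.I)).
split=> // [A tA|f lf].
  have [g [h [lgh goo hoo ex]]] := trace_class_expansion tA.
  (* All polarization vectors in one countable family: the second index selects a fourth root of
     unity, with default 1 beyond the list. *)
  have lv (p : nat * nat) : l2 (nth 1 (fourth_roots (R := R)) p.2 *: g p.1 + h p.1).
    by apply: l2_subspace.2; case: (lgh p.1).
  have := ae_countable (countableP [set: nat * nat]) (fun p _ => frame_identity hJ hPhi (lv p)).
  move=> id; apply: ae_imply2 id fibers => xi idx /inl2 lT.
  apply: (trace_class_frame (cJ xi) lT lgh goo hoo ex) => j z zin.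
  by have := idx (j, index z fourth_roots) Logic.I; rewrite /= nth_index.
apply: ae_imply2 (positive_case _ (rank1_positive lf)) fibers => xi e /inl2 lT; rewrite /tau_vec e.
by apply: eq_esum => phi Pphi; rewrite (rank1_inner lf (lT _ Pphi)).
Qed.
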